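(* Let $\mathbb{K}$ be an algebraically closed field of characteristic zero and let $X$ be a normal affine algebraic variety over $\mathbb{K}$ of dimension $n$ with a commutative monoid structure of rank $r\in\{0,\,n-1,\,n\}$. Then $X$ is toric, and the multiplication on $X$ is coherent with a multiplication $\bar x\cdot\bar y$ on $\overline{X}=\mathbb{A}^m\times(\mathbb{K}^\times)^{\widetilde m}$, where $\pi\colon\overline{X}\to X$ is the Cox construction. Up to isomorphism of monoid structures on $X$ and $\overline{X}$, the product $\bar x\cdot\bar y$ of $\bar x=(x_1,\dots,x_{m+\widetilde m})$ and $\bar y=(y_1,\dots,y_{m+\widetilde m})$ is given by the following formulas. 1) If $r=n$, then $$\bar x\cdot\bar y=(x_1y_1,\ldots,x_{m+\widetilde m}y_{m+\widetilde m}).$$ 2) If $r=n-1$, then $$\bar x\cdot\bar y=(x_1y_1,\ldots,x_{i-1}y_{i-1},\;x_iy^{\bar e,i}+x^{\bar e,i}y_i,\;x_{i+1}y_{i+1},\ldots,x_{m+\widetilde m}y_{m+\widetilde m}),$$ where $1\le i\le m$, $p_i$ is the primitive vector on the ray $\rho_i$ of the fan of $X$, $e=e_0+\tilde e\in\mathfrak{R}_i=\mathfrak{R}_{i,0}+\mathbb{Z}^{\widetilde m}$ (with $e_0\in\mathfrak{R}_{i,0}$ and $\tilde e=(\tilde e_{m+1},\dots,\tilde e_{m+\widetilde m})\in\mathbb{Z}^{\widetilde m}$) is a Demazure root corresponding to this ray, and $$x^{\bar e,i}=\prod_{\substack{1\le j\le m\\ j\ne i}}x_j^{\langle p_j,e\rangle}\prod_{m<j\le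 m+\widetilde m}x_j^{\tilde e_j}.$$ 3) If $r=0$, then $\overline{X}=X=\mathbb{A}^n$ and $$\bar x\cdot\bar y=(x_1+y_1,\ldots,x_n+y_n).$$
   Context: Monoids. An algebraic monoid is an irreducible algebraic variety with an associative multiplication that is a morphism of varieties and has a unit. Isomorphisms of monoids are isomorphisms of varieties preserving products and units. The set $G(X)$ of invertible elements is a connected algebraic group, open in $X$. If $X$ is affine and commutative, $G(X)\cong\mathbb{G}_m^r\times\mathbb{G}_a^s$, where $\mathbb{G}_m=(\mathbb{K}^\times,\times)$, $\mathbb{G}_a=(\mathbb{K},+)$, and $r$ is the rank of the monoid. Toric notation. A normal irreducible variety $X$ is toric if a torus $T\cong(\mathbb{K}^\times)^n$ acts effectively on it with an open orbit. Let $M$ be the character lattice of $T$ and $N$ the dual lattice, with pairing $\langle\cdot,\cdot\rangle$. For affine toric $X$, $\mathbb{K}[X]=\bigoplus_{u\in S_X}\mathbb{K}\chi^u$ with $S_X=M\cap\omega$, where $\omega\subseteq M_{\mathbb{Q}}$ is a rational polyhedral cone; $\sigma\subseteq N_{\mathbb{Q}}$ is the dual cone, the fan of $X$ consists of the faces of $\sigma$, $\rho_1,\dots,\rho_m$ are the rays of $\sigma$, and $p_i\in N$ is the primitive lattice vector on $\rho_i$. The Demazure roots corresponding to $\rho_i$ are the elements of $\mathfrak{R}_i=\{e\in M\mid\langle p_i,e\rangle=-1,\ \langle p_j,e\rangle\ge0\text{ for all }j\ne i\}$. Cox construction. Let $N_0=\mathrm{span}(\sigma)\cap N$ and let $\widetilde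 m$ be the codimension of $\mathrm{span}(\sigma)$ in $N_{\mathbb{Q}}$. Fix a splitting $N=N_0\oplus\mathbb{Z}^{\widetilde m}$ and the dual splitting $M=M_0\oplus\mathbb{Z}^{\widetilde m}$; correspondingly $X=X_0\times(\mathbb{K}^\times)^{\widetilde m}$, where $X_0$ is the affine toric variety of the cone $\sigma\subseteq(N_0)_{\mathbb{Q}}$, and $\mathfrak{R}_i=\mathfrak{R}_{i,0}+\mathbb{Z}^{\widetilde m}$, where $\mathfrak{R}_{i,0}\subseteq M_0$ is the set of Demazure roots of $X_0$ corresponding to $\rho_i$. Write $u=u_0+\tilde u\in M$ with $u_0\in M_0$ and $\tilde u=(\tilde u_{m+1},\dots,\tilde u_{m+\widetilde m})\in\mathbb{Z}^{\widetilde m}$. Let $\overline{X}=\mathbb{A}^m\times(\mathbb{K}^\times)^{\widetilde m}$ with coordinates $x_1,\dots,x_m$ on $\mathbb{A}^m$ and $x_{m+1},\dots,x_{m+\widetilde m}$ on $(\mathbb{K}^\times)^{\widetilde m}$. The Cox construction is the morphism $\pi\colon\overline{X}\to X$ whose comorphism $\mathbb{K}[X]\hookrightarrow\mathbb{K}[\overline{X}]=\mathbb{K}[x_1,\dots,x_m,x_{m+1}^{\pm1},\dots,x_{m+\widetilde m}^{\pm1}]$ is $$\chi^u\mapsto\chi^{\bar u}:=\prod_{j=1}^m x_j^{\langle p_j,u\rangle}\prod_{j=m+1}^{m+\widetilde m}x_j^{\tilde u_j},\qquad u\in S_X.$$ It is the categorical quotient of $\overline{X}$ by the quasitorus $H_X=\mathrm{Hom}(\mathrm{Cl}(X),\mathbb{K}^\times)$.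 Coherence. A monoid multiplication $\mu\colon X\times X\to X$ is coherent with a monoid multiplication $\bar\mu\colon\overline{X}\times\overline{X}\to\overline{X}$ if $\pi\circ\bar\mu=\mu\circ(\pi\times\pi)$. *)

(* Defs.v *)
From mathcomp Require Export all_boot all_order all_algebra.
From mathcomp Require Export mpoly.

Set Implicit Arguments.
Unset Strict Implicit.
Unset Printing Implicit Defensive.

Import Order.TTheory GRing.Theory Num.Theory.
Local Open Scope ring_scope.

(* Varieties are the classical quasi-affine ones: irreducible locally closed
   sets of K-points of an affine space.  Functions and maps between them are
   total MathComp functions of which only the values on the variety matter. *)
Section Varieties.
Variable K : closedFieldType.

Definition aset (N : nat) := 'rV[K]_N -> Prop.

Definition pval N (p : {mpoly K[N]}) (x : 'rV[K]_N) : K := p.@[fun i => x 0 i].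

Definition zariski_closed N (Z : aset N) : Prop :=
  exists S : {mpoly K[N]} -> Prop,
    forall x, Z x <-> (forall p, S p -> pval p x = 0).

Definition open_in N (X U : aset N) : Prop :=
  exists2 Z : aset N, zariski_closed Z & forall x, U x <-> X x /\ ~ Z x.

Definition locally_closed N (X : aset N) : Prop :=
  exists2 Z : aset N, zariski_closed Z & open_in Z X.

Definition irreducible N (X : aset N) : Prop :=
  (exists x, X x) /\
  forall Z1 Z2 : aset N, zariski_closed Z1 -> zariski_closed Z2 ->
    (forall x, X x -> Z1 x \/ Z2 x) ->
    (forall x, X x -> Z1 x) \/ (forall x, X x -> Z2 x).

Definition variety N (X : aset N) : Prop := locally_closed X /\ irreducible X.

Definition affine_variety N (X : aset N) : Prop :=
  zariski_closed X /\ irreducible X.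

Definition regular N (X : aset N) (f : 'rV[K]_N -> K) : Prop :=
  forall x, X x -> exists U (p q : {mpoly K[N]}),
    [/\ open_in X U, U x &
        forall y, U y -> pval q y != 0 /\ f y = pval p y / pval q y].

Definition morphism N N' (X : aset N) (Y : aset N') (f : 'rV[K]_N -> 'rV[K]_N')
  : Prop :=
  (forall x, X x -> Y (f x)) /\ (forall j, regular X (fun x => f x 0 j)).

Definition inverse_on N N' (X : aset N) (Y : aset N')
    (f : 'rV[K]_N -> 'rV[K]_N') (g : 'rV[K]_N' -> 'rV[K]_N) : Prop :=
  (forall x, X x -> g (f x) = x) /\ (forall y, Y y -> f (g y) = y).

Definition var_iso N N' (X : aset N) (Y : aset N') (f : 'rV[K]_N -> 'rV[K]_N')
  : Prop :=
  exists g, [/\ morphism X Y f, morphism Y X g & inverse_on X Y f g].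

Definition prod_set N N' (X : aset N) (Y : aset N') : aset (N + N') :=
  fun z => X (lsubmx z) /\ Y (rsubmx z).

(* A rational function on an irreducible X is written f / g with f, g regular
   and g not identically zero on X; an identity in K(X) is an identity at all
   points where the denominators do not vanish. *)
Definition nonzero_on N (X : aset N) (g : 'rV[K]_N -> K) : Prop :=
  exists2 x, X x & g x != 0.

Definition integral_fraction N (X : aset N) (f g : 'rV[K]_N -> K) : Prop :=
  exists (d : nat) (a : 'I_d -> 'rV[K]_N -> K),
    (forall i, regular X (a i)) /\
    (forall x, X x -> g x != 0 ->
       (f x / g x) ^+ d + \sum_(i < d) a i x * (f x / g x) ^+ i = 0).

(* K[X] is integrally closed in K(X); this is normality when X is affine. *)
Definition normal_affine N (X : aset N) : Prop :=
  forall f g, regular X f -> regular X g -> nonzero_on X g ->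
    integral_fraction X f g ->
    exists2 h, regular X h & forall x, X x -> g x != 0 -> h x = f x / g x.

Definition alg_independent N (X : aset N) k (f g : 'I_k -> 'rV[K]_N -> K)
  : Prop :=
  (forall i, [/\ regular X (f i), regular X (g i) & nonzero_on X (g i)]) /\
  (forall P : {mpoly K[k]},
     (forall x, X x -> (forall i, g i x != 0) ->
        P.@[fun i => f i x / g i x] = 0) -> P = 0).

(* dim X is the transcendence degree of K(X) over K. *)
Definition has_dim N (X : aset N) (n : nat) : Prop :=
  (exists f g, @alg_independent N X n f g) /\
  ~ (exists f g, @alg_independent N X n.+1 f g).

Definition is_unit N (X : aset N) (mu : 'rV[K]_N -> 'rV[K]_N -> 'rV[K]_N)
    (e : 'rV[K]_N) : Prop :=
  X e /\ forall x, X x -> mu e x = x /\ mu x e = x.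

Definition alg_monoid N (X : aset N) (mu : 'rV[K]_N -> 'rV[K]_N -> 'rV[K]_N)
  : Prop :=
  [/\ variety X,
      morphism (prod_set X X) X (fun z => mu (lsubmx z) (rsubmx z)),
      forall x y z, X x -> X y -> X z -> mu x (mu y z) = mu (mu x y) z
    & exists e, is_unit X mu e].

Definition commutative_on N (X : aset N)
    (mu : 'rV[K]_N -> 'rV[K]_N -> 'rV[K]_N) : Prop :=
  forall x y, X x -> X y -> mu x y = mu y x.

Definition monoid_iso N N' (X : aset N) (mu : 'rV[K]_N -> 'rV[K]_N -> 'rV[K]_N)
    (Y : aset N') (nu : 'rV[K]_N' -> 'rV[K]_N' -> 'rV[K]_N')
    (f : 'rV[K]_N -> 'rV[K]_N') : Prop :=
  [/\ var_iso X Y f,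
      forall x y, X x -> X y -> f (mu x y) = nu (f x) (f y)
    & forall e, is_unit X mu e -> is_unit Y nu (f e)].

Definition unit_group N (X : aset N) (mu : 'rV[K]_N -> 'rV[K]_N -> 'rV[K]_N)
  : aset N :=
  fun x => X x /\ exists2 y, X y & is_unit X mu (mu x y) /\ is_unit X mu (mu y x).

(* G_m^r x G_a^s, as an open subset of affine (r + s)-space. *)
Definition GmGa r s : aset (r + s) :=
  fun x => forall j : 'I_r, x 0 (lshift s j) != 0.

Definition GmGa_mul r s (x y : 'rV[K]_(r + s)) : 'rV[K]_(r + s) :=
  \row_k match split k with
         | inl _ => x 0 k * y 0 k
         | inr _ => x 0 k + y 0 k
         end.

Definition monoid_rank N (X : aset N) (mu : 'rV[K]_N -> 'rV[K]_N -> 'rV[K]_N)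
    (r : nat) : Prop :=
  exists s phi, monoid_iso (@GmGa r s) (@GmGa_mul r s) (unit_group X mu) mu phi.

Definition torus n : aset n := fun t => forall i, t 0 i != 0.

Definition torus_one n : 'rV[K]_n := const_mx 1.

Definition torus_mul n (s t : 'rV[K]_n) : 'rV[K]_n := \row_i (s 0 i * t 0 i).

(* x0 is a base point of the open orbit. *)
Definition toric_action N (X : aset N) n
    (act : 'rV[K]_n -> 'rV[K]_N -> 'rV[K]_N) (x0 : 'rV[K]_N) : Prop :=
  [/\ morphism (prod_set (@torus n) X) X (fun z => act (lsubmx z) (rsubmx z)),
      (forall x, X x -> act (torus_one n) x = x) /\
      (forall s t x, torus s -> torus t -> X x ->
         act (torus_mul s t) x = act s (act t x)),
      forall t, torus t -> (forall x, X x -> act t x = x) -> t = torus_one n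
    & X x0 /\ open_in X (fun x => exists2 t, torus t & x = act t x0)].

Definition affine_toric N (X : aset N) : Prop :=
  [/\ affine_variety X, normal_affine X
    & exists n act x0, @toric_action N X n act x0].

End Varieties.

Arguments torus {K n}.
Arguments torus_one {K n}.

(* For T = (K^x)^n the character lattice M and its dual N are both Z^n, with
   the standard pairing; u in M is the character t |-> \prod_i t_i ^ u_i. *)
Definition pairing (R : pzRingType) n (v u : 'rV[R]_n) : R :=
  \sum_i v 0 i * u 0 i.

Definition toQ n (v : 'rV[int]_n) : 'rV[rat]_n := map_mx intr v.

Section Cones.
Variable n : nat.
Implicit Types C F : 'rV[rat]_n -> Prop.

Definition cone_span C : 'rV[rat]_n -> Prop := fun w =>
  exists k (a : 'I_k -> rat) (s : 'I_k -> 'rV[rat]_n),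
    (forall i, 0 <= a i /\ C (s i)) /\ w = \sum_i a i *: s i.

Definition lin_span C : 'rV[rat]_n -> Prop := fun w =>
  exists k (a : 'I_k -> rat) (s : 'I_k -> 'rV[rat]_n),
    (forall i, C (s i)) /\ w = \sum_i a i *: s i.

Definition dual_cone C : 'rV[rat]_n -> Prop := fun v =>
  forall w, C w -> 0 <= pairing v w.

Definition is_face C F : Prop :=
  exists2 u, dual_cone C u & forall v, F v <-> C v /\ pairing v u = 0.

Definition primitive (v : 'rV[int]_n) : Prop :=
  forall (k : int) (w : 'rV[int]_n), v = k *: w -> `|k| = 1.

Definition primitive_on_ray C (v : 'rV[int]_n) : Prop :=
  primitive v /\
  is_face C (fun w => exists2 c : rat, 0 <= c & w = c *: toQ v).

(* The b_j form a basis of a complement of N_0 in the lattice N. *)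
Definition splitting (N0 : 'rV[int]_n -> Prop) mt (b : 'I_mt -> 'rV[int]_n)
  : Prop :=
  forall v : 'rV[int]_n, exists! vc : 'rV[int]_n * 'rV[int]_mt,
    N0 vc.1 /\ v = vc.1 + \sum_j vc.2 0 j *: b j.

Definition demazure_root m (p : 'I_m -> 'rV[int]_n) (i : 'I_m)
    (e : 'rV[int]_n) : Prop :=
  pairing (p i) e = -1 /\ forall j, j != i -> 0 <= pairing (p j) e.

End Cones.

Section Cox.
Variable K : closedFieldType.
Variables (N : nat) (X : aset K N) (n : nat).
Variables (act : 'rV[K]_n -> 'rV[K]_N -> 'rV[K]_N) (x0 : 'rV[K]_N).

Definition character (u : 'rV[int]_n) (t : 'rV[K]_n) : K :=
  \prod_i t 0 i ^ u 0 i.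

(* f is chi^u, seen as a regular function on X through the orbit map. *)
Definition extends_character (u : 'rV[int]_n) (f : 'rV[K]_N -> K) : Prop :=
  regular X f /\ forall t, torus t -> f (act t x0) = character u t.

Definition weight_monoid (u : 'rV[int]_n) : Prop :=
  exists f, extends_character u f.

Definition omega : 'rV[rat]_n -> Prop :=
  cone_span (fun w => exists2 u, weight_monoid u & w = toQ u).

Definition sigma : 'rV[rat]_n -> Prop := dual_cone omega.

Definition lattice_span_sigma (v : 'rV[int]_n) : Prop := lin_span sigma (toQ v).

Variables m mt : nat.

Definition Xbar : aset K (m + mt) :=
  fun x => forall j : 'I_mt, x 0 (rshift m j) != 0.

Variables (p : 'I_m -> 'rV[int]_n) (b : 'I_mt -> 'rV[int]_n).

(* With the splitting M = M_0 + Z^mt dual to the one given by b, i.e. with M_0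
   the annihilator of the b_j and Z^mt spanned by the basis dual to b, the j-th
   coordinate of the Z^mt-component of u is pairing (b j) u. *)
Definition cox_monomial (u : 'rV[int]_n) (x : 'rV[K]_(m + mt)) : K :=
  (\prod_(j < m) x 0 (lshift mt j) ^ pairing (p j) u) *
  (\prod_(j < mt) x 0 (rshift m j) ^ pairing (b j) u).

Record cox_construction (pi : 'rV[K]_(m + mt) -> 'rV[K]_N) : Prop := {
  cox_rays_inj : injective p;
  cox_rays : forall v, primitive_on_ray sigma v <-> exists i, v = p i;
  cox_splitting : splitting lattice_span_sigma b;
  cox_morphism : morphism Xbar X pi;
  cox_comorphism : forall u f, extends_character u f ->
    forall x, Xbar x -> f (pi x) = cox_monomial u x }.

Definition root_monomial (i : 'I_m) (e : 'rV[int]_n) (x : 'rV[K]_(m + mt)) : K :=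
  (\prod_(j < m | j != i) x 0 (lshift mt j) ^ pairing (p j) e) *
  (\prod_(j < mt) x 0 (rshift m j) ^ pairing (b j) e).

Definition mul_root (i : 'I_m) (e : 'rV[int]_n) (x y : 'rV[K]_(m + mt))
  : 'rV[K]_(m + mt) :=
  \row_k (if k == lshift mt i
          then x 0 k * root_monomial i e y + root_monomial i e x * y 0 k
          else x 0 k * y 0 k).

Definition coherent (pi : 'rV[K]_(m + mt) -> 'rV[K]_N)
    (mu : 'rV[K]_N -> 'rV[K]_N -> 'rV[K]_N)
    (mubar : 'rV[K]_(m + mt) -> 'rV[K]_(m + mt) -> 'rV[K]_(m + mt)) : Prop :=
  forall x y, Xbar x -> Xbar y -> pi (mubar x y) = mu (pi x) (pi y).

End Cox.

(* Main.v *)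
Require Import Defs.
From HB Require Import structures.
From Stdlib Require Import Classical ClassicalEpsilon.
From mathcomp Require Import ring zify.

Set Implicit Arguments.
Unset Strict Implicit.
Unset Printing Implicit Defensive.

Import Order.TTheory GRing.Theory Num.Theory.
Local Open Scope ring_scope.

(** Let G = G_m^r x G_a^s be the group of units and [phi] its embedding into X.

    The units form a principal open subset of X.  By the Nullstellensatz
    regular functions on closed sets are polynomials, so X acts by matrices on
    the finite-dimensional space spanned by the translates of the coordinate
    functions, and a point is invertible exactly when its matrix is
    ([unit_group_principal_open]).  So G is dense, K[X] becomes a space of Laurent
    polynomials on G, and comparing transcendence degrees gives n = r + s.  The
    hypothesis on r says that s = 0, s = 1 or r = 0.

    In these cases K[X] is spanned by monomials ([monomials_split]).  As a
    space stable under translations by G, it contains with a function also its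
    parts t^w q(z), where z are the additive coordinates
    ([eigenvectors_in_subspace]).  For s = 0 these are monomials.  For s = 1
    the differences of q(z + 1) and q(z) show, in characteristic zero, that with
    t^w q(z) all t^w z^k with k at most deg q belong to K[X]
    ([shift_stable_polys]).  For r = 0 the equation of the nonunits is a
    polynomial without zeros on the affine space G, hence constant, so X = G.
    Therefore rescaling all coordinates of G extends to X, and X is toric with
    base point phi(1, .., 1).

    The cone sigma is cut out by finitely many weights, so it has finitely many
    rays, and the lattice of its span is saturated, so it has a complement.  The
    Cox map replaces every character in the coordinates of X by its Cox monomial.
    On the torus of Xbar it is [phi] after a homomorphism of tori ([cox_torus]), and
    identities involving it are checked there and extended by irreducibility
    ([gfrac_density], [coherent_on_torus]).

    For r = n that homomorphism gives the coordinatewise product.  For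
    r = n - 1 the weights have nonnegative last coordinate and can be lowered to
    last coordinate zero.  So the last basis vector spans a ray of sigma, of index
    i say, and the primitive vectors of the other rays have nonpositive last
    coordinate: minus the last basis vector of M is a Demazure root e.  The
    additive coordinate of G is z = x_i / x^{e,i} in Cox coordinates, and z + z'
    gives the formula.  For r = 0 the Cox map is the isomorphism [phi].  In each
    case the multiplication obtained is already of the stated
    form, so the isomorphisms are identities. *)

(** * Translation-stable spaces of functions *)

(** Subtracting [lam a i] times a sum of eigenfunctions from its translate by [a]
    kills the [i]-th term and only rescales the others, so induction on the
    number of terms isolates each of them.  With [V] the zero space this is the
    linear independence of characters; with [V] the functions on a monoid it
    splits a function into homogeneous parts. *)
Lemma eigenvectors_in_subspace (K : fieldType) (I : eqType) (D A : Type)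
    (dom : D -> Prop) (V : (D -> K) -> Prop) (Ad : A -> Prop)
    (rho : A -> D -> D) (lam : A -> I -> K) :
    (forall h h', (forall x, dom x -> h x = h' x) -> V h -> V h') ->
    V (fun=> 0) ->
    (forall h h', V h -> V h' -> V (fun x => h x + h' x)) ->
    (forall c h, V h -> V (fun x => c * h x)) ->
    (forall a h, Ad a -> V h -> V (fun x => h (rho a x))) ->
    (forall i j, i != j -> exists2 a, Ad a & lam a i != lam a j) ->
  forall (E : seq I) (F : I -> D -> K), uniq E ->
    (forall a i x, Ad a -> dom x -> F i (rho a x) = lam a i * F i x) ->
    V (fun x => \sum_(i <- E) F i x) -> forall i, i \in E -> V (F i).
Proof.
move=> Vext V0 VD VZ Vrho sep; elim=> [//|i E IH] F /= /andP[iE uE] eig VF.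
have VE j : j \in E -> V (F j).
  move=> jE; have [a Aa aij] : exists2 a, Ad a & lam a i != lam a j.
    by apply: sep; apply: contra iE => /eqP ->.
  have := IH (fun k x => (lam a k - lam a i) * F k x) uE.
  have eig' b k x : Ad b -> dom x -> (lam a k - lam a i) * F k (rho b x)
      = lam b k * ((lam a k - lam a i) * F k x).
    by move=> Ab Dx; rewrite eig //; ring.
  have VD' : V (fun x => \sum_(k <- E) (lam a k - lam a i) * F k x).
    apply: Vext (VD _ _ (Vrho a _ Aa VF) (VZ (- lam a i) _ VF)) => x Dx.
    rewrite !big_cons mulrDr addrACA eig // -mulrDl subrr mul0r add0r.
    rewrite big_distrr /= -big_split /=; apply: eq_bigr => k _.
    by rewrite eig //; ring.
  move=> /(_ eig' VD' j jE) /(VZ (lam a j - lam a i)^-1); apply: Vext => x _.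
  by rewrite mulKf // subr_eq0 eq_sym.
move=> j; rewrite inE => /orP[/eqP ->|/VE //].
have VS s : {subset s <= E} -> V (fun x => \sum_(k <- s) F k x).
  elim: s => [_|k s IHs sE]; first by apply: Vext V0 => x _; rewrite big_nil.
  have Vk : V (F k) by apply/VE/sE; rewrite mem_head.
  have Vs := IHs (fun k' k'E => sE k' (mem_behead (s := k :: s) k'E)).
  by apply: Vext (VD _ _ Vk Vs) => x _; rewrite big_cons.
apply: Vext (VD _ _ VF (VZ (-1) _ (VS E _))) => // x Dx.
by rewrite big_cons mulN1r addrK.
Qed.

(** * Polynomials as functions *)

Section Pval.
Variable K : closedFieldType.
Variable n : nat.
Implicit Types (p q : {mpoly K[n]}) (x : 'rV[K]_n).

Lemma pvalD p q x : pval (p + q) x = pval p x + pval q x.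
Proof. exact: mevalD. Qed.
Lemma pvalB p q x : pval (p - q) x = pval p x - pval q x.
Proof. exact: mevalB. Qed.
Lemma pvalN p x : pval (- p) x = - pval p x.
Proof. exact: mevalN. Qed.
Lemma pvalM p q x : pval (p * q) x = pval p x * pval q x.
Proof. exact: mevalM. Qed.
Lemma pvalC c x : pval c%:MP_[n] x = c.
Proof. exact: mevalC. Qed.
Lemma pval0 x : pval 0 x = 0.
Proof. exact: meval0. Qed.
Lemma pval1 x : pval 1 x = 1.
Proof. exact: meval1. Qed.
Lemma pvalX i x : pval 'X_i x = x 0 i.
Proof. exact: mevalXU. Qed.
Lemma pvalXm m x : pval 'X_[m] x = \prod_i x 0 i ^+ m i.
Proof. exact: mevalX. Qed.
Lemma pvalZ c p x : pval (c *: p) x = c * pval p x.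
Proof. exact: mevalZ. Qed.
Lemma pvalXn p k x : pval (p ^+ k) x = pval p x ^+ k.
Proof. by rewrite /pval rmorphXn. Qed.
Lemma pval_sum I (s : seq I) (P : pred I) (F : I -> {mpoly K[n]}) x :
  pval (\sum_(i <- s | P i) F i) x = \sum_(i <- s | P i) pval (F i) x.
Proof. by rewrite /pval rmorph_sum. Qed.
Lemma pval_prod I (s : seq I) (P : pred I) (F : I -> {mpoly K[n]}) x :
  pval (\prod_(i <- s | P i) F i) x = \prod_(i <- s | P i) pval (F i) x.
Proof. by rewrite /pval rmorph_prod. Qed.
Lemma pvalE p x :
  pval p x = \sum_(m <- msupp p) p@_m * \prod_i x 0 i ^+ m i.
Proof. exact: mevalE. Qed.

Definition pvals := (pvalD, pvalB, pvalN, pvalM, pvalC, pval0, pval1, pvalX,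
  pvalXm, pvalZ, pvalXn, pval_sum, pval_prod).

Hypothesis charK : [pchar K] =i pred0.

Lemma pow2_inj a b : 2%:R ^+ a = 2%:R ^+ b :> K -> a = b.
Proof.
rewrite -!natrX => e; have inj := (pcharf0P K).1 charK.
wlog lab : a b e / (a <= b)%N.
  by move=> W; case: (leqP a b) => [/W|/ltnW/W H]; [apply | symmetry; apply: H].
have : (2 ^ b - 2 ^ a)%:R == 0 :> K.
  by rewrite natrB ?leq_exp2l // e subrr.
rewrite inj subn_eq0 leq_exp2l // => lba.
by apply/eqP; rewrite eqn_leq lab lba.
Qed.

Lemma two_neq0 : 2%:R != 0 :> K.
Proof. by rewrite ((pcharf0P K).1 charK). Qed.

Lemma torus_mulP (a x : 'rV[K]_n) : torus a -> torus x -> torus (torus_mul a x).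
Proof. by move=> ta tx i; rewrite mxE mulf_neq0. Qed.

(** Monomials are distinct characters of the torus: in characteristic zero the
    powers of 2 are distinct, so a point with one coordinate 2 and the others 1
    tells two monomials apart. *)
Lemma pval_torus_eq0 p : (forall x, torus x -> pval p x = 0) -> p = 0.
Proof.
move=> p0; apply/mpolyP => m; rewrite mcoeff0.
case: (boolP (m \in msupp p)) => [mp|/memN_msupp_eq0 //].
suff /(_ (const_mx 1)) : forall x, torus x -> p@_m * \prod_i x 0 i ^+ m i = 0.
  rewrite big1 ?mulr1 => [->//|i _]; last by rewrite mxE expr1n.
  by move=> i; rewrite mxE oner_neq0.
apply: (@eigenvectors_in_subspace K _ _ _ (@torus K n)
  (fun h => forall x, torus x -> h x = 0) (@torus K n) (@torus_mul K n)
  (fun a (m : 'X_{1..n}) => \prod_i a 0 i ^+ m i) _ _ _ _ _ _ (msupp p)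
  (fun m x => p@_m * \prod_i x 0 i ^+ m i)) => //.
- by move=> h h' e h0 x tx; rewrite -e ?h0.
- by move=> h h' h0 h0' x tx; rewrite h0 ?h0' ?addr0.
- by move=> c h h0 x tx; rewrite h0 ?mulr0.
- by move=> a h ta h0 x tx; rewrite h0 //; apply: torus_mulP.
- move=> m1 m2 m12; have [i mi] : exists i, m1 i != m2 i.
    apply/existsP; apply: contraNT m12 => /existsPn H.
    by apply/eqP/mnmP => i; have := H i; rewrite negbK => /eqP.
  exists (\row_j if j == i then 2%:R else 1).
    by move=> j; rewrite mxE; case: ifP; rewrite ?two_neq0 ?oner_neq0.
  have E (m0 : 'X_{1..n}) :
    \prod_j (\row_j (if j == i then 2%:R else 1 : K)) 0 j ^+ m0 j = 2%:R ^+ m0 i.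
    rewrite (bigD1 i) //= big1 ?mulr1 ?mxE ?eqxx // => j /negPf ji.
    by rewrite mxE ji expr1n.
  by rewrite !E; apply: contra mi => /eqP/pow2_inj ->.
- move=> a m1 x _ _; rewrite mulrCA -big_split /=; congr (_ * _).
  by apply: eq_bigr => i _; rewrite mxE exprMn.
Qed.

Lemma pval_eq0 p : (forall x, pval p x = 0) -> p = 0.
Proof. by move=> p0; apply: pval_torus_eq0 => x _. Qed.

End Pval.

(** * The Nullstellensatz *)

Definition is_ideal (R : comNzRingType) (J : R -> Prop) : Prop :=
  [/\ J 0, forall a b, J a -> J b -> J (a + b) & forall a b, J b -> J (a * b)].

Lemma ideal_sum (R : comNzRingType) (J : R -> Prop) : is_ideal J ->
  forall (I : Type) (s : seq I) (a F : I -> R), (forall i, J (F i)) ->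
  J (\sum_(i <- s) a i * F i).
Proof.
move=> [J0 JD JM] I s a F JF; elim: s => [|i s IH]; first by rewrite big_nil.
by rewrite big_cons; apply: JD => //; apply: JM.
Qed.

Lemma poly_sum_lt (R : nzRingType) d (p : {poly R}) : (size p <= d)%N ->
  p = \sum_(l < d) p`_l *: 'X^l.
Proof.
move=> sp; rewrite -poly_def; apply/polyP => l; rewrite coef_poly.
by case: ltnP => // dl; rewrite nth_default // (leq_trans sp).
Qed.

(** The determinant trick, in the role of a resultant.  Modulo the monic [g],
    multiplication by [f] is a matrix [F] over [R] that sends (1, X, X^2, ..) into
    [I]; multiplying by the adjugate puts [\det F] itself into [I].  Since [f]
    specialises to the constant [k], so does [F] to [k%:M], and [\det F] does not
    vanish at [ev]. *)
Lemma monic_ideal_lifts_unit (R : comNzRingType) (L : fieldType)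
    (ev : {rmorphism R -> L}) (I : {poly R} -> Prop) (f g : {poly R}) k :
    is_ideal I -> g \is monic -> I g -> I f -> k != 0 ->
    map_poly ev f = k%:P ->
  exists2 c, I c%:P & ev c != 0.
Proof.
move=> idI mg Ig If k0 evf; have [I0 ID IM] := idI.
have sg : (0 < size g)%N by rewrite lt0n size_poly_eq0 monic_neq0.
pose d := (size g).-1; have dE : size g = d.+1 by rewrite prednK.
pose F : 'M[R]_d := \matrix_(j, l) (Pdiv.Ring.rmodp (f * 'X^j) g)`_l.
have sr j : (size (Pdiv.Ring.rmodp (f * 'X^j) g) <= d)%N.
  by rewrite -ltnS -dE Pdiv.Ring.ltn_rmodpN0 // monic_neq0.
have evF : map_mx ev F = k%:M.
  apply/matrixP => j l; rewrite !mxE.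
  have mg' : map_poly ev g \is monic by apply: monic_map.
  have := congr1 (map_poly ev) (Pdiv.RingMonic.rdivp_eq mg (f * 'X^j)).
  rewrite rmorphD !rmorphM /= evf map_polyXn => E.
  have sg' : size (map_poly ev g) = d.+1.
    by rewrite size_map_poly_id0 // (monicP mg) rmorph1 oner_neq0.
  have := Pdiv.RingMonic.rmodp_addl_mul_small mg'.
  move=> /(_ (map_poly ev (Pdiv.Ring.rdivp (f * 'X^j) g))
             (map_poly ev (Pdiv.Ring.rmodp (f * 'X^j) g))).
  rewrite sg' ltnS -E => /(_ (leq_trans (size_poly _ _) (sr j))) E1.
  have := Pdiv.RingMonic.rmodp_addl_mul_small mg' 0 (r := k%:P * 'X^j).
  rewrite mul0r add0r E1 sg' ltnS => E2.
  rewrite -coef_map E2 ?coefCM ?coefXn 1?eq_sym ?mulr_natr //.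
  by rewrite size_Cmul // size_polyXn.
have JF (j : 'I_d) : I (\sum_l (F j l)%:P * 'X^l).
  have -> : \sum_l (F j l)%:P * 'X^l = Pdiv.Ring.rmodp (f * 'X^j) g.
    rewrite [RHS](poly_sum_lt (sr j)); apply: eq_bigr => l _.
    by rewrite mxE mul_polyC.
  have -> : Pdiv.Ring.rmodp (f * 'X^j) g =
      'X^j * f + (- Pdiv.Ring.rdivp (f * 'X^j) g) * g.
    rewrite (mulrC 'X^j) mulNr; apply/esym/eqP; rewrite subr_eq addrC.
    exact/eqP/Pdiv.RingMonic.rdivp_eq.
  by apply: ID; apply: IM.
exists (\det F); last first.
  by rewrite -det_map_mx evF det_scalar expf_neq0.
case: (posnP d) => [d0|d_gt0].
  have -> : (\det F)%:P = (\det F)%:P * g; last by apply: IM.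
  suff -> : g = 1 by rewrite mulr1.
  have := mg; rewrite monicE lead_coefE dE d0 /= => /eqP g0.
  by rewrite (size1_polyC (p := g)) ?g0 // dE d0.
have -> : (\det F)%:P = \sum_(j <- enum 'I_d)
    (\adj F (Ordinal d_gt0) j)%:P * (\sum_l (F j l)%:P * 'X^l).
  rewrite big_enum /=; transitivity
      (\sum_(l < d) ((\adj F *m F) (Ordinal d_gt0) l)%:P * 'X^l).
    rewrite mul_adj_mx (bigD1 (Ordinal d_gt0)) //= big1.
      by rewrite mxE eqxx mulr1n expr0 mulr1 addr0.
    by move=> l /negPf; rewrite eq_sym => n0; rewrite mxE n0 mulr0n mul0r.
  under [RHS]eq_bigr do rewrite big_distrr /=.
  rewrite exchange_big /=; apply: eq_bigr => l _.
  rewrite mxE rmorph_sum /= big_distrl /=; apply: eq_bigr => j _.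
  by rewrite rmorphM mulrA.
exact: ideal_sum.
Qed.

Lemma mpoly_rmorph_eq (R S : comNzRingType) n
    (f g : {rmorphism {mpoly R[n]} -> S}) :
  (forall c, f c%:MP = g c%:MP) -> (forall i, f 'X_i = g 'X_i) -> f =1 g.
Proof.
move=> fgC fgX p; rewrite (mpolyE p) !rmorph_sum /=; apply: eq_bigr => m _.
rewrite -mul_mpolyC !rmorphM /= fgC mpolyXE_id !rmorph_prod; congr (_ * _).
by apply: eq_bigr => i _; rewrite !rmorphXn /= fgX.
Qed.

(** The coefficient in a degree that bounds the degree: contrary to the leading
    coefficient it may be zero, which makes it multiplicative and additive
    without case distinctions. *)
Definition degree_top (R : nzRingType) d (h : {poly R}) v :=
  (size h <= d.+1)%N /\ h`_d = v.

Lemma degree_topM (R : comNzRingType) d e (h k : {poly R}) v w :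
  degree_top d h v -> degree_top e k w -> degree_top (d + e) (h * k) (v * w).
Proof.
move=> [sh hv] [sk kw]; split.
  apply: leq_trans (size_polyMleq _ _) _; move: sh sk; lia.
have dlt : (d < (d + e).+1)%N by rewrite ltnS leq_addr.
rewrite coefM (bigD1 (Ordinal dlt)) //= addKn hv kw big1 ?addr0 // => i.
rewrite -val_eqE /= => ine.
case: (ltngtP i d) ine => // id _.
  rewrite [k`__]nth_default ?mulr0 //; apply: leq_trans sk _; lia.
by rewrite [h`__]nth_default ?mul0r //; apply: leq_trans sh _.
Qed.

Lemma degree_topX (R : comNzRingType) d (h : {poly R}) v k :
  degree_top d h v -> degree_top (k * d) (h ^+ k) (v ^+ k).
Proof.
move=> t; elim: k => [|k IH]; last by rewrite !exprS mulSn; apply: degree_topM.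
by rewrite !expr0 mul0n; split; rewrite ?size_poly1 // coefC.
Qed.

Section GenericProjection.
Variables (K : closedFieldType) (n : nat) (c : 'I_n.+1 -> K).
Hypothesis c_max : c ord_max != 0.

(** The linear change of coordinates X_i = a_i + c_i Y, where a_i = 0 for the last
    index.  If the top form of a polynomial does not vanish at [c], it becomes
    monic in Y up to a constant. *)
Definition shear_coord (i : 'I_n.+1) : {poly {mpoly K[n]}} :=
  (if unlift ord_max i is Some j then 'X_j else 0)%:P + (c i)%:MP%:P * 'X.

Definition shear : {mpoly K[n.+1]} -> {poly {mpoly K[n]}} :=
  mmap (polyC \o @mpolyC n K) shear_coord.

Definition unshear_coef : {mpoly K[n]} -> {mpoly K[n.+1]} :=
  mmap (@mpolyC n.+1 K) (fun j =>
    'X_(lift ord_max j) - (c (lift ord_max j) / c ord_max) *: 'X_ord_max).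

Definition unshear : {poly {mpoly K[n]}} -> {mpoly K[n.+1]} :=
  horner_eval ((c ord_max)^-1 *: 'X_ord_max) \o map_poly unshear_coef.

Definition shear_point (a : 'rV[K]_n) (y : K) : 'rV[K]_n.+1 :=
  \row_i ((if unlift ord_max i is Some j then a 0 j else 0) + c i * y).

HB.instance Definition _ := GRing.RMorphism.copy shear (mmap _ shear_coord).
HB.instance Definition _ := GRing.RMorphism.copy unshear_coef (mmap _ _).
HB.instance Definition _ := GRing.RMorphism.copy unshear
  (horner_eval ((c ord_max)^-1 *: 'X_ord_max) \o map_poly unshear_coef).

Lemma shearX i : shear 'X_i = shear_coord i.
Proof. by rewrite /shear mmapX mmap1U. Qed.

Lemma shearC k : shear k%:MP = k%:MP%:P.
Proof. by rewrite /shear mmapC. Qed.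

Lemma shearK p : unshear (shear p) = p.
Proof.
apply: (@mpoly_rmorph_eq _ _ _ (unshear \o shear) idfun) => [k|i] /=.
  rewrite shearC /unshear /= map_polyC /= /horner_eval hornerC.
  by rewrite /unshear_coef mmapC.
rewrite shearX /unshear /= /horner_eval rmorphD rmorphM /= !map_polyC map_polyX.
rewrite hornerD hornerM !hornerC hornerX /= {2}/unshear_coef mmapC.
case: unliftP => [j|] ->.
  rewrite {1}/unshear_coef mmapX mmap1U.
  by rewrite mul_mpolyC scalerA subrK.
by rewrite rmorph0 add0r mul_mpolyC scalerA mulfV // scale1r.
Qed.

Lemma shear_eval p (a : 'rV[K]_n) y :
  (map_poly (meval (fun j => a 0 j)) (shear p)).[y] = pval p (shear_point a y).
Proof.
pose ev := horner_eval y \o map_poly (meval (fun j => a 0 j)) \o shear.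
apply: (@mpoly_rmorph_eq _ _ _ ev (meval (fun i => shear_point a y 0 i)))
  => [k|i]; rewrite /ev /=.
  by rewrite shearC map_polyC /= /horner_eval hornerC !mevalC.
rewrite shearX rmorphD rmorphM /= !map_polyC map_polyX /horner_eval hornerD.
rewrite hornerM !hornerC hornerX /= mevalC mevalXU mxE; congr (_ + _).
by case: unliftP => [j|] _; rewrite ?mevalXU ?meval0.
Qed.

Lemma shear_monomial m :
  degree_top (mdeg m) (shear 'X_[m]) (\prod_i c i ^+ m i)%:MP.
Proof.
rewrite mpolyXE_id mdegE rmorph_prod rmorph_prod /=.
elim/big_ind3: _ => [|d h v e k w T1 T2|i _].
- by split; rewrite ?size_poly1 // coefC.
- exact: degree_topM.
rewrite !rmorphXn /= -[m i in X in degree_top X]muln1; apply: degree_topX.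
rewrite shearX /shear_coord; split.
  rewrite addrC; case: (eqVneq (c i) 0) => [->|ci].
    rewrite mpolyC0 mul0r add0r; apply: leq_trans (size_polyC_leq1 _) _.
    by [].
  by rewrite size_MXaddC; case: ifP => // _; rewrite ltnS size_polyC_leq1.
by rewrite coefD coefC /= add0r coefMX /= coefC.
Qed.

(** In degree [d] only the terms c_i Y contribute, so Y^d is multiplied by the
    value at [c] of the form of degree [d]. *)
Lemma shear_top p d : (forall m, m \in msupp p -> (mdeg m <= d)%N) ->
  degree_top d (shear p)
    (\sum_(m <- msupp p | mdeg m == d) p@_m * \prod_i c i ^+ m i)%:MP.
Proof.
rewrite {2}(mpolyE p) rmorph_sum /= => le_d.
rewrite big_mkcond /= rmorph_sum /=.
have {le_d} := le_d; elim: (msupp p) => [|m s IH] le_d.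
  by rewrite !big_nil; split; rewrite ?size_poly0 // coef0.
rewrite !big_cons -mul_mpolyC rmorphM /= shearC.
have [|s1 t1] := IH; first by move=> k ks; apply: le_d; rewrite inE ks orbT.
have [s2 t2] := shear_monomial m.
have md := le_d m (mem_head _ _); split.
  apply: leq_trans (size_polyD _ _) _; rewrite geq_max s1 andbT.
  by rewrite mul_polyC (leq_trans (size_scale_leq _ _)) // (leq_trans s2).
rewrite coefD t1 coefCM; case: eqP => [<-|ne]; first by rewrite t2 rmorphM.
rewrite nth_default ?mulr0 ?add0r //; apply: leq_trans s2 _.
by move: md ne; lia.
Qed.

End GenericProjection.

(** Induction on the number of variables.  In generic coordinates the ideal
    contains a polynomial monic in the last variable Y.  The elimination ideal has
    a zero by induction, and over it the ideal specialises to a proper ideal of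
    K[Y], because a unit would lift by [monic_ideal_lifts_unit]. *)
Theorem weak_nullstellensatz (K : closedFieldType) (charK : [pchar K] =i pred0)
    n (J : {mpoly K[n]} -> Prop) : is_ideal J -> ~ J 1 ->
  exists x, forall p, J p -> pval p x = 0.
Proof.
elim: n J => [|n IH] J idJ J1; have [J0 JD JM] := idJ.
  exists 0 => p Jp; apply/eqP/negP => /negP px; apply: J1.
  suff <- : (pval p 0)^-1 *: p = 1 by rewrite -mul_mpolyC; apply: JM.
  have pE : p = (p@_0%MM)%:MP.
    apply/mpolyP => m; rewrite mcoeffC; have -> : m = 0%MM by apply/mnmP; case.
    by rewrite eqxx mulr1.
  move: px; rewrite pE pvalC => px.
  by rewrite -mul_mpolyC -rmorphM mulVf ?rmorph1.
case: (classic (exists2 g, J g & g != 0)) => [[g Jg g0]|Jz]; last first.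
  exists 0 => p Jp; case: (eqVneq p 0) => [->|p0]; first exact: pval0.
  by case: Jz; exists p.
have [d dg] : exists d, msize g = d.+1.
  by exists (msize g).-1; rewrite prednK // lt0n msize_poly_eq0.
have le_d m : m \in msupp g -> (mdeg m <= d)%N.
  by move=> /msize_mdeg_lt; rewrite dg.
pose top : {mpoly K[n.+1]} := \sum_(m <- msupp g | mdeg m == d) g@_m *: 'X_[m].
(* A point where the top form does not vanish gives the change of coordinates. *)
have top0 : top != 0.
  have lt : mlead g \in msupp g by apply: mlead_supp.
  have dl : mdeg (mlead g) = d by apply/eq_add_S; rewrite mlead_deg // dg.
  apply: contraTneq lt => t0; rewrite mcoeff_msupp negbK.
  have := congr1 (mcoeff (mlead g)) t0; rewrite mcoeff0 /top raddf_sum /=.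
  rewrite -big_filter (bigD1_seq (mlead g)) ?filter_uniq //=; last first.
    by rewrite mem_filter dl eqxx mlead_supp.
  rewrite mcoeffZ mcoeffX eqxx mulr1 big1 ?addr0 => [->//|m /negPf mn].
  by rewrite mcoeffZ mcoeffX mn mulr0.
have [x [tx vx]] : exists x : 'rV[K]_n.+1, torus x /\ pval top x != 0.
  apply: NNPP => H; move/eqP: top0; apply; apply: (pval_torus_eq0 charK) => x tx.
  by apply/eqP/negP => /negP vx; apply: H; exists x.
pose c i := x 0 i; have cmax : c ord_max != 0 by apply: tx.
have [sg tg] := shear_top cmax le_d.
set v := (\sum_(m <- _ | _) _) in tg.
have v0 : v != 0.
  suff <- : pval top x = v by [].
  by rewrite /top pval_sum; apply: eq_bigr => m _; rewrite pvalZ pvalXm.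
pose I h := J (unshear c h).
have idI : is_ideal I.
  split; rewrite /I; first by rewrite rmorph0.
    by move=> a b Ia Ib; rewrite rmorphD; apply: JD.
  by move=> a b Ib; rewrite rmorphM; apply: JM.
have [I0 ID IM] := idI.
have Ish p : J p -> I (shear c p) by move=> Jp; rewrite /I shearK.
pose g1 := v^-1%:MP%:P * shear c g.
have Ig1 : I g1 by apply/IM/Ish.
have mg1 : g1 \is monic.
  have c1 : g1`_d = 1 by rewrite coefCM tg -rmorphM mulVf ?rmorph1.
  have s1 : (size g1 <= d.+1)%N.
    by rewrite /g1 mul_polyC (leq_trans (size_scale_leq _ _)).
  rewrite monicE lead_coefE; suff -> : size g1 = d.+1 by rewrite /= c1.
  apply/eqP; rewrite eqn_leq s1 ltnNge; apply/negP => /(nth_default 0).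
  by rewrite c1 => /eqP; rewrite oner_eq0.
have [a az] : exists a, forall p, I p%:P -> pval p a = 0.
  apply: IH; last by rewrite /I rmorph1.
  split; first by rewrite polyC0.
    by move=> p q Ip Iq; rewrite polyCD; apply: ID.
  by move=> p q Iq; rewrite polyCM; apply: IM.
pose ev := map_poly (meval (fun j => a 0 j)).
have nounit f k : I f -> k != 0 -> ev f <> k%:P.
  move=> If k0 evf; have [r Ir] := monic_ideal_lifts_unit idI mg1 Ig1 If k0 evf.
  by move/eqP; apply; apply: az.
suff [y yz] : exists y, forall f, I f -> (ev f).[y] = 0.
  by exists (shear_point c a y) => p Jp; rewrite -shear_eval; apply/yz/Ish.
case: (classic (exists2 f, I f & ev f != 0)) => [[f If f0]|Iz]; last first.
  exists 0 => f If; case: (eqVneq (ev f) 0) => [->|f0]; first exact: horner0.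
  by case: Iz; exists f.
(* An element of the specialised ideal of least size divides all others. *)
have [k] := ubnP (size (ev f)); elim: k f If f0 => // k IHk f If f0 szf.
case: (classic (exists h, I h /\ ~~ (ev f %| ev h)%R)) => [[h [Ih fh]]|div].
  pose q := ev h %/ ev f.
  have [Q evQ] : exists Q : {poly {mpoly K[n]}}, ev Q = q.
    exists (map_poly (@mpolyC n K) q).
    rewrite /ev -map_poly_comp map_poly_id // => z _ /=.
    exact: mevalC.
  have evr : ev (h + - Q * f) = ev h %% ev f.
    transitivity (ev h - ev Q * ev f); first by rewrite mulNr /ev rmorphB rmorphM.
    by rewrite evQ {1}(divp_eq (ev h) (ev f)) addrAC subrr add0r.
  apply: (IHk (h + - Q * f)); first by apply: ID => //; apply: IM.
    by rewrite evr.
  by rewrite evr -ltnS; apply: leq_trans szf; rewrite ltnS ltn_modpN0.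
have s1 : size (ev f) != 1%N.
  apply/negP => /size_poly1P [z z0]; exact: nounit.
have [y /rootP ry] := closed_rootP _ s1.
exists y => h Ih.
have /dvdpP [q ->] : ev f %| ev h.
  by apply: NNPP => nd; apply: div; exists h; split=> //; apply/negP.
by rewrite hornerM ry mulr0.
Qed.

(** * Regular functions as fractions, and irreducibility *)

Section RegularFunctions.
Variable K : closedFieldType.

Definition pcomp n k (psi : 'I_n -> {mpoly K[k]}) (p : {mpoly K[n]}) :
  {mpoly K[k]} := p \mPo [tuple psi i | i < n].

Lemma pval_comp n k (psi : 'I_n -> {mpoly K[k]}) p x :
  pval (pcomp psi p) x = pval p (\row_i pval (psi i) x).
Proof.
rewrite /pval comp_mpoly_meval; apply: meval_eq => i.
by rewrite tnth_mktuple mxE.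
Qed.

Lemma closed_separates N (Z : aset K N) x : zariski_closed Z -> ~ Z x ->
  exists2 p, (forall y, Z y -> pval p y = 0) & pval p x != 0.
Proof.
move=> [S ZS] nZx; apply: NNPP => H; apply/nZx/ZS => p Sp.
apply/eqP/negP => /negP px; apply: H; exists p => // y /ZS; exact.
Qed.

Lemma clear_inverse n (g : {mpoly K[n]}) (Q : {mpoly K[n + 1]}) :
  exists l q, forall x, pval g x != 0 ->
    pval Q (row_mx x (pval g x)^-1%:M) * pval g x ^+ l = pval q x.
Proof.
elim/mpolyind: Q => [|c m p _ _ [l [q IH]]].
  by exists 0%N, 0 => x _; rewrite !pval0 mul0r.
pose e := m (rshift n ord0).
exists (e + l)%N, (c *: (\prod_(i < n) 'X_i ^+ m (lshift 1 i)) * g ^+ l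
                   + q * g ^+ e).
move=> x gx; rewrite !pvals -IH // big_split_ord /= big_ord1 row_mxEr mxE mulr1n.
rewrite -/e exprVn exprD.
have <- : \prod_(i < n) x 0 i ^+ m (lshift 1 i) =
    \prod_(i < n) row_mx x (pval g x)^-1%:M 0 (lshift 1 i) ^+ m (lshift 1 i).
  by apply: eq_bigr => i _; rewrite row_mxEl.
have <- : \prod_(i < n) x 0 i ^+ m (lshift 1 i) =
    \prod_(i < n) pval ('X_i ^+ m (lshift 1 i)) x.
  by apply: eq_bigr => i _; rewrite pvalXn pvalX.
by field; rewrite expf_neq0.
Qed.

(** Rabinowitsch's trick.  With an extra coordinate w for 1 / g, the polynomials P
    such that f P is, up to a power of g, a polynomial on [W] form an ideal.  A
    common zero (x, w) cannot have x outside [Z], because of the equations of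
    [Z], nor g x = 0, because of 1 - w g, nor x in [W], because of the
    denominators of the local expressions of [f].  So the ideal contains 1. *)
Lemma regular_on_principal_open (charK : [pchar K] =i pred0) N (Z W : aset K N)
    (g : {mpoly K[N]}) (f : 'rV[K]_N -> K) :
    zariski_closed Z -> (forall x, W x <-> Z x /\ pval g x != 0) ->
    regular W f ->
  exists p k, forall x, W x -> f x = pval p x / pval g x ^+ k.
Proof.
move=> clZ WE regf.
pose I (P : {mpoly K[N + 1]}) := exists k p, forall x, W x ->
  f x * pval P (row_mx x (pval g x)^-1%:M) * pval g x ^+ k = pval p x.
have idI : is_ideal I.
  split.
  - by exists 0%N, 0 => x _; rewrite !pval0 mulr0 mul0r.
  - move=> P Q [k [p Pp]] [l [q Qq]].
    exists (k + l)%N, (p * g ^+ l + q * g ^+ k) => x Wx.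
    by rewrite !pvals -Pp // -Qq // exprD; ring.
  - move=> Q P [k [p Pp]]; have [l [q Qq]] := clear_inverse g Q.
    exists (k + l)%N, (q * p) => x Wx; have [_ gx] := (WE x).1 Wx.
    by rewrite !pvals -Pp // -Qq // exprD; ring.
pose lft : {mpoly K[N]} -> {mpoly K[N + 1]} :=
  pcomp (fun i => 'X_(lshift 1 i)).
have lftE p x w : pval (lft p) (row_mx x w) = pval p x.
  rewrite pval_comp; congr pval; apply/rowP => i.
  by rewrite mxE pvalX row_mxEl.
have I1 : I 1.
  apply: NNPP => nI1; have [v vz] := weak_nullstellensatz charK idI nI1.
  move: vz; rewrite -[v]hsubmxK; set x := lsubmx v; set w := rsubmx v => vz.
  case: (classic (Z x)) => [Zx|nZx]; last first.
    have [p pZ px] := closed_separates clZ nZx.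
    move/eqP: px; apply; rewrite -(lftE _ _ w); apply: vz.
    exists 0%N, 0 => y Wy; have [Zy _] := (WE y).1 Wy.
    by rewrite lftE pZ // pval0 mulr0 mul0r.
  case: (eqVneq (pval g x) 0) => [gx|gx].
    have /vz : I (1 - 'X_(rshift N ord0) * lft g).
      exists 0%N, 0 => y Wy; have [_ gy] := (WE y).1 Wy.
      rewrite pvalB pval1 pvalM pvalX lftE row_mxEr mxE mulr1n mulVf //.
      by rewrite subrr mulr0 mul0r pval0.
    by rewrite pvalB pval1 pvalM pvalX lftE gx mulr0 subr0 => /eqP; rewrite oner_eq0.
  have Wx : W x by apply/WE.
  have [U [p [q [[Z' clZ' UE] Ux Upq]]]] := regf x Wx.
  have [_ nZ'x] := (UE x).1 Ux.
  have [s sZ' sx] := closed_separates clZ' nZ'x.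
  have [qx _] := Upq x Ux.
  have /vz : I (lft (q * s)).
    exists 0%N, (p * s) => y Wy; rewrite lftE !pvals mulr1.
    case: (classic (Z' y)) => [/sZ' ->|nZ'y]; first by rewrite !mulr0.
    have [|qy ->] := Upq y; first exact/UE.
    by field.
  by rewrite lftE pvalM => /eqP; rewrite mulf_eq0 (negPf qx) (negPf sx).
have [k [p fp]] := I1; exists p, k => x Wx; have [_ gx] := (WE x).1 Wx.
by rewrite -fp // pval1 mulr1 mulfK // expf_neq0.
Qed.

Lemma regular_on_closed (charK : [pchar K] =i pred0) N (Z : aset K N)
    (f : 'rV[K]_N -> K) : zariski_closed Z -> regular Z f ->
  exists p, forall x, Z x -> f x = pval p x.
Proof.
move=> clZ regf.
have WE x : Z x <-> Z x /\ pval (1 : {mpoly K[N]}) x != 0.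
  by rewrite pval1 oner_neq0; split=> [//|[]].
have [p [k fp]] := regular_on_principal_open charK clZ WE regf.
by exists p => x Zx; rewrite fp // pval1 expr1n divr1.
Qed.

(** A single fraction valid on all of [X].  On principal open subsets of closed
    sets these are all the regular functions; they are closed under composition,
    which is not apparent for functions given by local fractions. *)
Definition gfrac N (X : aset K N) (f : 'rV[K]_N -> K) : Prop :=
  exists p q : {mpoly K[N]}, forall x, X x ->
    pval q x != 0 /\ f x = pval p x / pval q x.

Lemma zariski_closed_empty N : zariski_closed (fun _ : 'rV[K]_N => False).
Proof.
exists (fun p => p = 1) => x; split=> // /(_ 1 erefl) /eqP.
by rewrite pval1 oner_eq0.
Qed.

Lemma open_in_refl N (X : aset K N) : open_in X X.
Proof.
by exists (fun=> False); [apply: zariski_closed_empty | move=> x; tauto].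
Qed.

Lemma gfrac_regular N (X : aset K N) f : gfrac X f -> regular X f.
Proof.
move=> [p [q fpq]] x Xx; exists X, p, q; split=> //; exact: open_in_refl.
Qed.

Lemma gfrac_morphism N N' (X : aset K N) (Y : aset K N') f :
  (forall x, X x -> Y (f x)) -> (forall j, gfrac X (fun x => f x 0 j)) ->
  morphism X Y f.
Proof. by move=> XY fg; split=> // j; apply: gfrac_regular. Qed.

Section Closure.
Variables (N : nat) (X : aset K N).
Implicit Types (f g : 'rV[K]_N -> K).

Lemma gfrac_ext f g : (forall x, X x -> f x = g x) -> gfrac X f -> gfrac X g.
Proof.
move=> fg [p [q fpq]]; exists p, q => x Xx; rewrite -fg //; exact: fpq.
Qed.

Lemma gfrac_pval p : gfrac X (pval p).
Proof. by exists p, 1 => x _; rewrite pval1 oner_neq0 divr1. Qed.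

Lemma gfrac_coord i : gfrac X (fun x => x 0 i).
Proof. by apply: gfrac_ext (gfrac_pval 'X_i) => x _; rewrite pvalX. Qed.

Lemma gfracC c : gfrac X (fun=> c).
Proof. by apply: gfrac_ext (gfrac_pval c%:MP) => x _; rewrite pvalC. Qed.

Lemma gfracD f g : gfrac X f -> gfrac X g -> gfrac X (fun x => f x + g x).
Proof.
move=> [p [q fpq]] [r [s grs]]; exists (p * s + r * q), (q * s) => x Xx.
have [qx ->] := fpq x Xx; have [sx ->] := grs x Xx.
by rewrite !pvals mulf_neq0 //; split=> //; field; apply/andP.
Qed.

Lemma gfracM f g : gfrac X f -> gfrac X g -> gfrac X (fun x => f x * g x).
Proof.
move=> [p [q fpq]] [r [s grs]]; exists (p * r), (q * s) => x Xx.
have [qx ->] := fpq x Xx; have [sx ->] := grs x Xx.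
by rewrite !pvals mulf_neq0 //; split=> //; field; apply/andP.
Qed.

Lemma gfracB f g : gfrac X f -> gfrac X g -> gfrac X (fun x => f x - g x).
Proof.
move=> Gf Gg; apply: gfracD Gf _.
by apply: gfrac_ext (gfracM (gfracC (-1)) Gg) => x _; rewrite mulN1r.
Qed.

Lemma gfracV f : (forall x, X x -> f x != 0) -> gfrac X f ->
  gfrac X (fun x => (f x)^-1).
Proof.
move=> f0 [p [q fpq]]; exists q, p => x Xx.
have [qx fE] := fpq x Xx; have := f0 x Xx; rewrite fE invf_div.
by rewrite mulf_eq0 negb_or => /andP[].
Qed.

Lemma gfracX f k : gfrac X f -> gfrac X (fun x => f x ^+ k).
Proof.
move=> Gf; elim: k => [|k IH]; first exact: gfracC.
by apply: gfrac_ext (gfracM Gf IH) => x _; rewrite exprS.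
Qed.

Lemma gfrac_expz f (k : int) : (0 <= k \/ forall x, X x -> f x != 0) ->
  gfrac X f -> gfrac X (fun x => f x ^ k).
Proof.
case: k => k; first by move=> _ /(gfracX k).
case=> // f0 Gf; apply: gfracV; last exact: gfracX.
by move=> x Xx; rewrite expf_neq0 ?f0.
Qed.

Lemma gfrac_sum I (s : seq I) (P : pred I) (F : I -> 'rV[K]_N -> K) :
  (forall i, gfrac X (F i)) -> gfrac X (fun x => \sum_(i <- s | P i) F i x).
Proof.
move=> GF; elim: s => [|i s IH].
  by apply: gfrac_ext (gfracC 0) => x _; rewrite big_nil.
case: (boolP (P i)) => Pi.
  by apply: gfrac_ext (gfracD (GF i) IH) => x _; rewrite big_cons Pi.
by apply: gfrac_ext IH => x _; rewrite big_cons (negPf Pi).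
Qed.

Lemma gfrac_prod I (s : seq I) (P : pred I) (F : I -> 'rV[K]_N -> K) :
  (forall i, gfrac X (F i)) -> gfrac X (fun x => \prod_(i <- s | P i) F i x).
Proof.
move=> GF; elim: s => [|i s IH].
  by apply: gfrac_ext (gfracC 1) => x _; rewrite big_nil.
case: (boolP (P i)) => Pi.
  by apply: gfrac_ext (gfracM (GF i) IH) => x _; rewrite big_cons Pi.
by apply: gfrac_ext IH => x _; rewrite big_cons (negPf Pi).
Qed.

Lemma gfrac_pval_comp k (p : {mpoly K[k]}) (psi : 'rV[K]_N -> 'rV[K]_k) :
  (forall j, gfrac X (fun x => psi x 0 j)) -> gfrac X (fun x => pval p (psi x)).
Proof.
move=> Gpsi.
have : gfrac X (fun x => \sum_(m <- msupp p) p@_m * \prod_i psi x 0 i ^+ m i).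
  apply: gfrac_sum => m; apply: gfracM; first exact: gfracC.
  by apply: gfrac_prod => i; apply: gfracX.
by apply: gfrac_ext => x _; rewrite pvalE.
Qed.

Lemma gfrac_comp k (Y : aset K k) (f : 'rV[K]_k -> K) (psi : 'rV[K]_N -> 'rV[K]_k) :
  gfrac Y f -> (forall x, X x -> Y (psi x)) ->
  (forall j, gfrac X (fun x => psi x 0 j)) -> gfrac X (fun x => f (psi x)).
Proof.
move=> [p [q fpq]] XY Gpsi.
apply: (@gfrac_ext (fun x => pval p (psi x) / pval q (psi x))).
  by move=> x /XY /fpq [].
apply: gfracM; first exact: gfrac_pval_comp.
by apply: gfracV; [move=> x /XY /fpq [] | apply: gfrac_pval_comp].
Qed.
End Closure.

Lemma closed_pval_zero N (p : {mpoly K[N]}) :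
  zariski_closed (fun x => pval p x = 0).
Proof. by exists (fun q => q = p) => x; split=> [px q ->|]; last exact. Qed.

Lemma closed_union N (Z1 Z2 : aset K N) : zariski_closed Z1 ->
  zariski_closed Z2 -> zariski_closed (fun x => Z1 x \/ Z2 x).
Proof.
move=> c1 c2.
exists (fun p => forall x, Z1 x \/ Z2 x -> pval p x = 0) => x; split.
  by move=> Zx p; apply.
move=> H; apply: NNPP => /not_or_and [n1 n2].
have [p1 z1 nz1] := closed_separates c1 n1.
have [p2 z2 nz2] := closed_separates c2 n2.
have := H (p1 * p2); rewrite pvalM => E.
have /eqP : pval p1 x * pval p2 x = 0.
  apply: E => y [/z1|/z2] E; rewrite pvalM E; [exact: mul0r|exact: mulr0].
by rewrite mulf_eq0 (negPf nz1) (negPf nz2).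
Qed.

Lemma closed_full N : zariski_closed (fun _ : 'rV[K]_N => True).
Proof. by exists (fun=> False) => x; split. Qed.

Lemma irreducible_mul0 N (X : aset K N) f g : irreducible X ->
  gfrac X f -> gfrac X g -> (forall x, X x -> f x * g x = 0) ->
  (forall x, X x -> f x = 0) \/ (forall x, X x -> g x = 0).
Proof.
move=> [_ irrX] [p [q fpq]] [r [s grs]] fg0.
have cov x : X x -> pval p x = 0 \/ pval r x = 0.
  move=> Xx; have := fg0 x Xx; have [qx ->] := fpq x Xx.
  have [sx ->] := grs x Xx => /eqP.
  rewrite !mulf_eq0 !invr_eq0 (negPf qx) (negPf sx) !orbF.
  by case/orP=> /eqP; tauto.
case: (irrX _ _ (closed_pval_zero p) (closed_pval_zero r) cov) => H; [left|right].
  by move=> x Xx; have [_ ->] := fpq x Xx; rewrite H ?mul0r.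
by move=> x Xx; have [_ ->] := grs x Xx; rewrite H ?mul0r.
Qed.

(** Zariski density in the form used below: two functions on an irreducible set
    agree as soon as they do where a third one, not identically zero, does not
    vanish. *)
Lemma gfrac_density N (X : aset K N) f g h : irreducible X ->
  gfrac X f -> gfrac X g -> gfrac X h -> nonzero_on X h ->
  (forall x, X x -> h x != 0 -> f x = g x) -> forall x, X x -> f x = g x.
Proof.
move=> irrX Gf Gg Gh [x0 Xx0 hx0] fg x Xx.
case: (irreducible_mul0 irrX Gh (gfracB Gf Gg)) => [y Xy|h0|fg0].
- case: (eqVneq (h y) 0) => [->|hy]; first by rewrite mul0r.
  by rewrite fg // subrr mulr0.
- by rewrite h0 ?eqxx in hx0.
by apply/eqP; rewrite -subr_eq0 fg0.
Qed.

Lemma irreducible_principal N (X W : aset K N) g : irreducible X ->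
  (forall x, W x <-> X x /\ pval g x != 0) -> (exists x, W x) -> irreducible W.
Proof.
move=> [_ irrX] WE neW; split=> // Z1 Z2 c1 c2 cov.
have cg := closed_pval_zero g.
case: (irrX _ _ (closed_union c1 cg) (closed_union c2 cg)) => [x Xx|H|H].
- case: (eqVneq (pval g x) 0) => [|gx]; first by tauto.
  by have /cov : W x by [apply/WE]; tauto.
- by left=> x /WE[/H[//|->]]; rewrite eqxx.
by right=> x /WE[/H[//|->]]; rewrite eqxx.
Qed.

Lemma irreducible_space (charK : [pchar K] =i pred0) N :
  irreducible (fun _ : 'rV[K]_N => True).
Proof.
split; first by exists 0.
move=> Z1 Z2 c1 c2 cov; apply: NNPP => /not_or_and [n1 n2].
have [x1 /not_imply_elim2 nx1] := not_all_ex_not _ _ n1.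
have [x2 /not_imply_elim2 nx2] := not_all_ex_not _ _ n2.
have [p1 z1 nz1] := closed_separates c1 nx1.
have [p2 z2 nz2] := closed_separates c2 nx2.
have /eqP : p1 * p2 = 0.
  apply: (pval_eq0 charK) => x; rewrite pvalM.
  by case: (cov x) => // [/z1|/z2] ->; rewrite ?mul0r ?mulr0.
rewrite mulf_eq0 => /orP[] /eqP E.
  by rewrite E pval0 eqxx in nz1.
by rewrite E pval0 eqxx in nz2.
Qed.

Lemma principal_variety (charK : [pchar K] =i pred0) N (W : aset K N) g :
  (forall x, W x <-> pval g x != 0) -> (exists x, W x) -> variety W.
Proof.
move=> WE neW; split.
  exists (fun=> True); first exact: closed_full.
  exists (fun x => pval g x = 0); first exact: closed_pval_zero.
  by move=> x; rewrite WE; split=> [/eqP|[_ /eqP]].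
apply: (irreducible_principal (g := g) (irreducible_space charK N) _ neW) => x.
by rewrite WE; split=> [gx|[] //]; split.
Qed.

End RegularFunctions.

Lemma gfrac_lsub (K : closedFieldType) M N (X : aset K M) (Y : aset K N) f :
  gfrac X f -> gfrac (prod_set X Y) (fun z => f (lsubmx z)).
Proof.
move=> Gf; apply: (gfrac_comp Gf) => [z []|j] //.
by apply: gfrac_ext (gfrac_coord _ (lshift N j)) => z _; rewrite mxE.
Qed.

Lemma gfrac_rsub (K : closedFieldType) M N (X : aset K M) (Y : aset K N) f :
  gfrac Y f -> gfrac (prod_set X Y) (fun z => f (rsubmx z)).
Proof.
move=> Gf; apply: (gfrac_comp Gf) => [z []|j] //.
by apply: gfrac_ext (gfrac_coord _ (rshift M j)) => z _; rewrite mxE.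
Qed.

(** * Linear and algebraic dependence *)

Section Dependence.
Variable K : closedFieldType.

Lemma msize_mul_le n (p q : {mpoly K[n]}) a b :
  (msize p <= a.+1)%N -> (msize q <= b.+1)%N -> (msize (p * q) <= (a + b).+1)%N.
Proof.
move=> pa qb; case: (eqVneq p 0) => [->|p0]; first by rewrite mul0r msize0.
case: (eqVneq q 0) => [->|q0]; first by rewrite mulr0 msize0.
rewrite msizeM //; move: pa qb.
by move: (mmeasure mdeg p) (mmeasure mdeg q) => u v; lia.
Qed.

Lemma msize_exp_le n (p : {mpoly K[n]}) a k :
  (msize p <= a.+1)%N -> (msize (p ^+ k) <= (k * a).+1)%N.
Proof.
move=> pa; elim: k => [|k IH]; first by rewrite expr0 msize1.
by rewrite exprS mulSn; apply: msize_mul_le.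
Qed.

Lemma msize_prod_le n (I : Type) (s : seq I) (F : I -> {mpoly K[n]}) (a : I -> nat) :
  (forall i, (msize (F i) <= (a i).+1)%N) ->
  (msize (\prod_(i <- s) F i) <= (\sum_(i <- s) a i).+1)%N.
Proof.
move=> Fa; elim: s => [|i s IH]; first by rewrite !big_nil msize1.
by rewrite !big_cons; apply: msize_mul_le.
Qed.

Lemma msize_sum_le n (I : eqType) (s : seq I) (F : I -> {mpoly K[n]}) B :
  (forall i, i \in s -> msize (F i) <= B)%N -> (msize (\sum_(i <- s) F i) <= B)%N.
Proof.
elim: s => [|i s IH] FB; first by rewrite big_nil msize0.
rewrite big_cons; apply: leq_trans (msizeD_le _ _) _.
rewrite geq_max FB ?mem_head // IH // => j js; apply: FB.
by rewrite inE js orbT.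
Qed.

(** All exponents of these polynomials are below [B], so they live in a space of
    dimension B ^ n. *)
Lemma mpoly_family_dependent n (I : finType) (Q : I -> {mpoly K[n]}) B :
    (forall i, msize (Q i) <= B)%N -> (B ^ n < #|I|)%N ->
  exists a : I -> K, (exists i, a i != 0) /\ \sum_i a i *: Q i = 0.
Proof.
move=> QB ltI; pose T := {ffun 'I_n -> 'I_B}.
pose mon (t : T) : 'X_{1..n} := [multinom (t i : nat) | i < n].
pose M : 'M[K]_(#|I|, #|T|) := \matrix_(i, t) (Q (enum_val i))@_(mon (enum_val t)).
have kn0 : kermx M != 0.
  rewrite -mxrank_eq0 mxrank_ker -lt0n subn_gt0.
  by apply: leq_ltn_trans (rank_leq_col _) _; rewrite card_ffun !card_ord.
have [[i0 j0] kij] : exists ij : 'I_#|I| * 'I_#|I|, kermx M ij.1 ij.2 != 0.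
  apply/existsP; apply: contraNT kn0 => /existsPn H; apply/eqP/matrixP => i j.
  by rewrite [RHS]mxE; apply/eqP; rewrite -[_ == _]negbK; apply: (H (i, j)).
exists (fun i => kermx M i0 (enum_rank i)); split.
  by exists (enum_val j0); rewrite enum_valK.
apply/mpolyP => m; rewrite mcoeff0 raddf_sum /=.
case: (ltnP (mdeg m) B) => mB; last first.
  apply: big1 => i _; rewrite mcoeffZ memN_msupp_eq0 ?mulr0 //.
  by apply: msize_mdeg_ge; apply: leq_trans mB.
have miB i : (m i < B)%N.
  by apply: leq_ltn_trans mB; rewrite mdegE (bigD1 i) //= leq_addr.
pose t : T := [ffun i => Ordinal (miB i)].
have tm : mon t = m by apply/mnmP => i; rewrite mnmE ffunE.
have := congr1 (fun A : 'M_(_, _) => A i0 (enum_rank t)) (mulmx_ker M).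
rewrite [LHS]mxE [RHS]mxE => E; rewrite -[RHS]E (reindex (@enum_val I I)) /=.
  by apply: eq_bigr => j _; rewrite mcoeffZ [M _ _]mxE !enum_valK enum_rankK tm.
exact/onW_bij/enum_val_bij.
Qed.

Definition lin_subst d k (N : 'M[K]_(d, k)) : {mpoly K[k]} -> {mpoly K[d]} :=
  pcomp (fun i => \sum_j N j i *: 'X_j).

Lemma pval_lin_subst d k (N : 'M[K]_(d, k)) p x : pval (lin_subst N p) x = pval p (x *m N).
Proof.
rewrite pval_comp; congr pval; apply/rowP => i; rewrite !mxE pval_sum.
by apply: eq_bigr => j _; rewrite pvalZ pvalX mulrC.
Qed.

Lemma msize_lin_subst d k (N : 'M[K]_(d, k)) p B :
  (msize p <= B)%N -> (msize (lin_subst N p) <= B)%N.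
Proof.
move=> pB; rewrite /lin_subst /pcomp comp_mpolyE; apply: msize_sum_le => m mp.
apply: leq_trans (msizeZ_le _ _) _.
apply: leq_trans (leq_trans (msize_mdeg_lt mp) pB).
rewrite mdegE; apply: (@msize_prod_le d _ _ _ (fun i => m i)) => i.
rewrite tnth_mktuple -[m i in leqRHS]muln1; apply: msize_exp_le.
apply: msize_sum_le => j _; apply: leq_trans (msizeZ_le _ _) _.
by rewrite msizeX mdeg1.
Qed.

(** The polynomials Q(x M^-i) for i >= 0 have bounded degree, so a nontrivial
    combination of them vanishes.  If i1 is its last index, evaluating it at
    [w i1.-1] leaves only the term Q(w_0 M^-1): the others are values of [Q] on
    the sequence. *)
Lemma polynomial_recurrence_backwards d (M : 'M[K]_d) (w : nat -> 'rV[K]_d)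
    (Q : {mpoly K[d]}) : M \in unitmx ->
    (forall j, w j.+1 = w j *m M) -> (forall j, pval Q (w j) = 0) ->
  pval Q (w 0%N *m invmx M) = 0.
Proof.
move=> uM wS Qw; pose S i := iter i (lin_subst (invmx M)) Q.
pose B := msize Q.
have SB i : (msize (S i) <= B)%N.
  by elim: i => [|i IH]; rewrite /S ?iterS; [exact: leqnn|apply: msize_lin_subst].
have SS i j : pval (S i.+1) (w j.+1) = pval (S i) (w j).
  by rewrite /S iterS pval_lin_subst wS mulmxK.
have Sle i j : (i <= j)%N -> pval (S i) (w j) = 0.
  elim: i j => [j _|i IH [|j] //]; first exact: Qw.
  by rewrite ltnS SS => /IH.
have SSn j : pval (S j.+1) (w j) = pval Q (w 0%N *m invmx M).
  elim: j => [|j IH]; last by rewrite SS.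
  by rewrite /S /= pval_lin_subst.
have [|a [[i0 ai0] dep]] :=
    @mpoly_family_dependent d 'I_(B ^ d).+1 (fun i => S i) B (fun i => SB i).
  by rewrite card_ord.
have [i1 ai1 max1] := @arg_maxnP _ i0 (fun i => a i != 0) (fun i => i : nat) ai0.
have a0 (i : 'I_(B ^ d).+1) : (i1 < i)%N -> a i = 0.
  by move=> lti; apply/eqP; apply: contraLR lti => /max1 le; rewrite -leqNgt.
case: (posnP i1) => [i10|i1_gt0].
  have : pval (\sum_i a i *: S i) (w 0%N *m invmx M) = 0 by rewrite dep pval0.
  rewrite pval_sum (bigD1 i1) //= big1 ?addr0 => [|i ine].
    by rewrite i10 pvalZ => /eqP; rewrite mulf_eq0 (negPf ai1) => /eqP.
  rewrite pvalZ a0 ?mul0r // i10 lt0n; apply: contra ine => /eqP i0E.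
  by apply/eqP/val_inj; rewrite /= i10.
have : pval (\sum_i a i *: S i) (w i1.-1) = 0 by rewrite dep pval0.
rewrite pval_sum (bigD1 i1) //= big1 ?addr0 => [|i ine].
  rewrite pvalZ -{1}(prednK i1_gt0) SSn => /eqP.
  by rewrite mulf_eq0 (negPf ai1) => /eqP.
rewrite pvalZ; case: (ltngtP i i1) => [lti|gti|/val_inj E].
- by rewrite Sle ?mulr0 // -ltnS prednK.
- by rewrite a0 ?mul0r.
- by rewrite E eqxx in ine.
Qed.

(** A dimension count.  Over a common
    denominator, the monomials with exponents below L in the n fractions have
    numerators of size at most c L in k variables.  These span a space of
    dimension at most (c L) ^ k, which is less than L ^ n for large L. *)
Lemma fractions_dependent n k (F H : 'I_n -> {mpoly K[k]}) : (k < n)%N ->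
  exists2 P : {mpoly K[n]}, P != 0 &
    forall y, (forall i, pval (H i) y != 0) ->
      P.@[fun i => pval (F i) y / pval (H i) y] = 0.
Proof.
move=> ltkn.
(* Over the common denominator H0 the fractions become G i / H0. *)
pose H0 := \prod_i H i; pose G i := F i * \prod_(j | j != i) H j.
pose D := \max_(p <- H0 :: [seq G i | i : 'I_n]) msize p.
have DH : (msize H0 <= D.+1)%N.
  by rewrite /D big_cons ltnW // ltnS leq_maxl.
have DG i : (msize (G i) <= D.+1)%N.
  rewrite /D big_cons; apply/leqW/leq_trans/leq_maxr.
  by apply: (@leq_bigmax_seq _ _ xpredT) => //; apply: map_f; rewrite mem_enum.
(* L is chosen so that (c * L) ^ k < L ^ k.+1. *)
pose c := (D * n).+1; pose L := (c ^ k).+1.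
pose I : finType := {ffun 'I_n -> 'I_L}.
pose Q (e : I) := (\prod_i G i ^+ e i) * H0 ^+ (n * L - \sum_i e i).
have sume (e : I) : (\sum_i e i <= n * L)%N.
  rewrite -[X in (X * _)%N](card_ord n) -sum_nat_const.
  by apply: leq_sum => i _; apply/ltnW/ltn_ord.
have QB e : (msize (Q e) <= c * L)%N.
  have : (msize (Q e) <= (\sum_i e i * D + (n * L - \sum_i e i) * D).+1)%N.
    apply: msize_mul_le; last exact: msize_exp_le.
    by apply: msize_prod_le => i; apply: msize_exp_le.
  move/leq_trans; apply; rewrite -big_distrl /= -mulnDl subnKC // /c mulSn.
  by rewrite /L addSn ltnS (leq_trans _ (leq_addl _ _)) // mulnAC [(D * n)%N]mulnC.
have [|a [[e0 ae0] dep]] := mpoly_family_dependent QB.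
  rewrite card_ffun !card_ord expnMn; apply: (@leq_trans (L ^ k.+1)).
    by rewrite expnS ltn_mul2r expn_gt0 /= /L ltnSn.
  by rewrite leq_exp2l /L // ltnS expn_gt0.
pose mon (e : I) : 'X_{1..n} := [multinom (e i : nat) | i < n].
have moninj : injective mon.
  move=> e e' /mnmP E; apply/ffunP => i; apply/val_inj.
  by have := E i; rewrite !mnmE.
exists (\sum_e a e *: 'X_[mon e]).
  apply: contraNneq ae0 => /(congr1 (mcoeff (mon e0))).
  rewrite mcoeff0 raddf_sum /= (bigD1 e0) //= mcoeffZ mcoeffX eqxx mulr1.
  rewrite big1 ?addr0 => [->//|e ne]; rewrite mcoeffZ mcoeffX.
  by rewrite (negPf (contra_neq (@moninj _ _) ne)) mulr0.
move=> y Hy; have H0y : pval H0 y != 0.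
  by rewrite /H0 pval_prod; apply/prodf_neq0 => i _.
have FG i : pval (F i) y / pval (H i) y = pval (G i) y / pval H0 y.
  have -> : H0 = H i * \prod_(j | j != i) H j by rewrite /H0 (bigD1 i).
  rewrite /G !pvalM.
  have nz : pval (\prod_(j | j != i) H j) y != 0.
    by rewrite pval_prod; apply/prodf_neq0 => j _.
  by rewrite -mulf_div divff // mulr1.
apply: (mulIf (expf_neq0 (n * L) H0y)); rewrite mul0r.
rewrite -[RHS](pval0 y) -dep pval_sum raddf_sum /= big_distrl /=.
apply: eq_bigr => e _; rewrite mevalZ mevalX pvalZ -mulrA; congr (_ * _).
rewrite /Q pvalM pval_prod pvalXn -{1}(subnKC (sume e)) exprD mulrA.
congr (_ * _); rewrite -prodrXr -big_split /=; apply: eq_bigr => i _.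
by rewrite pvalXn FG mnmE expr_div_n divfK // expf_neq0.
Qed.

End Dependence.

(** * The group of units is a principal open subset *)

Lemma bounded_maximum (P : nat -> Prop) B : P 0%N -> (forall d, P d -> d <= B)%N ->
  exists d, P d /\ forall e, P e -> (e <= d)%N.
Proof.
move=> P0; elim: B => [|B IH] PB; first by exists 0%N.
case: (classic (P B.+1)) => [PB1|nP]; first by exists B.+1.
apply: IH => d Pd; have := PB d Pd; rewrite leq_eqVlt => /orP[/eqP dE|//].
by rewrite dE in Pd.
Qed.

Section UnitGroup.
Variables (K : closedFieldType) (N : nat) (X : aset K N).
Variable mu : 'rV[K]_N -> 'rV[K]_N -> 'rV[K]_N.

Lemma pval_row_mx_separates n1 n2 (P : 'I_N -> {mpoly K[n1 + n2]}) :
  exists (T : finType) (p : 'I_N -> T -> {mpoly K[n1]}) (q : T -> {mpoly K[n2]}),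
    forall k x y, pval (P k) (row_mx x y) = \sum_b pval (p k b) x * pval (q b) y.
Proof.
pose w := \max_k msize (P k).
exists 'X_{1..(n1 + n2) < w},
  (fun k (m : 'X_{1..(n1 + n2) < w}) => (P k)@_m *: \prod_i 'X_i ^+ (bmnm m) (lshift n2 i)),
  (fun m : 'X_{1..(n1 + n2) < w} => \prod_j 'X_j ^+ (bmnm m) (rshift n1 j)) => k x y.
have Pw : (msize (P k) <= w)%N by apply: (@leq_bigmax _ (fun k => msize (P k)) k).
rewrite {1}(mpolywE Pw) pval_sum; apply: eq_bigr => m _.
rewrite !pvalZ -mulrA pvalXm big_split_ord !pval_prod; congr (_ * (_ * _)).
  by apply: eq_bigr => i _; rewrite row_mxEl pvalXn pvalX.
by apply: eq_bigr => i _; rewrite row_mxEr pvalXn pvalX.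
Qed.

Lemma closed_prod_set N1 N2 (Y : aset K N1) (Z : aset K N2) : zariski_closed Y ->
  zariski_closed Z -> zariski_closed (prod_set Y Z).
Proof.
move=> clY clZ.
exists (fun p => forall x, prod_set Y Z x -> pval p x = 0) => x; split.
  by move=> YZx p; apply.
move=> H; split; apply: NNPP => nZ.
  have [p pY px] := closed_separates clY nZ; move/eqP: px; apply.
  have := H (pcomp (fun i => 'X_(lshift N2 i)) p); rewrite pval_comp.
  rewrite (_ : (\row_i _) = lsubmx x).
    apply=> y [Yy _]; rewrite pval_comp (_ : (\row_i _) = lsubmx y) ?pY //.
    by apply/rowP => i; rewrite !mxE pvalX.
  by apply/rowP => i; rewrite !mxE pvalX.
have [p pY px] := closed_separates clZ nZ; move/eqP: px; apply.
have := H (pcomp (fun i => 'X_(rshift N1 i)) p); rewrite pval_comp.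
rewrite (_ : (\row_i _) = rsubmx x).
  apply=> y [_ Yy]; rewrite pval_comp (_ : (\row_i _) = rsubmx y) ?pY //.
  by apply/rowP => i; rewrite !mxE pvalX.
by apply/rowP => i; rewrite !mxE pvalX.
Qed.

Hypothesis charK : [pchar K] =i pred0.
Hypothesis clX : zariski_closed X.
Hypothesis monX : alg_monoid X mu.
Hypothesis comX : commutative_on X mu.

Lemma mul_closed x y : X x -> X y -> X (mu x y).
Proof.
have [_ [H _] _ _] := monX => Xx Xy.
by have := H (row_mx x y); rewrite /prod_set row_mxKl row_mxKr; apply.
Qed.

Lemma mul_polynomial : exists P : 'I_N -> {mpoly K[N + N]},
  forall x y k, X x -> X y -> mu x y 0 k = pval (P k) (row_mx x y).
Proof.
have [_ [_ H] _ _] := monX.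
have [P HP] := fin_all_exists (fun k =>
  regular_on_closed charK (closed_prod_set clX clX) (H k)).
exists P => x y k Xx Xy.
by rewrite -HP /prod_set ?row_mxKl ?row_mxKr.
Qed.

Lemma translation_polynomial y k : X y ->
  exists q, forall x, X x -> mu y x 0 k = pval q x.
Proof.
have [P HP] := mul_polynomial => Xy.
exists (pcomp (fun i : 'I_(N + N) =>
  match split i with inl i => (y 0 i)%:MP | inr j => 'X_j end) (P k)) => x Xx.
rewrite HP // pval_comp; congr pval; apply/rowP => i; rewrite !mxE.
by case: split => j; rewrite ?pvalC ?pvalX.
Qed.

Lemma translation_pullback y p : X y ->
  exists q, forall x, X x -> pval p (mu y x) = pval q x.
Proof.
move=> Xy; have [Q HQ] := fin_all_exists (fun k => translation_polynomial k Xy).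
exists (pcomp Q p) => x Xx; rewrite pval_comp; congr pval.
by apply/rowP => k; rewrite mxE HQ.
Qed.

Lemma is_unit_unique e e' : is_unit X mu e -> is_unit X mu e' -> e = e'.
Proof.
move=> [Xe ue] [Xe' ue']; rewrite -(ue' e Xe).1.
by rewrite (ue e' Xe').2.
Qed.

(** Linear independence of [d] translates of coordinate functions, witnessed by
    their values at [d] points.  The largest such [d] is the dimension of the
    space spanned by all translates, on which the monoid acts by matrices. *)
Definition nondegenerate d := exists (k : 'I_d -> 'I_N) (b a : 'I_d -> 'rV[K]_N),
  [/\ forall i, X (b i), forall i, X (a i) &
      (\matrix_(j, i) mu (b i) (a j) 0 (k i)) \in unitmx].

(** Separating the variables in the polynomials of the multiplication factors the
    matrix of values through a space that does not depend on [d]. *)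
Lemma nondegenerate_bounded : exists B, forall d, nondegenerate d -> (d <= B)%N.
Proof.
have [P HP] := mul_polynomial.
have [T [p [q pq]]] := pval_row_mx_separates P.
exists #|T| => d [k [b [a [Xb Xa]]]]; set A := \matrix_(_, _) _ => uA.
pose Q : 'M[K]_(d, #|T|) := \matrix_(j, t) pval (q (enum_val t)) (a j).
pose R : 'M[K]_(#|T|, d) := \matrix_(t, i) pval (p (k i) (enum_val t)) (b i).
suff AE : A = Q *m R.
  by rewrite -(mxrank_unit uA) AE (leq_trans (mxrankM_maxl _ _)) // rank_leq_col.
apply/matrixP => j i; rewrite !mxE HP // pq (reindex (@enum_val T T)) /=.
  by apply: eq_bigr => t _; rewrite !mxE mulrC.
exact/onW_bij/enum_val_bij.
Qed.

(** A vanishing Schur complement. *)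
Lemma det_border_mx d (A : 'M[K]_d) (B : 'cV_d) (C : 'rV_d) (D : 'M[K]_1) :
  A \in unitmx -> block_mx A B C D \notin unitmx -> D = C *m invmx A *m B.
Proof.
move=> uA; rewrite unitmxE unitfE negbK => /eqP det0.
pose L : 'M[K]_(d + 1) := block_mx 1%:M 0 (- (C *m invmx A)) 1%:M.
have LE : L *m block_mx A B C D = block_mx A B 0 (D - C *m invmx A *m B).
  rewrite mulmx_block !mul1mx !mul0mx !addr0 !mulNmx mulmxKV // addNr.
  by rewrite addrC.
have := congr1 determinant LE; rewrite det_mulmx det0 mulr0 det_ublock => /esym/eqP.
rewrite mulf_eq0 => /orP[|]; first by rewrite unitmxE unitfE in uA; rewrite (negPf uA).
rewrite det_mx11 => /eqP E; apply/eqP; rewrite -subr_eq0; apply/eqP/matrixP => i j.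
by rewrite !ord1 E mxE.
Qed.

(** Let [Fr z] be the row of values at z of a basis of the space spanned by all
    translates of the coordinate functions.  Then Fr (x z) = Fr z * M x for a
    matrix M x with polynomial entries, and z is a linear function of Fr z.  If
    M x is invertible, the candidate inverse of x is the point whose row is
    Fr e * (M x)^-1.  It satisfies the equations of [X] because the powers of x do
    ([polynomial_recurrence_backwards]).  Hence the units are the points with
    det (M x) <> 0. *)
Theorem unit_group_principal_open :
  exists g, forall x, unit_group X mu x <-> X x /\ pval g x != 0.
Proof.
have [B HB] := nondegenerate_bounded.
have [_ _ assoc [e ue]] := monX; have [Xe unit_e] := ue.
have nd0 : nondegenerate 0.
  have k0 : 'I_0 -> 'I_N by case.
  exists k0, (fun=> e), (fun=> e); split=> //.
  by rewrite unitmxE det_mx00 unitr1.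
have [d [[k [b [a [Xb Xa]]]]]] := bounded_maximum nd0 HB.
set A := \matrix_(_, _) _ => uA max_d.
pose Fr z : 'rV[K]_d := \row_i mu (b i) z 0 (k i).
(* By maximality of d a further translate is determined by its values at the
   points a j: bordering A with it gives a degenerate matrix. *)
have span b0 k0 z : X b0 -> X z ->
    mu b0 z 0 k0 = (Fr z *m invmx A *m \col_j mu b0 (a j) 0 k0) 0 0.
  move=> Xb0 Xz; pose D : 'M[K]_1 := const_mx (mu b0 z 0 k0).
  have -> : mu b0 z 0 k0 = D 0 0 by rewrite mxE.
  rewrite (@det_border_mx _ A (\col_j mu b0 (a j) 0 k0) (Fr z) D) //.
  apply/negP => uAd.
  suff /max_d : nondegenerate (d + 1) by rewrite addn1 ltnn.
  exists (fun i => if split i is inl i then k i else k0),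
    (fun i => if split i is inl i then b i else b0),
    (fun i => if split i is inl i then a i else z).
  split; [by move=> i; case: split|by move=> i; case: split|].
  rewrite (_ : (\matrix_(_, _) _) =
    block_mx A (\col_j mu b0 (a j) 0 k0) (Fr z) D) //.
  apply/matrixP => j i; rewrite !mxE.
  case: (split j) => j'; rewrite !mxE; case: (split i) => i'; by rewrite !mxE.
pose Ax x : 'M[K]_d := \matrix_(j, i) mu (b i) (mu x (a j)) 0 (k i).
pose M x := invmx A *m Ax x.
have FrM x z : X x -> X z -> Fr (mu x z) = Fr z *m M x.
  move=> Xx Xz; apply/rowP => i; rewrite mxE assoc // span //; last exact: mul_closed.
  rewrite /M mulmxA [in RHS]mxE mxE; apply: eq_bigr => j _.
  by rewrite !mxE assoc.
pose C : 'M[K]_(d, N) := invmx A *m \matrix_(j, l) a j 0 l.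
have FrC z : X z -> z = Fr z *m C.
  move=> Xz; apply/rowP => l; have := span e l z Xe Xz.
  rewrite (unit_e z Xz).1 => ->; rewrite /C mulmxA [in RHS]mxE mxE.
  by apply: eq_bigr => j _; rewrite !mxE (unit_e _ (Xa j)).1.
have [q Hq] : exists q : 'I_d -> 'I_d -> {mpoly K[N]},
    forall j i x, X x -> mu (b i) (mu x (a j)) 0 (k i) = pval (q j i) x.
  apply: (fin_all_exists (P := fun j qj => forall i x, X x -> _ = pval (qj i) x)) => j.
  apply: (fin_all_exists (P := fun i qi => forall x, X x -> _ = pval qi x)) => i.
  have [qi Hqi] := translation_polynomial (k i) (mul_closed (Xb i) (Xa j)).
  by exists qi => x Xx; rewrite -Hqi // (comX Xx (Xa j)) assoc.
have uM x : (M x \in unitmx) = (\det (Ax x) != 0).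
  by rewrite unitmx_mul unitmx_inv uA /= unitmxE unitfE.
exists (\det (\matrix_(j, i) q j i)) => x.
have detE : X x -> pval (\det (\matrix_(j, i) q j i)) x = \det (Ax x).
  move=> Xx; rewrite /pval -det_map_mx; congr determinant.
  by apply/matrixP => j i; rewrite !mxE Hq.
split=> [[Xx [y Xy [uxy _]]]|[Xx]].
  split=> //; rewrite detE // -uM.
  have xyE := is_unit_unique uxy ue.
  suff : M y *m M x = 1%:M by move/mulmx1_unit=> [].
  have AE : A *m (M y *m M x) = A.
    apply/row_matrixP => j; rewrite row_mul.
    have -> : row j A = Fr (a j) by apply/rowP => i; rewrite !mxE.
    rewrite mulmxA -FrM // -FrM //; last exact: mul_closed.
    by rewrite assoc // xyE (unit_e _ (Xa j)).1.
  by rewrite -[LHS](mulKmx uA) AE mulVmx.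
rewrite detE // -uM => uMx; split=> //.
(* w j is the row of x^j, and v is what this sequence would be at j = -1. *)
pose pw j := iter j (mu x) e.
have Xpw j : X (pw j) by elim: j => //= j IH; apply: mul_closed.
pose w j := Fr (pw j).
have wS j : w j.+1 = w j *m M x by rewrite /w /pw iterS FrM //; apply: Xpw.
pose v := Fr e *m invmx (M x).
have back Q : (forall j, pval Q (w j) = 0) -> pval Q v = 0.
  exact: polynomial_recurrence_backwards.
pose y := v *m C.
have Xy : X y.
  have [S XS] := clX; apply/XS => p Sp; rewrite -pval_lin_subst; apply: back => j.
  by rewrite pval_lin_subst -FrC //; apply: (XS _).1.
have Fry : Fr y = v.
  apply/rowP => i; have [t Ht] := translation_polynomial (k i) (Xb i).
  rewrite mxE Ht //; apply/eqP; rewrite -subr_eq0; apply/eqP.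
  rewrite -[v 0 i]pvalX -pval_lin_subst -pvalB; apply: back => j.
  rewrite pvalB pval_lin_subst pvalX -FrC // -Ht // mxE.
  by rewrite subrr.
have xy : mu x y = e.
  by rewrite [LHS]FrC ?FrM ?Fry ?mulmxKV -?FrC //; apply: mul_closed.
by exists y => //; rewrite (comX Xy Xx) xy.
Qed.

End UnitGroup.

(** * Characters and Laurent polynomials *)

Section Characters.
Variables (K : closedFieldType) (charK : [pchar K] =i pred0) (n : nat).
Implicit Types (u w : 'rV[int]_n) (x y t : 'rV[K]_n).

Definition char_defined u x := forall i, 0 <= u 0 i \/ x 0 i != 0.

Lemma characterD u w x : char_defined u x -> char_defined w x ->
  character (u + w) x = character u x * character w x.
Proof.
move=> ux wx; rewrite /character -big_split /=; apply: eq_bigr => i _.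
rewrite mxE; case: (eqVneq (x 0 i) 0) => [x0|xi]; last by rewrite expfzDr.
case: (ux i); last by rewrite x0 eqxx.
case: (wx i); last by rewrite x0 eqxx.
case: (w 0 i) => // k _; case: (u 0 i) => // l _.
by rewrite -PoszD -!exprnP exprD.
Qed.

Lemma character_mul u x y : character u (torus_mul x y) = character u x * character u y.
Proof.
by rewrite /character -big_split; apply: eq_bigr => i _; rewrite mxE expfzMl.
Qed.

Lemma character_one u : character u (@torus_one K n) = 1.
Proof. by rewrite /character big1 // => i _; rewrite mxE exp1rz. Qed.

Lemma torus_one_torus : torus (@torus_one K n).
Proof. by move=> i; rewrite mxE oner_neq0. Qed.

Definition two_at i : 'rV[K]_n := \row_j if j == i then 2%:R else 1.

Lemma torus_two_at i : torus (two_at i).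
Proof. by move=> j; rewrite mxE; case: ifP; rewrite ?two_neq0 ?oner_neq0. Qed.

Lemma character_two_at u i : character u (two_at i) = 2%:R ^ u 0 i.
Proof.
rewrite /character (bigD1 i) //= mxE eqxx big1 ?mulr1 // => j /negPf ji.
by rewrite mxE ji exp1rz.
Qed.

Lemma pow2z_inj (a b : int) : 2%:R ^ a = 2%:R ^ b :> K -> a = b.
Proof.
move=> E; have {E} : 2%:R ^ (a - b) = 1 :> K.
  by rewrite expfzDr ?two_neq0 // E -expfzDr ?two_neq0 // subrr expr0z.
suff H c : 2%:R ^ c = 1 :> K -> c = 0 by move/H/eqP; rewrite subr_eq0 => /eqP.
have H k : 2%:R ^+ k = 1 :> K -> k = 0%N.
  by move=> E; apply: (pow2_inj charK); rewrite E expr0.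
case: c => k; first by move=> /H ->.
by move/eqP; rewrite NegzE -exprz_inv -exprnP exprVn invr_eq1 => /eqP/H.
Qed.

Lemma character_separates u w : u != w ->
  exists2 t : 'rV[K]_n, torus t & character u t != character w t.
Proof.
move=> uw; have [i ui] : exists i, u 0 i != w 0 i.
  apply/existsP; apply: contraNT uw => /existsPn H; apply/eqP/rowP => i.
  by apply/eqP; rewrite -[_ == _]negbK; apply: H.
exists (two_at i); first exact: torus_two_at.
by rewrite !character_two_at; apply: contra ui => /eqP/pow2z_inj ->.
Qed.

Lemma characters_independent (E : seq 'rV[int]_n) (c : 'rV[int]_n -> K) :
  uniq E -> (forall t, torus t -> \sum_(u <- E) c u * character u t = 0) ->
  forall u, u \in E -> c u = 0.
Proof.
move=> uE sum0 u uu.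
suff /(_ (@torus_one K n) torus_one_torus) :
    forall t, torus t -> c u * character u t = 0.
  by rewrite character_one mulr1.
apply: (@eigenvectors_in_subspace K _ _ _ (@torus K n)
  (fun h => forall t, torus t -> h t = 0) (@torus K n) (@torus_mul K n)
  (fun a u => character u a) _ _ _ _ _ _ E
  (fun u t => c u * character u t)) => //.
- by move=> h h' e h0 t tt; rewrite -e ?h0.
- by move=> h h' h0 h0' t tt; rewrite h0 ?h0' ?addr0.
- by move=> a h h0 t tt; rewrite h0 ?mulr0.
- by move=> a h ta h0 t tt; rewrite h0 //; apply: torus_mulP.
- by move=> v w /character_separates [t tt vw]; exists t.
- by move=> a w t _ _; rewrite character_mul mulrCA.
Qed.

End Characters.

Section LaurentPolynomials.
Variables (K : closedFieldType) (charK : [pchar K] =i pred0) (r s : nat).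
Notation G := (@GmGa K r s).

(** The exponents of the Laurent monomials that are regular on G_m^r x G_a^s. *)
Definition exponent_ok (u : 'rV[int]_(r + s)) := forall j : 'I_s, 0 <= u 0 (rshift r j).

Lemma exponent_char_defined u x : exponent_ok u -> G x -> char_defined u x.
Proof.
by move=> uok Gx i; rewrite -(splitK i); case: split => j /=; [right|left].
Qed.

Lemma torus_GmGa x : torus x -> G x.
Proof. by move=> tx j. Qed.

Definition units_poly : {mpoly K[r + s]} := \prod_(j < r) 'X_(lshift s j).

Lemma GmGa_principal x : G x <-> pval units_poly x != 0.
Proof.
rewrite pval_prod; split=> [Gx|/prodf_neq0 nz j].
  by apply/prodf_neq0 => j _; rewrite pvalX; apply: Gx.
by have := nz j isT; rewrite pvalX.
Qed.

Lemma regular_GmGa_fraction f : regular G f ->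
  exists p k, forall x, G x -> f x = pval p x / pval units_poly x ^+ k.
Proof.
apply: (@regular_on_principal_open _ charK _ (fun=> True)); first exact: closed_full.
by move=> x; rewrite GmGa_principal; split=> [|[]].
Qed.

Lemma regular_GmGa_gfrac f : regular G f -> gfrac G f.
Proof.
move=> /regular_GmGa_fraction [p [k fp]]; exists p, (units_poly ^+ k) => x Gx.
by rewrite pvalXn expf_neq0 -?GmGa_principal // fp.
Qed.

Lemma regular_GmGa_laurent f : regular G f ->
  exists (E : seq 'rV[int]_(r + s)) (c : 'rV[int]_(r + s) -> K),
    [/\ uniq E, forall u, u \in E -> exponent_ok u &
        forall x, G x -> f x = \sum_(u <- E) c u * character u x].
Proof.
move=> /regular_GmGa_fraction [p [k fp]].
pose sh (i : 'I_(r + s)) : int := if split i is inl _ then k%:Z else 0.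
pose ex (m : 'X_{1..(r + s)}) : 'rV[int]_(r + s) := \row_i ((m i)%:Z - sh i).
pose un (u : 'rV[int]_(r + s)) : 'X_{1..(r + s)} :=
  [multinom absz (u 0 i + sh i)%R | i < r + s].
have exK : cancel ex un by move=> m; apply/mnmP => i; rewrite mnmE mxE subrK absz_nat.
exists [seq ex m | m <- msupp p], (fun u => p@_(un u)); split.
- by rewrite map_inj_uniq ?msupp_uniq //; apply: can_inj exK.
- by move=> _ /mapP[m _ ->] j; rewrite mxE /sh (unsplitK (inr j)) subr0.
move=> x Gx; rewrite fp // pvalE [in RHS]big_map big_distrl /=; apply: eq_bigr => m _.
rewrite exK -mulrA; congr (_ * _); rewrite /character /units_poly pval_prod.
rewrite -prodrXl -prodfV !big_split_ord /= mulrAC -big_split /=; congr (_ * _).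
  apply: eq_bigr => j _; rewrite mxE /sh (unsplitK (inl j)) pvalX.
  by rewrite expfzDr ?Gx // exprnN.
by apply: eq_bigr => j _; rewrite mxE /sh (unsplitK (inr j)) subr0.
Qed.

End LaurentPolynomials.

(** * The chart of a monoid by its group of units *)

Section Chart.
Variables (K : closedFieldType) (charK : [pchar K] =i pred0).
Variables (N : nat) (X : aset K N) (mu : 'rV[K]_N -> 'rV[K]_N -> 'rV[K]_N).
Variables (r s : nat) (phi : 'rV[K]_(r + s) -> 'rV[K]_N).
Notation G := (@GmGa K r s).

(** [phi] embeds G as the open subset [d != 0] of [X]; by [chart_coord] its inverse
    is regular there. *)
Record chart (d : {mpoly K[N]}) : Prop := {
  chart_in : forall g, G g -> X (phi g);
  chart_open : forall g, G g -> pval d (phi g) != 0;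
  chart_onto : forall x, X x -> pval d x != 0 -> exists2 g, G g & x = phi g;
  chart_gfrac : forall j, gfrac G (fun g => phi g 0 j);
  chart_coord : forall j, exists p k, forall g, G g ->
    g 0 j = pval p (phi g) / pval d (phi g) ^+ k;
  chart_mul : forall g h, G g -> G h -> phi (GmGa_mul g h) = mu (phi g) (phi h) }.

Lemma chart_exists : affine_variety X -> alg_monoid X mu -> commutative_on X mu ->
  monoid_iso G (@GmGa_mul K r s) (unit_group X mu) mu phi -> exists d, chart d.
Proof.
move=> [clX _] monX comX [[psi [[phiU regphi] [psiG regpsi] [phiK psiK]]] phiM _].
have [d dE] := unit_group_principal_open charK clX monX comX.
exists d; split=> //.
- by move=> g /phiU [].
- by move=> g /phiU /dE [].
- move=> x Xx dx; have Ux := (dE x).2 (conj Xx dx).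
  by exists (psi x); [exact: psiG|rewrite psiK].
- by move=> j; apply/(regular_GmGa_gfrac charK)/regphi.
move=> j; have [p [k pk]] := regular_on_principal_open charK clX dE (regpsi j).
exists p, k => g Gg.
by rewrite -pk ?phiK //; apply: phiU.
Qed.

Definition GmGa_one : 'rV[K]_(r + s) := row_mx (const_mx 1) 0.

Lemma GmGa_oneP : G GmGa_one.
Proof. by move=> j; rewrite row_mxEl mxE oner_neq0. Qed.

Lemma GmGa_mulP g h : G g -> G h -> G (GmGa_mul g h).
Proof.
move=> Gg Gh j; rewrite mxE (unsplitK (inl j)).
by rewrite mulf_neq0.
Qed.

Variables (d : {mpoly K[N]}) (irrX : irreducible X) (ch : chart d).

Lemma chart_inj g h : G g -> G h -> phi g = phi h -> g = h.
Proof.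
move=> Gg Gh gh; apply/rowP => j; have [p [k pk]] := chart_coord ch j.
by rewrite pk // gh -pk.
Qed.

Lemma chart_coords : exists pk : 'I_(r + s) -> {mpoly K[N]} * nat,
  forall j g, G g -> g 0 j = pval (pk j).1 (phi g) / pval d (phi g) ^+ (pk j).2.
Proof.
apply: (fin_all_exists (P := fun j pk => forall g, G g ->
  g 0 j = pval pk.1 (phi g) / pval d (phi g) ^+ pk.2)) => j.
by have [p [k pk]] := chart_coord ch j; exists (p, k).
Qed.

Lemma chart_dense f : gfrac X f -> (forall g, G g -> f (phi g) = 0) ->
  forall x, X x -> f x = 0.
Proof.
move=> Gf f0; have one := GmGa_oneP.
case: (irreducible_mul0 irrX Gf (gfrac_pval X d)) => // [x Xx|d0].
  case: (eqVneq (pval d x) 0) => [->|dx]; first by rewrite mulr0.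
  by have [g Gg ->] := chart_onto ch Xx dx; rewrite f0 ?mul0r.
by have := chart_open ch one; rewrite (d0 _ (chart_in ch one)) eqxx.
Qed.

Lemma chart_pval_gfrac p : gfrac G (fun g => pval p (phi g)).
Proof. exact: gfrac_pval_comp (chart_gfrac ch). Qed.

(** The coordinates of G are rational functions on [X], and they are algebraically
    independent. *)
Lemma dim_le n : has_dim X n -> zariski_closed X -> (r + s <= n)%N.
Proof.
move=> [_ notS] clX; rewrite leqNgt; apply/negP => lt_n; apply: notS.
have [pk Hpk] := chart_coords.
pose w (i : 'I_n.+1) := widen_ord lt_n i.
exists (fun i => pval (pk (w i)).1), (fun i => pval (d ^+ (pk (w i)).2)); split.
  move=> i; split; try exact/gfrac_regular/gfrac_pval.
  exists (phi GmGa_one); first exact/(chart_in ch)/GmGa_oneP.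
  by rewrite pvalXn expf_neq0 // (chart_open ch) //; apply: GmGa_oneP.
move=> P P0; apply: (pval_torus_eq0 charK) => y ty.
pose g : 'rV[K]_(r + s) := \row_j if insub (j : nat) is Some i then y 0 i else 1.
have Gg : G g.
  by move=> j; rewrite mxE; case: insubP => [i _ _|_]; rewrite ?oner_neq0 ?ty.
rewrite -[RHS](P0 (phi g) (chart_in ch Gg)); last first.
  by move=> i; rewrite pvalXn expf_neq0 // (chart_open ch).
apply: meval_eq => i; rewrite pvalXn -Hpk // mxE /w.
rewrite insubT //= => lt; congr (y 0 _); exact/val_inj.
Qed.

(** Rational functions on [X] pull back to fractions in r + s variables.  If there
    are more of them than variables, they satisfy a relation, which extends from
    the open image of the chart to [X]. *)
Lemma dim_ge n : has_dim X n -> zariski_closed X -> (n <= r + s)%N.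
Proof.
move=> [[f [h [regfh indep]]] _] clX; rewrite leqNgt; apply/negP => lt_n.
have [p Hp] := fin_all_exists (fun i =>
  let: And3 rf _ _ := regfh i in regular_on_closed charK clX rf).
have [q Hq] := fin_all_exists (fun i =>
  let: And3 _ rg _ := regfh i in regular_on_closed charK clX rg).
have frac (e : {mpoly K[N]}) : exists AB : {mpoly K[r + s]} * {mpoly K[r + s]},
    forall g, G g -> pval AB.2 g != 0 /\ pval e (phi g) = pval AB.1 g / pval AB.2 g.
  by have [A [B AB]] := chart_pval_gfrac e; exists (A, B).
have [A HA] := fin_all_exists (fun i => frac (p i)).
have [B HB] := fin_all_exists (fun i => frac (q i)).
have [P P0 Pvan] := fractions_dependent
  (fun i => (A i).1 * (B i).2) (fun i => (A i).2 * (B i).1) lt_n.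
move/eqP: P0; apply; apply: indep => x Xx hx.
pose Q := \prod_i q i; pose W : aset K N := fun y => X y /\ pval Q y != 0.
have Wq y i : W y -> pval (q i) y != 0.
  by move=> [_]; rewrite pval_prod => /prodf_neq0/(_ i isT).
have Wx : W x.
  by split=> //; rewrite pval_prod; apply/prodf_neq0 => i _; rewrite -Hq.
have irrW : irreducible W.
  by apply: (irreducible_principal (g := Q) irrX) => //; exists x.
pose F y := pval P (\row_i (pval (p i) y / pval (q i) y)).
have GF : gfrac W F.
  apply: gfrac_pval_comp => i.
  apply: (@gfrac_ext _ _ _ (fun y => pval (p i) y * (pval (q i) y)^-1)).
    by move=> y _; rewrite mxE.
  apply: gfracM; first exact: gfrac_pval.
  by apply: gfracV; [move=> y; apply: Wq | exact: gfrac_pval].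
have F0 y : W y -> F y * pval d y = 0.
  move=> Wy; have [Xy _] := Wy.
  case: (eqVneq (pval d y) 0) => [->|dy]; first by rewrite mulr0.
  have [g Gg yE] := chart_onto ch Xy dy.
  suff -> : F y = 0 by rewrite mul0r.
  rewrite -[RHS](Pvan g) => [|i].
    apply: meval_eq => i; rewrite mxE yE.
    have [_ ->] := HA i g Gg; have [_ ->] := HB i g Gg.
    by rewrite !pvalM invf_div mulf_div.
  rewrite pvalM mulf_neq0 //; first by have [] := HA i g Gg.
  have := Wq y i Wy; rewrite yE; have [B2 ->] := HB i g Gg.
  by apply: contraNneq => ->; rewrite mul0r.
case: (irreducible_mul0 irrW GF (gfrac_pval W d) F0) => [F00|d0].
  rewrite -[RHS](F00 x Wx); apply: meval_eq => i.
  by rewrite mxE Hp // Hq.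
have Qd y : X y -> pval Q y * pval d y = 0.
  move=> Xy; case: (eqVneq (pval Q y) 0) => [->|Qy]; first by rewrite mul0r.
  by rewrite d0 ?mulr0.
case: (irreducible_mul0 irrX (gfrac_pval X Q) (gfrac_pval X d) Qd) => H.
  by have [_] := Wx; rewrite H ?eqxx.
have one := GmGa_oneP; have := chart_open ch one.
by rewrite (H _ (chart_in ch one)) eqxx.
Qed.

(** The coordinate ring of [X], as a space of functions on G. *)
Definition pullback (h : 'rV[K]_(r + s) -> K) : Prop :=
  exists p, forall g, G g -> h g = pval p (phi g).

Lemma pullback_ext h h' : (forall g, G g -> h g = h' g) -> pullback h -> pullback h'.
Proof. by move=> e [p hp]; exists p => g Gg; rewrite -e ?hp. Qed.

Lemma pullback0 : pullback (fun=> 0).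
Proof. by exists 0 => g _; rewrite pval0. Qed.

Lemma pullbackD h h' : pullback h -> pullback h' -> pullback (fun g => h g + h' g).
Proof. by move=> [p hp] [q hq]; exists (p + q) => g Gg; rewrite hp ?hq ?pvalD. Qed.

Lemma pullbackZ c h : pullback h -> pullback (fun g => c * h g).
Proof. by move=> [p hp]; exists (c *: p) => g Gg; rewrite hp ?pvalZ. Qed.

Lemma pullback_translate a h : zariski_closed X -> alg_monoid X mu ->
  G a -> pullback h -> pullback (fun g => h (GmGa_mul a g)).
Proof.
move=> clX monX Ga [p hp].
have [q Hq] := translation_pullback charK clX monX p (chart_in ch Ga).
exists q => g Gg; rewrite hp; last exact: GmGa_mulP.
by rewrite (chart_mul ch) // Hq //; apply: (chart_in ch).
Qed.

(** The coordinate ring is spanned by monomials; equivalently, it is stable under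
    the rescaling of all r + s coordinates of G. *)
Definition monomials_split : Prop := forall (E : seq 'rV[int]_(r + s)) c,
  uniq E -> (forall u, u \in E -> exponent_ok u) ->
  pullback (fun g => \sum_(u <- E) c u * character u g) ->
  forall u, u \in E -> c u != 0 -> pullback (character u).

(** The elements of the semigroup of exponents of the monomials regular on [X]. *)
Definition weight u := exponent_ok u /\ pullback (character u).

(** A coordinate of G is a fraction with numerator and denominator in the
    coordinate ring, so [u] can be any monomial of the denominator.  In particular
    the weights generate the lattice. *)
Lemma weight_neighbours (split : monomials_split) i :
  exists u, weight u /\ weight (u + delta_mx 0 i).
Proof.
have [p [k pk]] := chart_coord ch i.
have [E [c [uE okE hE]]] := regular_GmGa_laurent charK
  (gfrac_regular (chart_pval_gfrac (d ^+ k))).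
have hphi : pullback (fun g => \sum_(u <- E) c u * character u g).
  by exists (d ^+ k) => g Gg; rewrite -hE.
have one := GmGa_oneP.
have [u uu cu] : exists2 u, u \in E & c u != 0.
  apply: NNPP => H; have := hE _ one; rewrite big_seq big1 => [/eqP|u uu].
    by rewrite pvalXn expf_eq0 (negPf (chart_open ch one)) andbF.
  case: (eqVneq (c u) 0) => [->|cu]; first by rewrite mul0r.
  by case: H; exists u.
have oki : exponent_ok (delta_mx 0 i : 'rV[int]_(r + s)).
  by move=> j; rewrite mxE; case: (_ && _).
have chi g : character (delta_mx 0 i) g = g 0 i.
  rewrite /character (bigD1 i) //= mxE !eqxx expr1z big1 ?mulr1 // => j /negPf ji.
  by rewrite mxE ji andbF expr0z.
have ok u' : u' \in E -> exponent_ok (u' + delta_mx 0 i).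
  by move=> u'E j; rewrite mxE addr_ge0 ?(okE _ u'E) ?oki.
exists u; split; split; [exact: okE|exact: split hphi u uu cu|exact: ok|].
pose E' := [seq v + delta_mx 0 i | v <- E].
apply: (split E' (fun v => c (v - delta_mx 0 i))).
- by rewrite map_inj_uniq //; apply: addIr.
- by move=> _ /mapP[v vE ->]; apply: ok.
- exists p => g Gg; rewrite big_map.
  have -> : pval p (phi g) = g 0 i * pval (d ^+ k) (phi g).
    by rewrite pk // pvalXn divfK // expf_neq0 // (chart_open ch).
  rewrite hE // big_distrr /= big_seq [RHS]big_seq; apply: eq_bigr => v vE.
  rewrite addrK characterD ?chi; [by ring|exact/exponent_char_defined/Gg/okE|].
  exact: exponent_char_defined.
- exact: map_f.
- by rewrite addrK.
Qed.

Lemma chart_expansion (split : monomials_split) :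
  exists (E : seq 'rV[int]_(r + s)) (c : 'I_N -> 'rV[int]_(r + s) -> K)
         (F : 'rV[int]_(r + s) -> {mpoly K[N]}),
    (forall u, u \in E -> exponent_ok u /\
       forall g, G g -> pval (F u) (phi g) = character u g) /\
    forall k g, G g -> phi g 0 k = \sum_(u <- E) c k u * character u g.
Proof.
have lau k := regular_GmGa_laurent charK (gfrac_regular (chart_gfrac ch k)).
have cond k : exists Ec : seq 'rV[int]_(r + s) * ('rV[int]_(r + s) -> K),
    [/\ uniq Ec.1, forall u, u \in Ec.1 -> exponent_ok u &
    forall g, G g -> phi g 0 k = \sum_(u <- Ec.1) Ec.2 u * character u g].
  by have [E [c Ec]] := lau k; exists (E, c).
have [Ec HEc] := fin_all_exists cond.
pose E := undup (flatten
  [seq [seq u <- (Ec k).1 | (Ec k).2 u != 0] | k <- enum 'I_N]).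
have WE u : u \in E -> weight u.
  rewrite mem_undup => /flatten_mapP[k _]; rewrite mem_filter => /andP[cu uE].
  have [uniqE okE phiE] := HEc k; split; first exact: okE.
  apply: (split (Ec k).1 (Ec k).2) => //; exists 'X_k => g Gg.
  by rewrite pvalX phiE.
have [F HF] : exists F : 'rV[int]_(r + s) -> {mpoly K[N]}, forall u, weight u ->
    forall g, G g -> pval (F u) (phi g) = character u g.
  pose spec u (F : {mpoly K[N]}) := forall g, G g -> pval F (phi g) = character u g.
  exists (fun u => epsilon (inhabits 0) (spec u)) => u [_ [p pu]].
  by apply: (epsilon_spec (inhabits 0) (spec u)); exists p => g Gg; rewrite pu.
exists E, (fun k u => if u \in (Ec k).1 then (Ec k).2 u else 0), F; split.
  by move=> u /WE Wu; split; [case: Wu | apply: HF].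
move=> k g Gg; have [uniqE okE ->] := HEc k => //.
have sub : {subset [seq u <- (Ec k).1 | (Ec k).2 u != 0] <= E}.
  by move=> u uE; rewrite mem_undup; apply/flatten_mapP; exists k; rewrite ?mem_enum.
rewrite (bigID (fun u => (Ec k).2 u != 0)) /= [X in _ + X]big1 ?addr0; last first.
  by move=> u /negPn/eqP ->; rewrite mul0r.
rewrite [RHS](bigID (fun u => (u \in (Ec k).1) && ((Ec k).2 u != 0))) /=.
rewrite [X in _ = _ + X]big1 ?addr0; last first.
  by move=> u; case: ifP => _; rewrite ?mul0r //= => /negPn/eqP ->; rewrite mul0r.
rewrite -big_filter -[RHS]big_filter.
rewrite (perm_big [seq u <- E | (u \in (Ec k).1) && ((Ec k).2 u != 0)]) /=.
  rewrite big_filter [RHS]big_filter; apply: eq_bigr => u /andP[-> _] //.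
apply: uniq_perm; rewrite ?filter_uniq ?undup_uniq // => u.
rewrite !mem_filter; case: (boolP (_ != 0)) => cu; rewrite ?andbT ?andbF //=.
case: (boolP (u \in (Ec k).1)) => //= uE.
by apply/esym/sub; rewrite mem_filter cu.
Qed.

End Chart.

(** * Splitting functions into monomials *)

(** In characteristic zero q(X + 1) - q(X) has degree exactly one less than q, so
    by induction [V] contains all lower powers of X, and then the top one. *)
Lemma shift_stable_polys (K : closedFieldType) (charK : [pchar K] =i pred0)
    (V : {poly K} -> Prop) :
    (forall p q, V p -> V q -> V (p + q)) -> (forall c p, V p -> V (c *: p)) ->
    (forall p, V p -> V (p \Po ('X + 1))) ->
  forall q, V q -> forall k, (k < size q)%N -> V 'X^k.
Proof.
move=> VD VZ Vsh q; have [n] := ubnP (size q); elim: n q => // n IH q szq Vq.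
have V0 : V 0 by have := VZ 0 q Vq; rewrite scale0r.
case Dn: (size q) => [//|d] k; rewrite ltnS => kd.
have lead0 : q`_d != 0.
  by have := lead_coef_eq0 q; rewrite lead_coefE Dn /= => ->; rewrite -size_poly_eq0 Dn.
have Vlow j : (j < d)%N -> V 'X^j.
  case: d Dn kd lead0 => // d Dn _ lead0 jd.
  pose delta := q \Po ('X + 1) - q.
  have Vdelta : V delta by apply: VD; [exact: Vsh|rewrite -scaleN1r; apply: VZ].
  have shE i : (q \Po ('X + 1))`_i = \sum_(l < d.+2) q`_l * 'C(l, i)%:R.
    rewrite comp_polyE Dn coef_sum; apply: eq_bigr => l _.
    rewrite coefZ exprD1n coef_sum; congr (_ * _).
    under eq_bigr do rewrite coefMn coefXn.
    case: (ltnP i l.+1) => il.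
      rewrite (bigD1 (Ordinal il)) //= eqxx big1 ?addr0 // => a.
      by rewrite -val_eqE eq_sym /= => /negPf ->; rewrite mul0rn.
    rewrite bin_small // big1 // => a _; case: eqP => [E|]; rewrite ?mul0rn //.
    by have := ltn_ord a; rewrite -E ltnNge il.
  have top : delta`_d = q`_d.+1 *+ d.+1.
    rewrite coefB shE !big_ord_recr /= big1 ?add0r => [|l _].
      by rewrite binn binSn mulr1 mulr_natr addrAC subrr add0r.
    by rewrite bin_small ?mulr0.
  have top1 : delta`_d.+1 = 0.
    rewrite coefB shE big_ord_recr /= big1 ?add0r => [|l _].
      by rewrite binn mulr1 subrr.
    by rewrite bin_small ?mulr0.
  apply: (IH delta) => //.
    move: szq; rewrite ltnS Dn; apply: leq_trans; rewrite ltnS.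
    apply/leq_sizeP => i; rewrite leq_eqVlt => /orP[/eqP <- //|di].
    rewrite coefB shE (nth_default 0 (s := q)) ?Dn // subr0 big1 // => l _.
    by rewrite bin_small ?mulr0 // (leq_trans (ltn_ord l)).
  apply: leq_trans jd _; rewrite ltnNge; apply/negP => /(nth_default 0).
  rewrite top -mulr_natr => /eqP; rewrite mulf_eq0 (negPf lead0).
  by rewrite ((pcharf0P K).1 charK).
move: kd; rewrite leq_eqVlt => /orP[/eqP ->|/Vlow //].
have VS (s : seq nat) : all (gtn d) s -> V (\sum_(j <- s) q`_j *: 'X^j).
  elim: s => [|j s IHs] /=; first by rewrite big_nil.
  by move=> /andP[jd sd]; rewrite big_cons; apply: VD; [apply/VZ/Vlow|apply: IHs].
have -> : 'X^d = (q`_d)^-1 *: (q + -1 *: \sum_(j <- iota 0 d) q`_j *: 'X^j).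
  rewrite [X in _ *: (X + _)](poly_sum_lt (leqnn (size q))) Dn big_ord_recr /=.
  rewrite -(big_mkord xpredT (fun j => q`_j *: 'X^j)) /index_iota subn0.
  by rewrite scaleN1r addrAC subrr add0r scalerA mulVf // scale1r.
apply/VZ/VD/VZ/VS => //; apply/allP => j; rewrite mem_iota add0n; by case/andP.
Qed.

Section Splitting.
Variables (K : closedFieldType) (charK : [pchar K] =i pred0).
Variables (N : nat) (X : aset K N) (mu : 'rV[K]_N -> 'rV[K]_N -> 'rV[K]_N).
Hypotheses (clX : zariski_closed X) (monX : alg_monoid X mu).

Section TorusPart.
Variables (r s : nat) (phi : 'rV[K]_(r + s) -> 'rV[K]_N).
Notation G := (@GmGa K r s).
Variables (d : {mpoly K[N]}) (ch : chart X mu phi d).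

(** Terms with the same exponents on the torus part of G form an eigenfunction
    for the translations by that torus. *)
Lemma split_by_torus_weight (E : seq 'rV[int]_(r + s)) c (w : 'rV[int]_r) :
    uniq E ->
    pullback phi (fun g => \sum_(u <- E) c u * character u g) ->
  pullback phi (fun g => \sum_(u <- E | lsubmx u == w) c u * character u g).
Proof.
move=> uE hE; pose W := undup [seq lsubmx u | u <- E].
case: (boolP (w \in W)) => [wW|nwW]; last first.
  apply: pullback_ext (pullback0 phi) => g _; rewrite big_seq_cond big1 // => u.
  move=> /andP[uu /eqP uw]; case/negP: nwW; rewrite mem_undup -uw.
  exact: map_f.
apply: (@eigenvectors_in_subspace K _ _ _ G (pullback phi) (@torus K r)
  (fun a g => GmGa_mul (row_mx a 0) g) (fun a w => character w a)
  _ _ _ _ _ _ W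
  (fun w g => \sum_(u <- E | lsubmx u == w) c u * character u g)) => //.
- by move=> h h' e; apply: pullback_ext.
- exact: pullback0.
- by move=> h h'; apply: pullbackD.
- by move=> a h; apply: pullbackZ.
- move=> a h ta; apply: (pullback_translate charK ch clX monX).
  by move=> j; rewrite row_mxEl ta.
- by move=> v v' /(character_separates charK) [a ta av]; exists a.
- exact: undup_uniq.
- move=> a v g ta Gg; rewrite big_distrr /=; apply: eq_bigr => u /eqP <-.
  rewrite mulrCA; congr (_ * _); rewrite /character !big_split_ord /= mulrA.
  congr (_ * _); last first.
    apply: eq_bigr => j _; rewrite mxE (unsplitK (inr j)) row_mxEr mxE add0r.
    by [].
  rewrite -big_split /=; apply: eq_bigr => j _.
  by rewrite mxE (unsplitK (inl j)) row_mxEl expfzMl mxE.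
apply: pullback_ext hE => g Gg; rewrite (exchange_big_dep xpredT) //= big_seq [RHS]big_seq.
apply: eq_bigr => u uu; rewrite -big_filter.
rewrite (_ : [seq v <- W | _] = [:: lsubmx u]) ?big_seq1 //.
have -> : [seq v <- W | lsubmx u == v] = [seq v <- W | pred1 (lsubmx u) v].
  by apply: eq_filter => v /=; rewrite eq_sym.
by rewrite filter_pred1_uniq ?undup_uniq // mem_undup map_f.
Qed.

End TorusPart.

Lemma monomials_split_torus r (phi : 'rV[K]_(r + 0) -> 'rV[K]_N) d :
  chart X mu phi d -> monomials_split phi.
Proof.
move=> ch E c uE okE hE u uu cu.
have linj (v w : 'rV[int]_(r + 0)) : (lsubmx v == lsubmx w) = (v == w).
  apply/eqP/eqP => [vw|->//]; rewrite -[v]hsubmxK -[w]hsubmxK vw; congr row_mx.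
  by apply/rowP => -[].
have := split_by_torus_weight ch (lsubmx u) uE hE.
move/(pullbackZ (c u)^-1); apply: pullback_ext => g Gg.
under eq_bigl do rewrite linj.
by rewrite -big_filter filter_pred1_uniq // big_seq1 mulKf.
Qed.

Section OneAdditiveCoordinate.
Variables (r : nat) (phi : 'rV[K]_(r + 1) -> 'rV[K]_N).
Notation G := (@GmGa K r 1).
Notation last := (rshift r (ord0 : 'I_1)).
Variables (d : {mpoly K[N]}) (ch : chart X mu phi d).

(** The polynomials in the additive coordinate whose product with the character
    [w] of the torus part belongs to the coordinate ring. *)
Definition vertical (w : 'rV[int]_r) (q : {poly K}) : Prop :=
  pullback phi (fun g => character w (lsubmx g) * q.[g 0 last]).

(** Translating by 1 in the additive coordinate turns q(X) into q(X + 1). *)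
Lemma vertical_monomials w q : vertical w q ->
  forall k, (k < size q)%N -> vertical w 'X^k.
Proof.
apply: (shift_stable_polys charK) => [p p' Vp Vp'|a p Vp|p Vp].
- by apply: pullback_ext (pullbackD Vp Vp') => g _; rewrite hornerD mulrDr.
- by apply: pullback_ext (pullbackZ a Vp) => g _; rewrite hornerZ mulrCA.
pose a : 'rV[K]_(r + 1) := const_mx 1.
have Ga : G a by move=> j; rewrite mxE oner_neq0.
apply: pullback_ext (pullback_translate charK ch clX monX Ga Vp) => g _.
rewrite horner_comp hornerD hornerX hornerC mxE (unsplitK (inr ord0)) mxE addrC.
congr (_ * _); apply: eq_bigr => j _.
by rewrite !mxE (unsplitK (inl j)) ?mxE mul1r.
Qed.

Lemma character_vertical u (g : 'rV[K]_(r + 1)) : exponent_ok u ->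
  character u g = character (lsubmx u) (lsubmx g) * ('X^(absz (u 0 last))).[g 0 last].
Proof.
move=> uok; rewrite hornerXn /character big_split_ord /= big_ord1; congr (_ * _).
  by apply: eq_bigr => j _; rewrite !mxE.
by rewrite -{1}(gez0_abs (uok ord0)).
Qed.

Lemma monomials_split_one : monomials_split phi.
Proof.
move=> E c uE okE hE u uu cu; pose w := lsubmx u.
pose q : {poly K} := \sum_(v <- E | lsubmx v == w) c v *: 'X^(absz (v 0 last)).
have Vq : vertical w q.
  apply: pullback_ext (split_by_torus_weight ch w uE hE) => g Gg.
  rewrite horner_sum big_distrr /= big_seq_cond [RHS]big_seq_cond.
  apply: eq_bigr => v /andP[vE /eqP vw].
  by rewrite (character_vertical _ (okE _ vE)) vw hornerZ; ring.
apply: pullback_ext (vertical_monomials Vq (k := absz (u 0 last)) _).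
  by move=> g Gg; rewrite (character_vertical _ (okE _ uu)).
rewrite ltnNge; apply/negP => /(nth_default 0); rewrite coef_sum.
rewrite -big_filter (bigD1_seq u) ?filter_uniq ?mem_filter ?eqxx //=.
rewrite coefZ coefXn eqxx mulr1 big_filter_cond big_seq_cond big1 ?addr0.
  by move/eqP; rewrite (negPf cu).
move=> v /andP[vE /andP[/eqP vw vu]]; rewrite coefZ coefXn.
case: eqP => [uv|]; rewrite ?mulr0 //; case/eqP: vu.
rewrite -[v]hsubmxK -[u]hsubmxK vw; congr row_mx; apply/rowP => j.
rewrite ord1 !mxE -(gez0_abs (okE v vE ord0)) -(gez0_abs (okE u uu ord0)).
by rewrite uv.
Qed.

(** This closure property of the weights is what makes the opposite of the last
    basis vector a Demazure root. *)
Lemma weight_lower (u v : 'rV[int]_(r + 1)) : weight phi u -> exponent_ok v ->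
  lsubmx v = lsubmx u -> v 0 last <= u 0 last -> weight phi v.
Proof.
move=> [uok pu] vok uv le; split=> //.
have Vu : vertical (lsubmx u) 'X^(absz (u 0 last)).
  by apply: pullback_ext pu => g _; rewrite character_vertical.
apply: pullback_ext (vertical_monomials Vu (k := absz (v 0 last)) _).
  by move=> g _; rewrite character_vertical // uv.
by rewrite size_polyXn ltnS -lez_nat !gez0_abs.
Qed.

End OneAdditiveCoordinate.
End Splitting.

(** * Pairings, cones and lattices *)

Section Pairing.
Variables (R : comNzRingType) (n : nat).
Implicit Types (v w u : 'rV[R]_n).

Lemma pairingDr v u w : pairing v (u + w) = pairing v u + pairing v w.
Proof.
by rewrite /pairing -big_split; apply: eq_bigr => i _; rewrite mxE mulrDr.
Qed.

Lemma pairingDl v u w : pairing (u + w) v = pairing u v + pairing w v.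
Proof.
by rewrite /pairing -big_split; apply: eq_bigr => i _; rewrite mxE mulrDl.
Qed.

Lemma pairingZr a v u : pairing v (a *: u) = a * pairing v u.
Proof.
by rewrite /pairing big_distrr; apply: eq_bigr => i _; rewrite mxE /= mulrCA.
Qed.

Lemma pairingZl a v u : pairing (a *: v) u = a * pairing v u.
Proof.
by rewrite /pairing big_distrr; apply: eq_bigr => i _; rewrite mxE /= mulrA.
Qed.

Lemma pairingC v u : pairing v u = pairing u v.
Proof. by apply: eq_bigr => i _; rewrite mulrC. Qed.

Lemma pairing0r v : pairing v 0 = 0.
Proof. by rewrite -[0 in LHS](scale0r 0) pairingZr mul0r. Qed.

Lemma pairing_sumr I (s : seq I) (F : I -> 'rV[R]_n) v :
  pairing v (\sum_(i <- s) F i) = \sum_(i <- s) pairing v (F i).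
Proof.
elim: s => [|i s IH]; first by rewrite !big_nil pairing0r.
by rewrite !big_cons pairingDr IH.
Qed.

Lemma pairing_deltar v i : pairing v (delta_mx 0 i) = v 0 i.
Proof.
rewrite /pairing (bigD1 i) //= mxE !eqxx mulr1 big1 ?addr0 // => j /negPf ji.
by rewrite mxE ji andbF mulr0.
Qed.

Lemma pairing_deltal u i : pairing (delta_mx 0 i) u = u 0 i.
Proof.
rewrite /pairing (bigD1 i) //= mxE !eqxx mul1r big1 ?addr0 // => j /negPf ji.
by rewrite mxE ji andbF mul0r.
Qed.
End Pairing.

Lemma pairing_toQ n (v u : 'rV[int]_n) : pairing (toQ v) (toQ u) = (pairing v u)%:~R.
Proof.
by rewrite /pairing rmorph_sum; apply: eq_bigr => i _; rewrite !mxE rmorphM.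
Qed.

Lemma toQZ n (k : int) (v : 'rV[int]_n) : toQ (k *: v) = k%:~R *: toQ v.
Proof. by apply/rowP => i; rewrite !mxE rmorphM. Qed.

Lemma toQB n (v w : 'rV[int]_n) : toQ (v - w) = toQ v - toQ w.
Proof. by apply/rowP => i; rewrite !mxE rmorphB. Qed.

Lemma toQD n (v w : 'rV[int]_n) : toQ (v + w) = toQ v + toQ w.
Proof. by apply/rowP => i; rewrite !mxE rmorphD. Qed.

Lemma toQ_delta n i : toQ (delta_mx 0 i : 'rV[int]_n) = delta_mx 0 i.
Proof. by apply/rowP => j; rewrite !mxE; case: (_ && _). Qed.

Lemma clear_denominators m n (A : 'M[rat]_(m, n)) :
  exists (D : int) (B : 'M[int]_(m, n)), 0 < D /\ map_mx intr B = D%:~R *: A.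
Proof.
pose D := \prod_i \prod_j denq (A i j).
have D_gt0 : 0 < D by apply: prodr_gt0 => i _; apply: prodr_gt0 => j _; apply: denq_gt0.
pose c i j := \prod_(k | k != i) \prod_l denq (A k l) * \prod_(l | l != j) denq (A i l).
exists D, (\matrix_(i, j) (c i j * numq (A i j))); split=> //.
apply/matrixP => i j; rewrite !mxE -[in RHS](divq_num_den (A i j)).
have -> : D = c i j * denq (A i j).
  rewrite /D /c (bigD1 i) //= (bigD1 j) //=; ring.
by rewrite !rmorphM /=; field; rewrite intr_eq0 denq_eq0.
Qed.

Lemma primitive_delta n i : primitive (delta_mx 0 i : 'rV[int]_n).
Proof.
move=> k w /rowP/(_ i); rewrite !mxE !eqxx => /esym E.
have : (absz k * absz (w 0%R i))%N = 1%N by rewrite -abszM E.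
by move/eqP; rewrite muln_eq1 => /andP[/eqP k1 _]; rewrite -abszE k1.
Qed.

Section Cone.
Variable n : nat.
Implicit Types (C S : 'rV[rat]_n -> Prop) (v w : 'rV[int]_n).

Lemma cone_span_sub S x : S x -> cone_span S x.
Proof.
move=> Sx; exists 1%N, (fun=> 1), (fun=> x); split; first by move=> i; rewrite ler01.
by rewrite big_ord1 scale1r.
Qed.

Lemma dual_cone_span S x : dual_cone (cone_span S) x <->
  forall y, S y -> 0 <= pairing x y.
Proof.
split=> [H y Sy|H _ [k [a [s [as_ge0 ->]]]]]; first exact/H/cone_span_sub.
rewrite pairing_sumr; apply: sumr_ge0 => i _; have [ai si] := as_ge0 i.
by rewrite pairingZr mulr_ge0 ?H.
Qed.

(** In lowest terms the denominator of [c] divides [v] and its numerator divides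
    [w]. *)
Lemma primitive_proportional v w (c : rat) : primitive v -> primitive w ->
  0 <= c -> toQ w = c *: toQ v -> w = v.
Proof.
move=> pv pw c_ge0 wcv.
have E i : denq c * w 0 i = numq c * v 0 i.
  apply: (@intr_inj rat); rewrite !rmorphM /= numqE.
  have := congr1 (fun x : 'rV_n => x 0 i) wcv; rewrite !mxE => ->; ring.
have dv i : (denq c %| v 0%R i)%Z.
  rewrite -(Gauss_dvdzr (m := denq c) (n := numq c)).
    by rewrite -E dvdz_mulr.
  rewrite coprimez_sym /coprimez /gcdz /=; have := coprime_num_den c.
    by rewrite /coprime => /eqP ->.
have d1 : `|denq c| = 1.
  apply: (pv _ (\row_i (v 0%R i %/ denq c)%Z)); apply/rowP => i.
  by rewrite !mxE mulrC divzK.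
have {}d1 : denq c = 1 by rewrite -d1 gtr0_norm.
have wv : w = numq c *: v by apply/rowP => i; rewrite mxE -E d1 mul1r.
have n1 : numq c = 1 by rewrite -(pw _ _ wv) ger0_norm // numq_ge0.
by rewrite wv n1 scale1r.
Qed.

Lemma primitive_on_ray_in C v : primitive_on_ray C v -> C (toQ v).
Proof.
move=> [_ [u _ /(_ (toQ v)) [H _]]]; apply: (H _).1.
by exists 1; rewrite ?ler01 ?scale1r.
Qed.

Variables (C : 'rV[rat]_n -> Prop) (E : seq 'rV[int]_n).
Hypothesis CE : forall x, C x <-> forall u, u \in E -> 0 <= pairing x (toQ u).

Definition vanishing v : (size E).-tuple bool :=
  map_tuple (fun u => pairing v u == 0) (in_tuple E).

(** If the same generators vanish on [v] and [w], then k v - w lies in the cone for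
    large k; so the face spanned by [v] contains [w]. *)
Lemma ray_proportional v w : primitive_on_ray C v -> primitive_on_ray C w ->
  vanishing v = vanishing w -> v = w.
Proof.
move=> rv rw vw; have Cv := primitive_on_ray_in rv; have Cw := primitive_on_ray_in rw.
have [pv [f fC fE]] := rv; have [pw _] := rw.
have posE x : C (toQ x) -> forall u, u \in E -> 0 <= pairing x u.
  by move=> /CE H u uE; have := H u uE; rewrite pairing_toQ ler0z.
(* Integrality helps: pairing v u is at least 1 when it is not zero. *)
pose k : int := \sum_(u <- E) pairing w u.
have Ck : C (toQ (k *: v - w)).
  apply/CE => u uE; rewrite pairing_toQ ler0z.
  rewrite -[- w]scaleN1r pairingDl !pairingZl mulN1r subr_ge0.
  have wk : pairing w u <= k.
    rewrite /k; elim: (E) uE (posE w Cw) => // x s IH.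
    rewrite inE big_cons => /orP[/eqP <- pos|us pos].
      rewrite lerDl big_seq sumr_ge0 // => y ys; apply: pos.
      by rewrite inE ys orbT.
    apply: le_trans (IH us _) _; last by rewrite lerDr pos ?mem_head.
    by move=> y ys; apply: pos; rewrite inE ys orbT.
  have /(congr1 (fun t : seq bool => nth true t (index u E))) :
    [seq pairing v x == 0 | x <- E] = [seq pairing w x == 0 | x <- E].
    exact: (congr1 val vw).
  rewrite !(nth_map 0) ?index_mem // !nth_index //.
  case: eqP => [-> /esym/eqP ->|/eqP v0 _]; first by rewrite mulr0.
  apply: (le_trans wk); rewrite ler_peMr //.
    by apply: le_trans wk; apply: posE.
  by rewrite -gtz0_ge1 lt_neqAle eq_sym v0 posE.
have v0 : pairing (toQ v) f = 0.
  by have [] := (fE (toQ v)).1 (ex_intro2 _ _ 1 ler01 (esym (scale1r _))).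
have w0 : pairing (toQ w) f = 0.
  have := fC _ Ck; rewrite pairingC toQB toQZ -[- toQ w]scaleN1r.
  rewrite pairingDl !pairingZl v0 mulr0 add0r mulN1r oppr_ge0 => le0.
  by apply/eqP; rewrite eq_le le0 pairingC fC.
have [c c_ge0 wcv] := (fE (toQ w)).2 (conj Cw w0).
exact/esym/(primitive_proportional pv pw c_ge0 wcv).
Qed.

(** A ray is determined by the set of generators vanishing on it. *)
Lemma finitely_many_rays : exists m (p : 'I_m -> 'rV[int]_n),
  injective p /\ forall v, primitive_on_ray C v <-> exists i, v = p i.
Proof.
pose ray (t : (size E).-tuple bool) v := primitive_on_ray C v /\ vanishing v = t.
pose chosen t := epsilon (inhabits (0 : 'rV[int]_n)) (ray t).
have chosenP v : primitive_on_ray C v -> v = chosen (vanishing v).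
  move=> rv; have [rc vc] : ray (vanishing v) (chosen (vanishing v)).
    by apply: epsilon_spec; exists v.
  exact: ray_proportional.
pose s := undup [seq v <- [seq chosen t | t <- enum {: (size E).-tuple bool}] |
    if excluded_middle_informative (primitive_on_ray C v) then true else false].
have sP v : primitive_on_ray C v <-> v \in s.
  rewrite mem_undup mem_filter; case: excluded_middle_informative => //= rv.
  split=> // _; apply/mapP; exists (vanishing v); rewrite ?mem_enum //.
  exact: chosenP.
exists (size s), (fun i => nth 0 s i); split.
  move=> i j /eqP; rewrite nth_uniq ?undup_uniq // => /eqP.
  exact: val_inj.
move=> v; rewrite sP; split=> [vs|[i ->]]; last exact: mem_nth.
have lt : (index v s < size s)%N by rewrite index_mem.
by exists (Ordinal lt); rewrite nth_index.
Qed.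
End Cone.

(** A positive coordinate i of [v] splits v into a multiple of the i-th basis vector
    and a vector of the orthant, so the ray of [v] contains that basis vector. *)
Lemma orthant_rays n (C : 'rV[rat]_n -> Prop) :
    (forall x, C x <-> forall i, 0 <= x 0 i) ->
  forall v, primitive_on_ray C v <-> exists i : 'I_n, v = delta_mx 0 i.
Proof.
move=> CE v; split=> [rv|[i ->]].
  have Cv := primitive_on_ray_in rv; have [pv [f fC fE]] := rv.
  have [i vi] : exists i, v 0 i != 0.
    apply/existsP; apply: contraT => /existsPn v0.
    have := pv 0 v; rewrite normr0 scale0r => H.
    suff /H : v = 0 by move/eqP; rewrite eq_sym oner_eq0.
    by apply/rowP => i; rewrite mxE; apply/eqP; rewrite -[_ == _]negbK; apply: v0.
  have Cd : C (toQ (delta_mx 0 i)).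
    by apply/CE => j; rewrite !mxE; case: (_ && _); rewrite ?ler01.
  have vi_gt0 : 0 < toQ v 0 i.
    by rewrite lt_neqAle (CE _).1 // andbT eq_sym mxE intr_eq0.
  have Cr : C (toQ v - toQ v 0 i *: toQ (delta_mx 0 i)).
    apply/CE => j.
    have -> : (toQ v - toQ v 0 i *: toQ (delta_mx 0 i)) 0 j =
        toQ v 0 j - toQ v 0 i * (j == i)%:R by rewrite toQ_delta !mxE eqxx.
    case: (eqVneq j i) => [->|ji]; first by rewrite mulr1 subrr.
    by rewrite mulr0 subr0 (CE _).1.
  have v0 : pairing (toQ v) f = 0.
    by have [] := (fE (toQ v)).1 (ex_intro2 _ _ 1 ler01 (esym (scale1r _))).
  have d0 : pairing (toQ (delta_mx 0 i)) f = 0.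
    have := fC _ Cr; rewrite pairingC -scaleNr pairingDl pairingZl v0 add0r.
    rewrite mulNr oppr_ge0 pmulr_rle0 // => le0.
    by apply/eqP; rewrite eq_le le0 pairingC (fC _ Cd).
  have [k k_ge0 dk] := (fE _).2 (conj Cd d0).
  exists i; apply/esym/(primitive_proportional pv _ k_ge0 dk); exact: primitive_delta.
split; first exact: primitive_delta.
exists (\row_j (j != i)%:R) => [x Cx|x].
  rewrite pairingC; apply: sumr_ge0 => j _; rewrite mxE mulr_ge0 ?ler0n //.
  exact: (CE _).1.
rewrite toQ_delta; split=> [[k k_ge0 ->]|[Cx /eqP]].
  split; first by apply/CE => j; rewrite !mxE mulr_ge0 ?ler0n.
  by rewrite pairingZl pairing_deltal mxE eqxx mulr0.
rewrite psumr_eq0 => [/allP x0|j _]; last by rewrite mxE mulr_ge0 ?ler0n ?(CE _).1.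
exists (x 0 i); first exact: (CE _).1.
apply/rowP => j; rewrite !mxE eqxx; case: (eqVneq j i) => [->|ji]; first by rewrite mulr1.
by have := x0 j (mem_index_enum j); rewrite mxE ji mulr1 mulr0 => /eqP.
Qed.

Section Complement.
Variable n : nat.
Variable C : 'rV[rat]_n -> Prop.

Lemma lin_spanZ a x : lin_span C x -> lin_span C (a *: x).
Proof.
move=> [k [c [s [Cs ->]]]]; exists k, (fun i => a * c i), s; split=> //.
by rewrite scaler_sumr; apply: eq_bigr => i _; rewrite scalerA.
Qed.

Lemma lin_span0 : lin_span C 0.
Proof. by exists 0%N, (fun=> 0), (fun=> 0); split; [case|rewrite big_ord0]. Qed.

Lemma lin_spanD x y : lin_span C x -> lin_span C y -> lin_span C (x + y).
Proof.
move=> [k [c [s [Cs ->]]]] [l [e [t [Ct ->]]]].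
exists (k + l)%N, (fun i => match split i with inl i => c i | inr j => e j end),
  (fun i => match split i with inl i => s i | inr j => t j end); split.
  by move=> i; case: split.
rewrite big_split_ord; congr (_ + _); apply: eq_bigr => i _.
  by rewrite (unsplitK (inl i)).
by rewrite (unsplitK (inr i)).
Qed.

Lemma lin_span_rows m (A : 'M[rat]_(m, n)) x :
  (forall i, lin_span C (row i A)) -> (x <= A)%MS -> lin_span C x.
Proof.
move=> CA /submxP[D ->]; rewrite mulmx_sum_row.
elim/big_ind: _ => [|y z|i _]; [exact: lin_span0|exact: lin_spanD|exact: lin_spanZ].
Qed.

(** The rows of [A] are chosen in the span so that its rank is maximal. *)
Lemma lin_span_matrix : exists A : 'M[rat]_n, forall x, lin_span C x <-> (x <= A)%MS.
Proof.
pose P k := exists A : 'M[rat]_n, (forall i, lin_span C (row i A)) /\ \rank A = k.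
have P0 : P 0%N.
  exists 0; split; last by rewrite mxrank0.
  by move=> i; rewrite row0; apply: lin_span0.
have Pn k : P k -> (k <= n)%N by move=> [A [_ <-]]; apply: rank_leq_row.
have [k [[A [CA rkA]] maxk]] := bounded_maximum P0 Pn.
exists A => x; split; last exact: lin_span_rows.
move=> Cx; have sub : (A <= A + x)%MS by apply: addsmxSl.
have : (\rank (A + x)%MS <= \rank A)%N.
  rewrite rkA; apply: maxk; exists (A + x)%MS; split=> // i.
  apply: (@lin_span_rows _ (col_mx A x)).
    move=> j; rewrite -(splitK j); case: split => l /=.
      by rewrite rowKu.
    by rewrite rowKd (_ : row l x = x) //; apply/rowP => c; rewrite mxE !ord1.
  by rewrite -addsmxE; apply: row_sub.
move=> le; apply: submx_trans (addsmxSr A x) _.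
suff /andP[] : (A == A + x)%MS by [].
by rewrite -(mxrank_leqif_eq sub).2 eqn_leq le mxrankS.
Qed.

(** The sublattice is the kernel of an integer matrix.  In a basis that puts this
    matrix into Smith normal form the kernel is spanned by part of the basis, and
    the rest of the basis spans a complement. *)
Lemma saturated_complement : exists mt (b : 'I_mt -> 'rV[int]_n),
  splitting (fun v => lin_span C (toQ v)) b.
Proof.
have [V VE] := lin_span_matrix.
have [D [A [D_gt0 AE]]] := clear_denominators (cokermx V).
have N0E v : lin_span C (toQ v) <-> v *m A = 0.
  rewrite VE submxE; have D0 : (D%:~R : rat) != 0 by rewrite intr_eq0 gt_eqF.
  have -> : (toQ v *m cokermx V == 0) = (map_mx (intr : int -> rat) (v *m A) == 0).
    by rewrite map_mxM AE -scalemxAr scaler_eq0 (negPf D0).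
  split=> [/eqP/rowP H|->]; last by rewrite map_mx0.
  by apply/rowP => i; have := H i; rewrite !mxE => /eqP; rewrite intr_eq0 => /eqP.
have [L uL [R uR [d _ AS]]] := int_Smith_normal_form A.
set Dg := \matrix_(_, _) _ in AS.
have killE v : lin_span C (toQ v) <-> forall j : 'I_n, d`_j != 0 -> (v *m L) 0 j = 0.
  have vDE j : (v *m L *m Dg) 0 j = (v *m L) 0 j * d`_j.
    rewrite mxE (bigD1 j) //= [Dg _ _]mxE eqxx mulr1n big1 ?addr0 // => i ij.
    by rewrite [Dg _ _]mxE (negPf (ij : (i : nat) != j)) mulr0n mulr0.
  rewrite N0E AS !mulmxA; split=> [H j dj|H].
    have /rowP/(_ j) : v *m L *m Dg = 0 by rewrite -[LHS](mulmxK uR) H mul0mx.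
    rewrite vDE [in RHS]mxE => /eqP; rewrite mulf_eq0 (negPf dj) orbF.
    by move/eqP.
  suff -> : v *m L *m Dg = 0 by rewrite mul0mx.
  apply/rowP => j; rewrite vDE [RHS]mxE; case: (eqVneq d`_j 0) => [->|dj].
    by rewrite mulr0.
  by rewrite H ?mul0r.
pose J := [set j : 'I_n | d`_j != 0].
pose b (k : 'I_#|J|) := row (enum_val k) (invmx L).
have bL (c : 'rV[int]_#|J|) k : ((\sum_j c 0 j *: b j) *m L) 0 (enum_val k) = c 0 k.
  rewrite mulmx_suml summxE (bigD1 k) //= big1 ?addr0 => [|l lk].
    by rewrite -scalemxAl -row_mul mulVmx // !mxE eqxx mulr1.
  rewrite -scalemxAl -row_mul mulVmx // !mxE (inj_eq enum_val_inj) (negPf lk).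
  by rewrite mulr0.
exists #|J|, b => v.
pose c : 'rV[int]_#|J| := \row_k (v *m L) 0 (enum_val k).
exists (v - \sum_j c 0 j *: b j, c); split=> /=.
  split; last by rewrite subrK.
  apply/killE => j dj; have jJ : j \in J by rewrite inE.
  have [k ->] : exists k : 'I_#|J|, j = enum_val k.
    by exists (enum_rank_in jJ j); rewrite enum_rankK_in.
  by rewrite mulmxBl mxE [X in _ + X]mxE bL [c _ _]mxE subrr.
move=> [v0 e] /= [Nv0 vE].
have ce : c = e.
  apply/rowP => k; rewrite [LHS]mxE vE mulmxDl mxE bL (killE v0).1 ?add0r //.
  by have := enum_valP k; rewrite inE.
by rewrite ce {1}vE addrK.
Qed.

End Complement.

(** * The torus action and the Cox map *)

Lemma poly_eq1_off0 (K : closedFieldType) (q : {poly K}) :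
  (forall z, z != 0 -> q.[z] = 1) -> q.[0] = 1.
Proof.
move=> q1; apply/eqP; rewrite -subr_eq0.
have -> : q.[0] - 1 = (q - 1%:P).[0] by rewrite hornerD hornerN hornerC.
suff -> : q - 1%:P = 0 by rewrite horner0.
apply/eqP; apply: contraTT isT => q0.
have /closed_nonrootP[z] : 'X * (q - 1%:P) != 0 by rewrite mulf_neq0 ?polyX_eq0.
rewrite /root hornerM hornerX hornerD hornerN hornerC mulf_eq0 negb_or.
by case/andP => z0; rewrite q1 // subrr eqxx.
Qed.

Lemma exprz_sum (K : fieldType) (z : K) (I : Type) (q : seq I) (e : I -> int) : z != 0 ->
  z ^ (\sum_(i <- q) e i) = \prod_(i <- q) z ^ e i.
Proof.
by move=> z0; elim/big_rec2: _ => [|i a v _ <-]; rewrite ?expr0z // expfzDr.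
Qed.

Section Toric.
Variables (K : closedFieldType) (charK : [pchar K] =i pred0).
Variables (N : nat) (X : aset K N) (mu : 'rV[K]_N -> 'rV[K]_N -> 'rV[K]_N).
Hypotheses (clX : zariski_closed X) (irrX : irreducible X) (monX : alg_monoid X mu).
Variables (r s : nat) (phi : 'rV[K]_(r + s) -> 'rV[K]_N).
Notation G := (@GmGa K r s).
Notation n := (r + s)%N.
Variables (d : {mpoly K[N]}) (ch : chart X mu phi d).
Variables (E : seq 'rV[int]_n) (c : 'I_N -> 'rV[int]_n -> K)
  (F : 'rV[int]_n -> {mpoly K[N]}).
Hypothesis EF : forall u, u \in E -> exponent_ok u /\
  forall g, G g -> pval (F u) (phi g) = character u g.
Hypothesis phiE : forall k g, G g -> phi g 0 k = \sum_(u <- E) c k u * character u g.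

(** The formula is forced on the image of the chart, where the functions [F u] are
    the characters; it makes sense on all of [X]. *)
Definition torus_act (t : 'rV[K]_n) (x : 'rV[K]_N) : 'rV[K]_N :=
  \row_k \sum_(u <- E) c k u * character u t * pval (F u) x.

Definition base_point : 'rV[K]_N := phi (@torus_one K n).

Lemma torus_mul_GmGa t g : torus t -> G g -> G (torus_mul t g).
Proof. by move=> tt Gg j; rewrite mxE mulf_neq0. Qed.

Lemma torus_act_chart t g : torus t -> G g -> torus_act t (phi g) = phi (torus_mul t g).
Proof.
move=> tt Gg; apply/rowP => k; rewrite mxE phiE; last exact: torus_mul_GmGa.
rewrite big_seq [RHS]big_seq; apply: eq_bigr => u /EF[_ Fu].
by rewrite character_mul Fu // mulrA.
Qed.

Lemma torus_mul1r t : torus_mul t (@torus_one K n) = t.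
Proof. by apply/rowP => i; rewrite !mxE mulr1. Qed.

Lemma torus_mul1l t : torus_mul (@torus_one K n) t = t.
Proof. by apply/rowP => i; rewrite !mxE mul1r. Qed.

Lemma torus_act_base t : torus t -> torus_act t base_point = phi t.
Proof.
move=> tt; rewrite torus_act_chart ?torus_mul1r //.
exact/torus_GmGa/torus_one_torus.
Qed.

Lemma torus_act_polynomial t k : exists p, forall x, torus_act t x 0 k = pval p x.
Proof.
exists (\sum_(u <- E) (c k u * character u t) *: F u) => x.
by rewrite mxE pval_sum; apply: eq_bigr => u _; rewrite pvalZ.
Qed.

Lemma torus_act_gfrac (Y : aset K N) t k : gfrac Y (fun x => torus_act t x 0 k).
Proof.
have [p pE] := torus_act_polynomial t k.
by apply: gfrac_ext (gfrac_pval Y p) => x _; rewrite pE.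
Qed.

Lemma torus_act_in t x : torus t -> X x -> X (torus_act t x).
Proof.
move=> tt; have [S XS] := clX; move=> Xx; apply/XS => p Sp.
apply: (chart_dense irrX ch (f := fun y => pval p (torus_act t y))) Xx.
  by apply: gfrac_pval_comp => k; apply: torus_act_gfrac.
move=> g Gg; rewrite torus_act_chart //; apply: (XS _).1 => //.
exact/(chart_in ch)/torus_mul_GmGa.
Qed.

Lemma gfrac_character M (Y : aset K M) (psi : 'rV[K]_M -> 'rV[K]_n) u :
  (forall j, gfrac Y (fun x => psi x 0 j)) -> (forall x, Y x -> torus (psi x)) ->
  gfrac Y (fun x => character u (psi x)).
Proof.
move=> Gpsi Tpsi; apply: gfrac_prod => i; apply: gfrac_expz => //.
by right=> x /Tpsi.
Qed.

(** The orbit consists of the units whose additive coordinates do not vanish. *)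
Lemma orbit_principal : exists Q, forall x, X x ->
  (pval Q x != 0 <-> exists2 t, torus t & x = torus_act t base_point).
Proof.
have [pk Hpk] := chart_coords ch.
exists (d * \prod_j (pk j).1) => x Xx; rewrite pvalM mulf_eq0 negb_or pval_prod.
split=> [/andP[dx /prodf_neq0 px]|[t tt ->]].
  have [g Gg xE] := chart_onto ch Xx dx; exists g.
    move=> j; rewrite Hpk // mulf_neq0 // -xE ?px //.
    by rewrite invr_eq0 expf_neq0.
  rewrite torus_act_base // => j; rewrite Hpk // mulf_neq0 // -xE ?px //.
  by rewrite invr_eq0 expf_neq0.
rewrite torus_act_base // (chart_open ch) /=; last exact: torus_GmGa.
apply/prodf_neq0 => j _; have := tt j; rewrite Hpk; last exact: torus_GmGa.
by rewrite mulf_eq0 negb_or => /andP[].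
Qed.

Theorem torus_act_toric : toric_action X torus_act base_point.
Proof.
have Gone : G (@torus_one K n) by apply/torus_GmGa/torus_one_torus.
split.
- apply: gfrac_morphism => [x [tx Xx]|k]; first exact: torus_act_in.
  apply: (@gfrac_ext _ _ _ (fun z => \sum_(u <- E)
      c k u * character u (lsubmx z) * pval (F u) (rsubmx z))).
    by move=> z _; rewrite mxE.
  apply: gfrac_sum => u; apply: gfracM; first apply: gfracM.
  + exact: gfracC.
  + apply: gfrac_character => [j|z [] //].
    by apply: gfrac_ext (gfrac_coord _ (lshift N j)) => z _; rewrite mxE.
  + apply: gfrac_pval_comp => j.
    by apply: gfrac_ext (gfrac_coord _ (rshift n j)) => z _; rewrite mxE.
- split=> [x Xx|t t' x tt tt' Xx].
    apply/rowP => k; apply/eqP; rewrite -subr_eq0; apply/eqP.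
    apply: (chart_dense irrX ch (f := fun y => torus_act torus_one y 0 k - y 0 k)) Xx.
      by apply: gfracB; [apply: torus_act_gfrac | apply: gfrac_coord].
    move=> g Gg; rewrite torus_act_chart ?torus_mul1l ?subrr //.
    exact: torus_one_torus.
  apply/rowP => k; apply/eqP; rewrite -subr_eq0; apply/eqP.
  apply: (chart_dense irrX ch (f := fun y =>
    torus_act (torus_mul t t') y 0 k - torus_act t (torus_act t' y) 0 k)) Xx.
    apply: gfracB; first exact: torus_act_gfrac.
    apply: (gfrac_comp (torus_act_gfrac (fun=> True) t k)) => // j.
    exact: torus_act_gfrac.
  move=> g Gg; rewrite !torus_act_chart //; try exact: torus_mul_GmGa.
    rewrite (_ : torus_mul (torus_mul t t') g = torus_mul t (torus_mul t' g)) ?subrr //.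
    by apply/rowP => i; rewrite !mxE mulrA.
  exact: torus_mulP.
- move=> t tt act1; have := act1 _ (chart_in ch Gone).
  rewrite torus_act_base // => /(chart_inj ch); apply=> //.
split; first exact: (chart_in ch).
have [Q QE] := orbit_principal.
exists (fun x => pval Q x = 0); first exact: closed_pval_zero.
move=> x; split=> [[t tt xE]|[Xx /eqP Qx]]; last exact/QE.
have Xx : X x by rewrite xE; apply: torus_act_in => //; apply: (chart_in ch).
by split=> //; apply/eqP/QE => //; exists t.
Qed.

(** A function extending the character [u] has a Laurent expansion on the chart,
    which by independence of characters consists of the single term [u]. *)
Lemma weight_monoidP u :
  weight_monoid X torus_act base_point u <-> weight phi u.
Proof.
split=> [[f [regf fu]]|[okE [p pu]]]; last first.
  exists (pval p); split; first exact/gfrac_regular/gfrac_pval.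
  by move=> t tt; rewrite torus_act_base // -pu //; apply: torus_GmGa.
have [p fp] := regular_on_closed charK clX regf.
have [E' [c' [uE' okE' pE']]] := regular_GmGa_laurent charK
  (gfrac_regular (chart_pval_gfrac ch p)).
have sum_u t : torus t -> \sum_(w <- E') c' w * character w t = character u t.
  move=> tt; rewrite -fu // torus_act_base // fp ?pE' //; try exact: torus_GmGa.
  exact/(chart_in ch)/torus_GmGa.
have uu : u \in E'.
  apply: contraT => nu.
  pose c1 w : K := if w == u then -1 else c' w.
  have E1 : uniq (u :: E') by rewrite /= nu.
  have sum0 t : torus t -> \sum_(w <- u :: E') c1 w * character w t = 0.
    move=> tt; rewrite big_cons /c1 eqxx mulN1r -(sum_u t tt) addrC.
    apply/eqP; rewrite subr_eq0; apply/eqP; rewrite big_seq [RHS]big_seq.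
    apply: eq_bigr => w wE; case: eqP => // wu.
    by rewrite -wu wE in nu.
  have := characters_independent charK E1 sum0 (mem_head _ _).
  by rewrite /c1 eqxx => /eqP; rewrite oppr_eq0 oner_eq0.
split; first exact: okE'.
have c'E w : w \in E' -> c' w = (w == u)%:R.
  move=> wE; apply/eqP; rewrite -subr_eq0; apply/eqP.
  apply: (characters_independent charK (c := fun w => c' w - (w == u)%:R) uE') wE.
  move=> t tt; rewrite -[RHS](subrr (character u t)) -{1}(sum_u t tt).
  under eq_bigr do rewrite mulrBl; rewrite sumrB; congr (_ - _).
  rewrite (bigD1_seq u) //= eqxx mul1r big1 ?addr0 // => v /negPf ->.
  by rewrite mul0r.
exists p => g Gg; rewrite pE' // (bigD1_seq u) //= c'E // eqxx mul1r.
rewrite big_seq_cond big1 ?addr0 // => w /andP[wE /negPf wu].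
by rewrite c'E // wu mul0r.
Qed.

Local Notation sig := (sigma X torus_act base_point).

Lemma sigmaP x : sig x <-> forall u, weight phi u -> 0 <= pairing x (toQ u).
Proof.
rewrite /sigma /omega dual_cone_span; split=> [H u wu|H _ [u /weight_monoidP wu ->]].
  by apply: H; exists u => //; apply/weight_monoidP.
exact: H.
Qed.

(** Along the one-parameter subgroup of [w] all coordinates of [X] are regular
    at 0, so no function on [X] can have a pole there. *)
Lemma weights_generated (w : 'rV[int]_n) u :
  (forall u', u' \in E -> 0 <= pairing w u') -> weight phi u -> 0 <= pairing w u.
Proof.
move=> wE [_ [p pu]]; rewrite leNgt; apply/negP => neg.
pose lam (z : K) : 'rV[K]_n := \row_i z ^ w 0 i.
have lamT z : z != 0 -> torus (lam z) by move=> z0 i; rewrite mxE expfz_neq0.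
have char_lam v z : z != 0 -> character v (lam z) = z ^ pairing w v.
  move=> z0; rewrite /character /pairing exprz_sum //.
  by apply: eq_bigr => i _; rewrite mxE exprz_exp.
pose R k : {poly K} := \sum_(v <- E) c k v *: 'X^(absz (pairing w v)).
have RE k z : z != 0 -> phi (lam z) 0 k = (R k).[z].
  move=> z0; rewrite phiE; last exact/torus_GmGa/lamT.
  rewrite /R horner_sum big_seq [RHS]big_seq; apply: eq_bigr => v vE.
  rewrite char_lam // hornerZ hornerXn -{1}(gez0_abs (wE v vE)).
  by [].
pose q := mmap polyC R p.
have qE z : q.[z] = pval p (\row_k (R k).[z]).
  rewrite /q /mmap horner_sum pvalE; apply: eq_bigr => m _.
  rewrite hornerM hornerC /mmap1 horner_prod; congr (_ * _).
  by apply: eq_bigr => k _; rewrite horner_exp mxE.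
have q1 z : z != 0 -> (q * 'X^(absz (pairing w u))).[z] = 1.
  move=> z0; rewrite hornerM hornerXn qE.
  rewrite (_ : \row_k _ = phi (lam z)); last first.
    by apply/rowP => k; rewrite mxE RE.
  rewrite -pu ?char_lam //; last exact/torus_GmGa/lamT.
  have {1}-> : pairing w u = - (absz (pairing w u))%:Z by rewrite ltz0_abs // opprK.
  by rewrite -exprnN mulVf ?expf_neq0.
have := poly_eq1_off0 q1; rewrite hornerM hornerXn expr0n absz_eq0 lt_eqF //.
by rewrite mulr0 => /esym/eqP; rewrite oner_eq0.
Qed.

Lemma sigma_generated x :
  sig x <-> forall u, u \in E -> 0 <= pairing x (toQ u).
Proof.
rewrite sigmaP; split=> [H u /EF[okE Fu]|H u wu].
  by apply: H; split=> //; exists (F u) => g Gg; rewrite Fu.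
have [D [w [D_gt0 wD]]] := clear_denominators x.
have wE v : (pairing w v)%:~R = D%:~R * pairing x (toQ v).
  by rewrite -pairing_toQ -pairingZl -wD.
have D0 : 0 < (D%:~R : rat) by rewrite ltr0z.
rewrite -(pmulr_rge0 _ D0) -wE ler0z; apply: weights_generated wu => v vE.
by rewrite -(ler0z rat) wE pmulr_rge0 ?H.
Qed.

Section CoxMap.
Variables (m mt : nat) (p : 'I_m -> 'rV[int]_n) (b : 'I_mt -> 'rV[int]_n).
Hypothesis p_sigma : forall j, sig (toQ (p j)).
Notation XB := (@Xbar K m mt).
Implicit Types x y : 'rV[K]_(m + mt).

Lemma ray_weight_ge0 j u : weight phi u -> 0 <= pairing (p j) u.
Proof. by move=> wu; have := (sigmaP _).1 (p_sigma j) u wu; rewrite pairing_toQ ler0z. Qed.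

Lemma E_weight u : u \in E -> weight phi u.
Proof.
by move=> /EF[okE Fu]; split=> //; exists (F u) => g Gg; rewrite Fu.
Qed.

(** The only map with the required comorphism, since the coordinates of [X] are
    combinations of the characters in [E]. *)
Definition cox_pi x : 'rV[K]_N :=
  \row_k \sum_(u <- E) c k u * cox_monomial p b u x.

(** The homomorphism of tori that [cox_pi] extends. *)
Definition cox_torus x : 'rV[K]_n :=
  \row_i (\prod_(j < m) x 0 (lshift mt j) ^ p j 0 i *
          \prod_(j < mt) x 0 (rshift m j) ^ b j 0 i).

Lemma character_cox_torus u x : torus x ->
  character u (cox_torus x) = cox_monomial p b u x.
Proof.
move=> tx; have pr k (e : 'I_k -> 'rV[int]_n) (f : 'I_k -> 'I_(m + mt)) :
    \prod_i \prod_(j < k) x 0 (f j) ^ (e j 0 i * u 0 i) =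
    \prod_(j < k) x 0 (f j) ^ pairing (e j) u.
  by rewrite exchange_big; apply: eq_bigr => j _; rewrite /pairing exprz_sum.
have prz k (z : 'I_k -> K) (e : int) : (\prod_j z j) ^ e = \prod_j z j ^ e.
  by elim/big_rec2: _ => [|j a v _ <-]; rewrite ?exp1rz // expfzMl.
rewrite /cox_monomial -!pr -big_split; apply: eq_bigr => i _.
rewrite mxE expfzMl !prz; congr (_ * _); apply: eq_bigr => j _.
  by rewrite exprz_exp.
by rewrite exprz_exp.
Qed.

Lemma torus_cox_torus x : torus x -> torus (cox_torus x).
Proof.
move=> tx i; rewrite mxE mulf_neq0 //; apply/prodf_neq0 => j _;
  by rewrite expfz_neq0.
Qed.

Lemma cox_pi_torus x : torus x -> cox_pi x = phi (cox_torus x).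
Proof.
move=> tx; apply/rowP => k; rewrite mxE phiE; last exact/torus_GmGa/torus_cox_torus.
by apply: eq_bigr => u _; rewrite character_cox_torus.
Qed.

Lemma cox_monomial_gfrac u : weight phi u -> gfrac XB (cox_monomial p b u).
Proof.
move=> wu; apply: gfracM; apply: gfrac_prod => j; apply: gfrac_expz.
- by left; apply: ray_weight_ge0.
- exact: gfrac_coord.
- by right=> x; apply.
- exact: gfrac_coord.
Qed.

Lemma cox_pi_gfrac k : gfrac XB (fun x => cox_pi x 0 k).
Proof.
apply: (@gfrac_ext _ _ _ (fun x => \sum_(u <- E)
    (if u \in E then c k u * cox_monomial p b u x else 0))).
  move=> x _; rewrite mxE big_seq [RHS]big_seq; apply: eq_bigr => u uE.
  by rewrite uE.
apply: gfrac_sum => u; case: (boolP (u \in E)) => uE; last exact: gfracC.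
by apply: gfracM; [exact: gfracC|apply/cox_monomial_gfrac/E_weight].
Qed.

Definition all_coords : {mpoly K[m + mt]} := \prod_i 'X_i.

Lemma all_coords_torus x : pval all_coords x != 0 <-> torus x.
Proof.
rewrite pval_prod; split=> [/prodf_neq0 H i|tx].
  by have := H i isT; rewrite pvalX.
by apply/prodf_neq0 => i _; rewrite pvalX; apply: tx.
Qed.

Lemma Xbar_torus x : torus x -> XB x.
Proof. by move=> tx j. Qed.

Lemma Xbar_principal x :
  XB x <-> pval (\prod_(j < mt) 'X_(rshift m j)) x != 0.
Proof.
rewrite pval_prod; split=> [Xx|/prodf_neq0 H j].
  by apply/prodf_neq0 => j _; rewrite pvalX; apply: Xx.
by have := H j isT; rewrite pvalX.
Qed.

Lemma Xbar_variety : variety XB.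
Proof.
apply: (principal_variety charK Xbar_principal).
by exists (@torus_one K _); apply/Xbar_torus/torus_one_torus.
Qed.

Lemma Xbar_dense f g : gfrac XB f -> gfrac XB g ->
  (forall x, torus x -> f x = g x) -> forall x, XB x -> f x = g x.
Proof.
move=> Gf Gg fg; apply: (gfrac_density Xbar_variety.2 Gf Gg (gfrac_pval _ all_coords)).
  exists (@torus_one K _); first exact/Xbar_torus/torus_one_torus.
  exact/all_coords_torus/torus_one_torus.
by move=> x _ /all_coords_torus; apply: fg.
Qed.

Lemma cox_pi_in x : XB x -> X (cox_pi x).
Proof.
have [S XS] := clX => Xx; apply/XS => q Sq.
apply: (Xbar_dense (f := fun x => pval q (cox_pi x)) (g := fun=> 0)) Xx.
- exact: gfrac_pval_comp cox_pi_gfrac.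
- exact: gfracC.
move=> y ty; rewrite cox_pi_torus //; apply: (XS _).1 => //.
exact/(chart_in ch)/torus_GmGa/torus_cox_torus.
Qed.

Theorem cox_pi_construction : injective p ->
    (forall v, primitive_on_ray sig v <-> exists i, v = p i) ->
    splitting (lattice_span_sigma X torus_act base_point) b ->
  cox_construction X torus_act base_point p b cox_pi.
Proof.
move=> pinj prays bsplit; split=> //.
  by apply: gfrac_morphism => [x|k]; [exact: cox_pi_in|exact: cox_pi_gfrac].
move=> u f fu; have wu : weight phi u by apply/weight_monoidP; exists f.
have [regf fE] := fu; have [q fq] := regular_on_closed charK clX regf.
move=> x Xx; rewrite fq; last exact: cox_pi_in.
apply: (Xbar_dense (f := fun x => pval q (cox_pi x))) Xx.
- exact: gfrac_pval_comp cox_pi_gfrac.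
- exact: cox_monomial_gfrac.
move=> y ty; have Tt := torus_cox_torus ty.
rewrite cox_pi_torus // -fq; last exact/(chart_in ch)/torus_GmGa.
by rewrite -torus_act_base // fE // character_cox_torus.
Qed.

(** Both sides are regular on the irreducible product, so pairs with [x], [y] and
    [mubar x y] in the torus suffice; there [cox_pi] is [phi] after [cox_torus].
    The condition at (1, 1) provides one such pair. *)
Lemma coherent_on_torus
    (mubar : 'rV[K]_(m + mt) -> 'rV[K]_(m + mt) -> 'rV[K]_(m + mt)) :
    (forall x y, XB x -> XB y -> XB (mubar x y)) ->
    (forall k, gfrac (prod_set XB XB) (fun z => mubar (lsubmx z) (rsubmx z) 0 k)) ->
    torus (mubar torus_one torus_one) ->
    (forall x y, torus x -> torus y -> torus (mubar x y) ->
      cox_torus (mubar x y) = GmGa_mul (cox_torus x) (cox_torus y)) ->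
  coherent cox_pi mu mubar.
Proof.
move=> XBmul Gmul t11 homo x y Xx Xy; apply/rowP => k.
have [P HP] := mul_polynomial charK clX monX.
pose f z := cox_pi (mubar (lsubmx z) (rsubmx z)) 0 k.
pose g z := mu (cox_pi (lsubmx z)) (cox_pi (rsubmx z)) 0 k.
pose h (z : 'rV[K]_((m + mt) + (m + mt))) := pval all_coords (lsubmx z) *
  pval all_coords (rsubmx z) * pval all_coords (mubar (lsubmx z) (rsubmx z)).
have one := @torus_one_torus K (m + mt).
pose z1 : 'rV[K]_((m + mt) + (m + mt)) := row_mx torus_one torus_one.
have irr2 : irreducible (prod_set XB XB).
  pose Q : {mpoly K[(m + mt) + (m + mt)]} :=
    \prod_(j < mt) 'X_(lshift (m + mt) (rshift m j)) *
    \prod_(j < mt) 'X_(rshift (m + mt) (rshift m j)).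
  apply: (irreducible_principal (g := Q) (irreducible_space charK _)) => [z|].
    rewrite /prod_set !Xbar_principal pvalM mulf_eq0 negb_or !pval_prod.
    have -> : \prod_(j < mt) pval 'X_(rshift m j) (lsubmx z) =
        \prod_(j < mt) pval 'X_(lshift (m + mt) (rshift m j)) z.
      by apply: eq_bigr => j _; rewrite !pvalX mxE.
    have -> : \prod_(j < mt) pval 'X_(rshift m j) (rsubmx z) =
        \prod_(j < mt) pval 'X_(rshift (m + mt) (rshift m j)) z.
      by apply: eq_bigr => j _; rewrite !pvalX mxE.
    by split=> [[-> ->]|[_ /andP[-> ->]]].
  by exists z1; rewrite /prod_set row_mxKl row_mxKr; split; apply: Xbar_torus.
have main : forall z, prod_set XB XB z -> f z = g z.
  apply: (gfrac_density (h := h) irr2).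
  - apply: (gfrac_comp (cox_pi_gfrac k)) => [z [Xz Yz]|j]; last exact: Gmul.
    exact: XBmul.
  - apply: (@gfrac_ext _ _ _
      (fun z => pval (P k) (row_mx (cox_pi (lsubmx z)) (cox_pi (rsubmx z))))).
      by move=> z [Xz Yz]; rewrite -HP //; apply: cox_pi_in.
    apply: gfrac_pval_comp => j; rewrite -(splitK j); case: split => i /=.
      apply: (@gfrac_ext _ _ _ (fun z => cox_pi (lsubmx z) 0 i)).
        by move=> z _; rewrite row_mxEl.
      exact: gfrac_lsub (cox_pi_gfrac i).
    apply: (@gfrac_ext _ _ _ (fun z => cox_pi (rsubmx z) 0 i)).
      by move=> z _; rewrite row_mxEr.
    exact: gfrac_rsub (cox_pi_gfrac i).
  - apply: gfracM; last exact: gfrac_pval_comp.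
    by apply: gfracM; [apply: gfrac_lsub|apply: gfrac_rsub]; apply: gfrac_pval.
  - exists z1; first by rewrite /prod_set row_mxKl row_mxKr; split; apply: Xbar_torus.
    by rewrite /h row_mxKl row_mxKr !mulf_neq0 //; apply/all_coords_torus.
  move=> z _; rewrite /h !mulf_eq0 !negb_or => /andP[/andP[]].
  move=> /all_coords_torus tx /all_coords_torus ty /all_coords_torus txy.
  rewrite /f /g !cox_pi_torus // homo // (chart_mul ch) //;
    exact/torus_GmGa/torus_cox_torus.
have := main (row_mx x y); rewrite /f /g row_mxKl row_mxKr; apply.
by rewrite /prod_set row_mxKl row_mxKr.
Qed.

End CoxMap.
End Toric.

(** * Multiplications on the Cox space *)

Lemma monoid_iso_id (K : closedFieldType) N (X : aset K N) mu :
  monoid_iso X mu X mu id.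
Proof.
have id_mor : morphism X X id.
  by apply: gfrac_morphism => // j; apply: gfrac_coord.
by split=> //; exists id; split.
Qed.

Lemma Xbar_monoid (K : closedFieldType) (charK : [pchar K] =i pred0) m mt
    (mubar : 'rV[K]_(m + mt) -> 'rV[K]_(m + mt) -> 'rV[K]_(m + mt)) one :
    (forall x y, Xbar x -> Xbar y -> Xbar (mubar x y)) ->
    (forall k, gfrac (prod_set (@Xbar K m mt) (@Xbar K m mt))
       (fun z => mubar (lsubmx z) (rsubmx z) 0 k)) ->
    (forall x y z, Xbar x -> Xbar y -> Xbar z ->
       mubar x (mubar y z) = mubar (mubar x y) z) ->
    is_unit (@Xbar K m mt) mubar one ->
  alg_monoid (@Xbar K m mt) mubar.
Proof.
move=> Xmul Gmul assoc unit1; split=> //; last by exists one.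
  exact: Xbar_variety.
by apply: gfrac_morphism => // z [Xz Yz]; apply: Xmul.
Qed.

Section SameNormalForm.
Variables (K : closedFieldType) (N : nat) (X : aset K N).
Variable mu : 'rV[K]_N -> 'rV[K]_N -> 'rV[K]_N.
Variables (n r m mt : nat) (p : 'I_m -> 'rV[int]_n) (b : 'I_mt -> 'rV[int]_n).
Variable pi : 'rV[K]_(m + mt) -> 'rV[K]_N.

Definition product_formulas
    (mubar : 'rV[K]_(m + mt) -> 'rV[K]_(m + mt) -> 'rV[K]_(m + mt)) := [/\ r = n ->
    forall x y, Xbar x -> Xbar y -> mubar x y = \row_k (x 0 k * y 0 k),
  r.+1 = n ->
    exists (i : 'I_m) (e : 'rV[int]_n), demazure_root p i e /\
      forall x y, Xbar x -> Xbar y -> mubar x y = mul_root p b i e x y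
  & r = 0%N ->
    [/\ m = n, mt = 0%N, var_iso (@Xbar K m mt) X pi
      & forall x y, Xbar x -> Xbar y -> mubar x y = \row_k (x 0 k + y 0 k)]].

(** The multiplications constructed below satisfy the formulas themselves, so both
    isomorphisms can be the identity. *)
Lemma already_normal mubar : alg_monoid X mu -> alg_monoid (@Xbar K m mt) mubar ->
    coherent pi mu mubar -> product_formulas mubar ->
  exists (mu' : 'rV[K]_N -> 'rV[K]_N -> 'rV[K]_N)
         (mubar' : 'rV[K]_(m + mt) -> 'rV[K]_(m + mt) -> 'rV[K]_(m + mt))
         (phi : 'rV[K]_N -> 'rV[K]_N) (psi : 'rV[K]_(m + mt) -> 'rV[K]_(m + mt)),
    [/\ alg_monoid X mu' /\ monoid_iso X mu X mu' phi,
        alg_monoid (@Xbar K m mt) mubar' /\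
        monoid_iso (@Xbar K m mt) mubar (@Xbar K m mt) mubar' psi,
        (forall x, Xbar x -> pi (psi x) = phi (pi x)) /\ coherent pi mu' mubar'
      & product_formulas mubar'].
Proof.
move=> monX monXb coh formulas; exists mu, mubar, id, id.
by split=> //; split=> //; apply: monoid_iso_id.
Qed.
End SameNormalForm.

Definition toric_normal_form (K : closedFieldType) N (X : aset K N) mu n r : Prop :=
  exists (act : 'rV[K]_n -> 'rV[K]_N -> 'rV[K]_N) (x0 : 'rV[K]_N)
         (m mt : nat) (p : 'I_m -> 'rV[int]_n) (b : 'I_mt -> 'rV[int]_n)
         (pi : 'rV[K]_(m + mt) -> 'rV[K]_N)
         (mubar : 'rV[K]_(m + mt) -> 'rV[K]_(m + mt) -> 'rV[K]_(m + mt)),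
    [/\ toric_action X act x0, cox_construction X act x0 p b pi,
        alg_monoid (@Xbar K m mt) mubar, coherent pi mu mubar
      & product_formulas X r p b pi mubar].

Section RootMonomial.
Variables (K : closedFieldType) (n m mt : nat).
Variables (p : 'I_m -> 'rV[int]_n) (b : 'I_mt -> 'rV[int]_n).
Variables (i : 'I_m) (e : 'rV[int]_n).
Hypothesis root_e : demazure_root p i e.
Notation XB := (@Xbar K m mt).
Notation R := (root_monomial p b i e).
Implicit Types x y z : 'rV[K]_(m + mt).

(** The monomial omits the coordinate [i], the only one in which [mul_root] differs
    from the product. *)
Lemma root_monomial_mul x y : R (mul_root p b i e x y) = R x * R y.
Proof.
rewrite /root_monomial mulrACA -!big_split; congr (_ * _); apply: eq_bigr => j.
  move=> ji; rewrite mxE (inj_eq (@lshift_inj _ _)) (negPf ji).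
  by rewrite expfzMl.
by move=> _; rewrite mxE eq_rlshift expfzMl.
Qed.

Lemma mul_rootE x y k : mul_root p b i e x y 0 k =
  if k == lshift mt i then x 0 k * R y + R x * y 0 k else x 0 k * y 0 k.
Proof. by rewrite mxE. Qed.

Lemma mul_root_Xbar x y : XB x -> XB y -> XB (mul_root p b i e x y).
Proof. by move=> Xx Xy j; rewrite mul_rootE eq_rlshift mulf_neq0. Qed.

Lemma root_monomial_gfrac : gfrac XB R.
Proof.
apply: gfracM; last first.
  apply: gfrac_prod => j; apply: gfrac_expz; last exact: gfrac_coord.
  by right=> x; apply.
(* The factor with exponent -1 is the excluded one. *)
apply: (@gfrac_ext _ _ _ (fun x => \prod_(j < m)
    if j != i then x 0 (lshift mt j) ^ pairing (p j) e else 1)).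
  by move=> x _; rewrite [RHS]big_mkcond.
apply: gfrac_prod => j; case: (eqVneq j i) => ji; first exact: gfracC.
apply: gfrac_expz; last exact: gfrac_coord.
by left; apply: root_e.2.
Qed.

Lemma mul_root_gfrac k :
  gfrac (prod_set XB XB) (fun t => mul_root p b i e (lsubmx t) (rsubmx t) 0 k).
Proof.
have Gl := gfrac_lsub XB (gfrac_coord XB k).
have Gr := gfrac_rsub XB (gfrac_coord XB k).
have Rl := gfrac_lsub XB root_monomial_gfrac.
have Rr := gfrac_rsub XB root_monomial_gfrac.
case: (boolP (k == lshift mt i)) => ki.
  by apply: gfrac_ext (gfracD (gfracM Gl Rr) (gfracM Rl Gr)) => z _; rewrite mul_rootE ki.
by apply: gfrac_ext (gfracM Gl Gr) => z _; rewrite mul_rootE (negPf ki).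
Qed.

Lemma root_monomial_ones x : (forall k, k != lshift mt i -> x 0 k = 1) -> R x = 1.
Proof.
move=> x1; rewrite /root_monomial !big1 ?mulr1 // => j.
  by move=> _; rewrite x1 ?exp1rz // eq_rlshift.
by move=> ji; rewrite x1 ?exp1rz // (inj_eq (@lshift_inj _ _)).
Qed.

Lemma mul_root_monoid (charK : [pchar K] =i pred0) :
  alg_monoid XB (mul_root p b i e).
Proof.
pose one : 'rV[K]_(m + mt) := \row_k (if k == lshift mt i then 0 else 1).
have R1 : R one = 1 by apply: root_monomial_ones => k /negPf ki; rewrite mxE ki.
apply: (Xbar_monoid charK mul_root_Xbar mul_root_gfrac (one := one)).
  move=> x y z _ _ _; apply/rowP => k; rewrite !mul_rootE !root_monomial_mul.
  by case: eqP => _; ring.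
split=> [j|x _]; first by rewrite mxE eq_rlshift oner_neq0.
split; apply/rowP => k; rewrite mul_rootE R1 mxE; case: eqP => _; ring.
Qed.
End RootMonomial.

Section CoordinatewiseProduct.
Variables (K : closedFieldType) (m mt : nat).
Notation XB := (@Xbar K m mt).

Lemma coordinatewise_monoid (charK : [pchar K] =i pred0) :
  alg_monoid XB (fun x y => \row_k (x 0 k * y 0 k)).
Proof.
apply: (Xbar_monoid charK (one := const_mx 1)).
- by move=> x y Xx Xy j; rewrite mxE mulf_neq0.
- move=> k; apply: gfrac_ext (gfracM (gfrac_lsub XB (gfrac_coord XB k))
    (gfrac_rsub XB (gfrac_coord XB k))) => z _.
  by rewrite [RHS]mxE.
- by move=> x y z _ _ _; apply/rowP => k; rewrite !mxE mulrA.
split=> [j|x _]; first by rewrite mxE oner_neq0.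
by split; apply/rowP => k; rewrite !mxE ?mulr1 ?mul1r.
Qed.
End CoordinatewiseProduct.

(** * Ranks n and n - 1 *)

Section Cases.
Variables (K : closedFieldType) (charK : [pchar K] =i pred0).
Variables (N : nat) (X : aset K N) (mu : 'rV[K]_N -> 'rV[K]_N -> 'rV[K]_N).
Hypotheses (clX : zariski_closed X) (irrX : irreducible X) (monX : alg_monoid X mu).

(** For s = 0 the chart is defined on a torus, and [cox_torus] turns coordinatewise
    products into products. *)
Lemma normal_form_torus r (phi : 'rV[K]_(r + 0) -> 'rV[K]_N) d :
  chart X mu phi d -> r != 0%N -> toric_normal_form X mu (r + 0) r.
Proof.
move=> ch r_neq0; have msplit := monomials_split_torus charK clX monX ch.
have [E [c [F [EF phiE]]]] := chart_expansion charK ch msplit.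
have [m [p [pinj rays]]] := finitely_many_rays
  (sigma_generated charK clX ch EF phiE).
have [mt [b splitb]] := saturated_complement (sigma X (torus_act E c F) (base_point phi)).
have p_sig j : sigma X (torus_act E c F) (base_point phi) (toQ (p j)).
  by apply: primitive_on_ray_in; apply/rays; exists j.
pose mubar (x y : 'rV[K]_(m + mt)) : 'rV[K]_(m + mt) := \row_k (x 0 k * y 0 k).
have monXb : alg_monoid (@Xbar K m mt) mubar by apply: coordinatewise_monoid.
exists (torus_act E c F), (base_point phi), m, mt, p, b, (cox_pi E c p b), mubar.
split=> //.
- exact: (torus_act_toric clX irrX ch EF phiE).
- exact: (cox_pi_construction charK clX ch EF phiE p_sig).
- apply: (coherent_on_torus charK clX monX ch EF phiE p_sig).
  + by move=> x y Xx Xy j; rewrite mxE mulf_neq0.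
  + move=> k; apply: gfrac_ext (gfracM (gfrac_lsub _ (gfrac_coord _ k))
      (gfrac_rsub _ (gfrac_coord _ k))) => z _.
    by rewrite [RHS]mxE.
  + by move=> k; rewrite !mxE mulr1 oner_neq0.
  move=> x y tx ty _; apply/rowP => k; rewrite !mxE.
  case: (split k) => [j|[]//]; rewrite mulrACA -!big_split /=.
  by congr (_ * _); apply: eq_bigr => l _; rewrite mxE expfzMl.
split=> [//|rn|r0]; last by rewrite r0 in r_neq0.
by exfalso; move: rn; clear; lia.
Qed.

Section OneAdditiveCoordinateCone.
Variables (r : nat) (phi : 'rV[K]_(r + 1) -> 'rV[K]_N) (d : {mpoly K[N]}).
Hypothesis ch : chart X mu phi d.
Notation last := (rshift r (ord0 : 'I_1)).
Notation eps := (delta_mx 0 last : 'rV[int]_(r + 1)).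
Variable C : 'rV[rat]_(r + 1) -> Prop.
Hypothesis CW : forall x, C x <-> forall u, weight phi u -> 0 <= pairing x (toQ u).

(** The projection of an exponent along the additive coordinate. *)
Definition ground (u : 'rV[int]_(r + 1)) : 'rV[int]_(r + 1) := row_mx (lsubmx u) 0.

Lemma weight_ground u : weight phi u -> weight phi (ground u).
Proof.
move=> wu; apply: (weight_lower charK clX monX ch wu).
- by move=> j; rewrite row_mxEr mxE.
- by rewrite row_mxKl.
by rewrite row_mxEr mxE; apply: wu.1.
Qed.

Lemma eps_in : C (toQ eps).
Proof.
apply/CW => u [uok _]; rewrite pairing_toQ ler0z pairing_deltal; exact: uok.
Qed.

Lemma ground_split (u : 'rV[int]_(r + 1)) : u = ground u + u 0 last *: eps.
Proof.
apply/rowP => k; rewrite -(splitK k); case: split => j /=; rewrite !mxE.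
  by rewrite (unsplitK (inl j)) eq_lrshift mulr0 addr0 mxE.
by rewrite (unsplitK (inr j)) mxE add0r !ord1 !eqxx mulr1.
Qed.

(** The required functional is a sum of weights with last coordinate zero; by
    [weight_neighbours] and [weight_ground] there are enough of them to span the
    hyperplane orthogonal to [eps]. *)
Lemma eps_ray : primitive_on_ray C eps.
Proof.
split; first exact: primitive_delta.
have msplit := monomials_split_one charK clX monX ch.
have [a Ha] : exists a : 'I_r -> 'rV[int]_(r + 1), forall j,
    [/\ weight phi (a j), weight phi (a j + delta_mx 0 (lshift 1 j)) & a j 0 last = 0].
  apply: (fin_all_exists (P := fun j u => [/\ weight phi u,
    weight phi (u + delta_mx 0 (lshift 1 j)) & u 0 last = 0])) => j.
  have [u [wu wu1]] := weight_neighbours charK ch msplit (lshift 1 j).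
  exists (ground u); split; [exact: weight_ground| |by rewrite row_mxEr mxE].
  suff <- : ground (u + delta_mx 0 (lshift 1 j)) =
    ground u + delta_mx 0 (lshift 1 j) by apply: weight_ground.
  apply/rowP => k; rewrite -(splitK k); case: split => l /=; rewrite !mxE.
    by rewrite (unsplitK (inl l)) !mxE.
  by rewrite (unsplitK (inr l)) !mxE eq_rlshift andbF addr0.
pose f : 'rV[rat]_(r + 1) :=
  \sum_j (toQ (a j) + toQ (a j + delta_mx 0 (lshift 1 j))).
have pair_ge0 x j : C x -> 0 <= pairing x (toQ (a j)) /\
    0 <= pairing x (toQ (a j + delta_mx 0 (lshift 1 j))).
  by move=> /CW Cx; have [w1 w2 _] := Ha j; split; apply: Cx.
have fE x : pairing x f = \sum_j (pairing x (toQ (a j)) +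
    pairing x (toQ (a j + delta_mx 0 (lshift 1 j)))).
  by rewrite /f pairing_sumr; apply: eq_bigr => j _; rewrite pairingDr.
exists f => [x Cx|x].
  rewrite pairingC fE; apply: sumr_ge0 => j _; have [h1 h2] := pair_ge0 x j Cx.
  exact: addr_ge0.
split=> [[k k_ge0 ->]|[Cx /eqP]].
  split.
    apply/CW => u wu; rewrite pairingZl mulr_ge0 //.
    exact: (CW _).1 eps_in u wu.
  rewrite pairingZl toQ_delta fE big1 ?mulr0 // => j _.
  rewrite !pairing_deltal toQD toQ_delta; have [_ _ a0] := Ha j.
  by rewrite !mxE a0 eq_rlshift andbF !addr0.
rewrite fE psumr_eq0 => [/allP f0|j _]; last first.
  by have [h1 h2] := pair_ge0 x j Cx; apply: addr_ge0.
have x0 j : x 0 (lshift 1 j) = 0.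
  have := f0 j (mem_index_enum j); have [h1 h2] := pair_ge0 x j Cx.
  rewrite implyTb paddr_eq0 // toQD pairingDr toQ_delta pairing_deltar.
  by move=> /andP[/eqP -> /eqP]; rewrite add0r.
have xE : x = x 0 last *: toQ eps.
  apply/rowP => k; rewrite -(splitK k); case: split => l /=; rewrite !mxE.
    by rewrite x0 eq_lrshift andbF mulr0.
  by rewrite !ord1 !eqxx mulr1.
exists (x 0 last) => //.
have [u [[uok _] wu1]] := weight_neighbours charK ch msplit last.
have := (CW _).1 Cx _ wu1; rewrite {1}xE pairingZl pairing_toQ pairing_deltal !mxE !eqxx.
rewrite pmulr_lge0 // ltr0z ltr_wpDl //; exact: uok.
Qed.

(** Weights may be lowered to last coordinate zero, so if v had a positive last
    coordinate c, then v - c eps would be in the cone.  The ray of v would then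
    contain its summand c eps. *)
Lemma other_ray_le0 v : primitive_on_ray C v -> v != eps -> v 0 last <= 0.
Proof.
move=> rv ve; rewrite leNgt; apply/negP => pos; move/eqP: ve; apply.
have Cv := primitive_on_ray_in rv; have [pv [f fC fE]] := rv.
have Cv0 : C (toQ (v - v 0 last *: eps)).
  apply/CW => u wu; rewrite pairing_toQ ler0z.
  have -> : pairing (v - v 0 last *: eps) u = pairing v (ground u).
    have -> : ground u = u - u 0 last *: eps.
      by apply/eqP; rewrite eq_sym subr_eq -ground_split.
    rewrite -scaleNr pairingDl pairingZl pairing_deltal.
    by rewrite -scaleNr pairingDr pairingZr pairing_deltar mulrC mulNr mulrN mulrC.
  by rewrite -(ler0z rat) -pairing_toQ; apply: (CW _).1 Cv _ (weight_ground wu).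
have v0 : pairing (toQ v) f = 0.
  by have [] := (fE (toQ v)).1 (ex_intro2 _ _ 1 ler01 (esym (scale1r _))).
have posQ : 0 < ((v 0 last)%:~R : rat) by rewrite ltr0z.
have e0 : pairing (toQ eps) f = 0.
  have := fC _ Cv0; rewrite pairingC toQB toQZ -scaleNr pairingDl pairingZl v0 add0r.
  rewrite mulNr oppr_ge0 pmulr_rle0 // => le0.
  by apply/eqP; rewrite eq_le le0 pairingC (fC _ eps_in).
have [k k_ge0 ek] := (fE (toQ eps)).2 (conj eps_in e0).
apply/esym/(primitive_proportional pv _ k_ge0 ek); exact: primitive_delta.
Qed.

End OneAdditiveCoordinateCone.

(** Let i be the index of the ray of [eps] and e = - eps.  In Cox coordinates the
    additive coordinate of G is the quotient of x_i by the monomial of e, so the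
    sum z + z' becomes [mul_root]. *)
Lemma normal_form_corank_one r (phi : 'rV[K]_(r + 1) -> 'rV[K]_N) d :
  chart X mu phi d -> r != 0%N -> toric_normal_form X mu (r + 1) r.
Proof.
move=> ch r_neq0; have msplit := monomials_split_one charK clX monX ch.
have [E [c [F [EF phiE]]]] := chart_expansion charK ch msplit.
have sgen := sigma_generated charK clX ch EF phiE.
have sweight := sigmaP charK clX ch EF phiE.
have [m [p [pinj rays]]] := finitely_many_rays sgen.
have [mt [b splitb]] := saturated_complement (sigma X (torus_act E c F) (base_point phi)).
have p_sig j : sigma X (torus_act E c F) (base_point phi) (toQ (p j)).
  by apply: primitive_on_ray_in; apply/rays; exists j.
pose last := rshift r (ord0 : 'I_1).
have [i pi_eps] := (rays _).1 (eps_ray ch sweight).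
pose e : 'rV[int]_(r + 1) := - delta_mx 0 last.
have pe v : pairing v e = - v 0 last.
  by rewrite /e -scaleN1r pairingZr pairing_deltar mulN1r.
have root_e : demazure_root p i e.
  split=> [|j ji]; rewrite pe; first by rewrite -pi_eps mxE !eqxx.
  rewrite oppr_ge0; apply: (other_ray_le0 ch sweight); first by apply/rays; exists j.
  by rewrite pi_eps (inj_eq pinj).
pose mubar := @mul_root K _ m mt p b i e.
have monXb : alg_monoid (@Xbar K m mt) mubar := mul_root_monoid b root_e charK.
exists (torus_act E c F), (base_point phi), m, mt, p, b, (cox_pi E c p b), mubar.
split=> //.
- exact: (torus_act_toric clX irrX ch EF phiE).
- exact: (cox_pi_construction charK clX ch EF phiE p_sig).
- apply: (coherent_on_torus charK clX monX ch EF phiE p_sig).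
  + exact: mul_root_Xbar.
  + exact: mul_root_gfrac.
  + have R1 : root_monomial p b i e (@torus_one K (m + mt)) = 1.
      by apply: root_monomial_ones => k _; rewrite mxE.
    move=> k; rewrite mul_rootE R1 !mxE !mulr1; case: ifP => _.
      by rewrite -mulr2n two_neq0.
    by rewrite oner_neq0.
  move=> x y tx ty txy; apply/rowP => k; rewrite -(splitK k).
  have Rn0 z : torus z -> root_monomial p b i e z != 0.
    by move=> tz; rewrite mulf_neq0 //; apply/prodf_neq0 => j _; rewrite expfz_neq0.
  case: split => j /=; rewrite [RHS]mxE ?(unsplitK (inl j)) ?(unsplitK (inr j)).
    rewrite !mxE mulrACA -!big_split; congr (_ * _); apply: eq_bigr => l _.
      case: (eqVneq l i) => [->|li]; last first.
        by rewrite mul_rootE (inj_eq (@lshift_inj _ _)) (negPf li) expfzMl.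
      by rewrite -pi_eps [delta_mx _ _ _ _]mxE eq_lrshift andbF !expr0z /= mulr1.
    by rewrite mul_rootE eq_rlshift expfzMl.
  rewrite [j]ord1 -/last.
  (* The additive coordinate of G, read in Cox coordinates. *)
  have lastE z : torus z ->
      cox_torus p b z 0 last = z 0 (lshift mt i) / root_monomial p b i e z.
    move=> tz; rewrite mxE (bigD1 i) //= -pi_eps mxE !eqxx expr1z -mulrA.
    congr (_ * _); rewrite /root_monomial invfM -!prodfV.
    by congr (_ * _); apply: eq_bigr => l _; rewrite pe invr_expz opprK.
  rewrite !lastE // root_monomial_mul mul_rootE eqxx.
  by field; rewrite !Rn0.
split=> [rn|_|r0]; last by rewrite r0 in r_neq0.
  by exfalso; move: rn; clear; lia.
by exists i, e.
Qed.

End Cases.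

(** * Rank zero *)

(** On every line through the origin such a polynomial is a univariate one without
    roots. *)
Lemma nonvanishing_constant (K : closedFieldType) n (q : {mpoly K[n]}) :
  (forall x, pval q x != 0) -> forall x, pval q x = pval q 0.
Proof.
move=> q0 x; pose u : {poly K} := mmap polyC (fun i => x 0 i *: 'X) q.
have uE z : u.[z] = pval q (z *: x).
  rewrite /u /mmap horner_sum pvalE; apply: eq_bigr => m _.
  rewrite hornerM hornerC /mmap1 horner_prod; congr (_ * _).
  by apply: eq_bigr => k _; rewrite horner_exp hornerZ hornerX mxE mulrC.
have : size u == 1%N.
  apply: contraT => /closed_rootP[z]; rewrite /root uE.
  by rewrite (negPf (q0 _)).
move=> /size_poly1P[k _ uk]; have := uE 0; have := uE 1.
by rewrite scale1r scale0r uk !hornerC => <- <-.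
Qed.

Section Unipotent.
Variables (K : closedFieldType) (charK : [pchar K] =i pred0).
Variables (N : nat) (X : aset K N) (mu : 'rV[K]_N -> 'rV[K]_N -> 'rV[K]_N).
Hypotheses (clX : zariski_closed X) (irrX : irreducible X).
Variables (s : nat) (phi : 'rV[K]_(0 + s) -> 'rV[K]_N) (d : {mpoly K[N]}).
Hypothesis ch : chart X mu phi d.
Notation G := (@GmGa K 0 s).

Lemma vector_group_full g : G g.
Proof. by case. Qed.
Hint Resolve vector_group_full : core.

(** The elementary core of the closedness of unipotent orbits: on the chart, which
    is an affine space, [d] is a polynomial without zeros, hence a constant. *)
Lemma unipotent_unit_everywhere x : X x -> pval d x != 0.
Proof.
have [q [k qE]] := regular_GmGa_fraction charK (gfrac_regular (chart_pval_gfrac ch d)).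
have {k}qE g : pval q g = pval d (phi g).
  by rewrite qE // /units_poly big_ord0 pval1 expr1n divr1.
have q0 g : pval q g != 0 by rewrite qE (chart_open ch).
move=> Xx; suff /eqP : pval d x - pval q 0 = 0.
  by rewrite subr_eq0 => /eqP ->.
apply: (chart_dense irrX ch (f := fun x => pval d x - pval q 0)) Xx.
  by apply: gfracB; [exact: gfrac_pval|exact: gfracC].
by move=> g _; rewrite -qE (nonvanishing_constant q0) subrr.
Qed.

Lemma unipotent_inverse : exists inv : 'rV[K]_N -> 'rV[K]_(0 + s),
  [/\ forall j, gfrac X (fun x => inv x 0 j), forall g, inv (phi g) = g
    & forall x, X x -> phi (inv x) = x].
Proof.
have [pk Hpk] := chart_coords ch.
pose inv x : 'rV[K]_(0 + s) := \row_j (pval (pk j).1 x / pval d x ^+ (pk j).2).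
have invK g : inv (phi g) = g by apply/rowP => j; rewrite mxE -Hpk.
exists inv; split=> // [j|x Xx]; last first.
  by have [g _ ->] := chart_onto ch Xx (unipotent_unit_everywhere Xx); rewrite invK.
apply: (@gfrac_ext _ _ _ (fun x => pval (pk j).1 x * (pval d x ^+ (pk j).2)^-1)).
  by move=> x _; rewrite mxE.
apply: gfracM; first exact: gfrac_pval.
apply: gfracV => [x Xx|]; first by rewrite expf_neq0 ?unipotent_unit_everywhere.
exact/gfracX/gfrac_pval.
Qed.

Lemma exponent_ok_unipotent (u : 'rV[int]_(0 + s)) :
  exponent_ok u <-> forall i, 0 <= u 0 i.
Proof.
split=> [uok i|H j]; last exact: H.
by rewrite -(splitK i); case: split => [[]//|j] /=.
Qed.

Lemma weight_unipotent (u : 'rV[int]_(0 + s)) :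
  weight phi u <-> forall i, 0 <= u 0 i.
Proof.
split=> [[uok _]|u0]; first exact/exponent_ok_unipotent.
split; first exact/exponent_ok_unipotent.
have [inv [Ginv invK _]] := unipotent_inverse.
pose q : {mpoly K[0 + s]} := \prod_i 'X_i ^+ absz (u 0%R i).
have [p pE] := regular_on_closed charK clX
  (gfrac_regular (gfrac_pval_comp q Ginv)).
exists p => g Gg; rewrite -pE; last exact: (chart_in ch).
rewrite invK pval_prod; apply: eq_bigr => i _.
by rewrite pvalXn pvalX -{1}(gez0_abs (u0 i)).
Qed.

Lemma monomials_split_unipotent : monomials_split phi.
Proof.
move=> E c uE okE _ u uu _.
by have [_] : weight phi u by apply/weight_unipotent/exponent_ok_unipotent/okE.
Qed.

(** As [X] is an affine space, its weights are all nonnegative exponents.  The cone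
    is then the orthant, its rays are the basis vectors and [cox_pi] is [phi]. *)
Lemma normal_form_unipotent : toric_normal_form X mu (0 + s) 0.
Proof.
have [E [c [F [EF phiE]]]] := chart_expansion charK ch monomials_split_unipotent.
set C := sigma X (torus_act E c F) (base_point phi).
have CE x : C x <-> forall i, 0 <= x 0 i.
  rewrite /C (sigmaP charK clX ch EF phiE); split=> [H i|H u /weight_unipotent u0].
    have := H (delta_mx 0 i); rewrite toQ_delta pairing_deltar; apply.
    by apply/weight_unipotent => j; rewrite mxE; case: (_ && _).
  by apply: sumr_ge0 => i _; rewrite mulr_ge0 ?H // mxE ler0z.
pose p (i : 'I_(0 + s)) : 'rV[int]_(0 + s) := delta_mx 0 i.
pose b (j : 'I_0) : 'rV[int]_(0 + s) := 0.
have rays := orthant_rays CE.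
have p_sig j : C (toQ (p j)).
  by apply: primitive_on_ray_in; apply/rays; exists j.
have pinj : injective p.
  move=> i j /rowP/(_ i); rewrite !mxE !eqxx; case: eqP => // _ /eqP.
have splitb : splitting (lattice_span_sigma X (torus_act E c F) (base_point phi)) b.
  move=> v; exists (v, 0); split=> /=.
    split; last by rewrite big_ord0 addr0.
    exists (0 + s)%N, (fun i => toQ v 0 i), (fun i => toQ (p i)); split=> //.
    by rewrite [LHS]row_sum_delta; apply: eq_bigr => i _; rewrite toQ_delta.
  move=> [v0 c0] /= [_ ->]; rewrite big_ord0 addr0; congr (_, _).
  by apply/rowP => -[].
have cox_phi x : Xbar x -> cox_pi E c p b x = phi (lsubmx x).
  move=> Xx; apply/rowP => k.
  apply: (Xbar_dense charK (f := fun x => cox_pi E c p b x 0 k)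
    (g := fun x => phi (lsubmx x) 0 k)) Xx.
  - exact: (cox_pi_gfrac charK clX ch EF phiE b p_sig).
  - apply: (gfrac_comp (chart_gfrac ch k)) => // j.
    by apply: gfrac_ext (gfrac_coord _ (lshift 0 j)) => y _; rewrite mxE.
  move=> y ty; rewrite (cox_pi_torus phiE) //; congr (phi _ 0 k).
  apply/rowP => i; rewrite !mxE big_ord0 mulr1 (bigD1 i) //= mxE !eqxx expr1z.
  rewrite big1 ?mulr1 => [|j /negPf ji]; first by rewrite [RHS]mxE.
  by rewrite mxE eq_sym ji andbF expr0z.
pose mubar (x y : 'rV[K]_(0 + s + 0)) : 'rV[K]_(0 + s + 0) := \row_k (x 0 k + y 0 k).
have full (x : 'rV[K]_(0 + s + 0)) : @Xbar K (0 + s) 0 x by case.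
have monXb : alg_monoid (@Xbar K (0 + s) 0) mubar.
  apply: (Xbar_monoid charK (one := 0)) => //.
  - move=> k; apply: gfrac_ext (gfracD (gfrac_lsub _ (gfrac_coord _ k))
      (gfrac_rsub _ (gfrac_coord _ k))) => z _.
    by rewrite [RHS]mxE.
  - by move=> x y z _ _ _; apply/rowP => k; rewrite !mxE addrA.
  by split=> // x _; split; apply/rowP => k; rewrite !mxE ?addr0 ?add0r.
have coh : coherent (cox_pi E c p b) mu mubar.
  move=> x y Xx Xy; rewrite !cox_phi // -(chart_mul ch) //; congr phi.
  apply/rowP => k; rewrite !mxE; case: split => [[]//|j].
  by [].
exists (torus_act E c F), (base_point phi), (0 + s)%N, 0%N, p, b, (cox_pi E c p b), mubar.
split=> //.
- exact: (torus_act_toric clX irrX ch EF phiE).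
- exact: (cox_pi_construction charK clX ch EF phiE p_sig).
split.
- move=> s0 x y _ _; apply/rowP => k; have := ltn_ord k.
  by move: s0; clear; lia.
- (* On the affine line the sum is also the product of rank n - 1 = 0, the root
     monomial being 1. *)
  move=> s1; have lt0 : (0 < 0 + s)%N by move: s1; clear; lia.
  have uniqI (j : 'I_(0 + s)) : j = Ordinal lt0.
    by apply/val_inj; have := ltn_ord j; move: s1; clear => /=; lia.
  exists (Ordinal lt0), (- delta_mx 0 (Ordinal lt0)); split.
    split; last by move=> j; rewrite [j]uniqI eqxx.
    by rewrite -scaleN1r pairingZr pairing_deltar mxE !eqxx.
  move=> x y _ _; apply/rowP => k; rewrite !mxE.
  have -> : k = lshift 0 (Ordinal lt0).
    by rewrite -[k]splitK; case: split => [j|[]//] /=; rewrite [j]uniqI.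
  rewrite eqxx /root_monomial !big_ord0 !big1 ?mulr1 ?mul1r // => j;
    by rewrite [j]uniqI eqxx.
move=> _; split=> //.
have [inv [Ginv invK phiK]] := unipotent_inverse.
exists (fun x => row_mx (inv x) 0); split.
- apply: gfrac_morphism => [x _|k].
    by rewrite cox_phi //; apply: (chart_in ch).
  exact: (cox_pi_gfrac charK clX ch EF phiE b p_sig).
- apply: gfrac_morphism => // j; rewrite -(splitK j); case: split => [i|[]//] /=.
  by apply: gfrac_ext (Ginv i) => x _; rewrite row_mxEl.
split=> [x Xx|x Xx].
  rewrite cox_phi // invK -[RHS]hsubmxK; congr row_mx.
  by apply/rowP => -[].
by rewrite cox_phi // row_mxKl phiK.
Qed.

End Unipotent.

Theorem theorem2 (K : closedFieldType) (charK : [pchar K] =i pred0)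
    (N : nat) (X : aset K N) (n r : nat)
    (mu : 'rV[K]_N -> 'rV[K]_N -> 'rV[K]_N)
    (affX : affine_variety X) (normX : normal_affine X) (dimX : has_dim X n)
    (monX : alg_monoid X mu) (comX : commutative_on X mu)
    (rkX : monoid_rank X mu r) (hr : r = 0%N \/ r.+1 = n \/ r = n) :
  affine_toric X /\
  exists (act : 'rV[K]_n -> 'rV[K]_N -> 'rV[K]_N) (x0 : 'rV[K]_N)
         (m mt : nat) (p : 'I_m -> 'rV[int]_n) (b : 'I_mt -> 'rV[int]_n)
         (pi : 'rV[K]_(m + mt) -> 'rV[K]_N)
         (mubar : 'rV[K]_(m + mt) -> 'rV[K]_(m + mt) -> 'rV[K]_(m + mt)),
    [/\ toric_action X act x0,
        cox_construction X act x0 p b pi,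
        alg_monoid (@Xbar K m mt) mubar,
        coherent pi mu mubar
      & exists (mu' : 'rV[K]_N -> 'rV[K]_N -> 'rV[K]_N)
               (mubar' : 'rV[K]_(m + mt) -> 'rV[K]_(m + mt) -> 'rV[K]_(m + mt))
               (phi : 'rV[K]_N -> 'rV[K]_N)
               (psi : 'rV[K]_(m + mt) -> 'rV[K]_(m + mt)),
          [/\ alg_monoid X mu' /\ monoid_iso X mu X mu' phi,
              alg_monoid (@Xbar K m mt) mubar' /\
              monoid_iso (@Xbar K m mt) mubar (@Xbar K m mt) mubar' psi,
              (forall x, Xbar x -> pi (psi x) = phi (pi x)) /\
              coherent pi mu' mubar'
            & [/\ r = n ->
                    forall x y, Xbar x -> Xbar y ->
                      mubar' x y = \row_k (x 0 k * y 0 k),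
                  r.+1 = n ->
                    exists (i : 'I_m) (e : 'rV[int]_n), demazure_root p i e /\
                      forall x y, Xbar x -> Xbar y ->
                        mubar' x y = mul_root p b i e x y
                & r = 0%N ->
                    [/\ m = n, mt = 0%N, var_iso (@Xbar K m mt) X pi
                      & forall x y, Xbar x -> Xbar y ->
                          mubar' x y = \row_k (x 0 k + y 0 k)]]]].
Proof.
have [clX irrX] := affX; have [s [phi iso]] := rkX.
have [d ch] := chart_exists charK affX monX comX iso.
have nE : n = (r + s)%N.
  apply/eqP; rewrite eqn_leq (dim_ge charK irrX ch dimX clX).
  exact: (dim_le charK ch dimX clX).
have nf : toric_normal_form X mu n r.
  subst n; case: (eqVneq r 0%N) => [r0|r0].
    subst r; exact: (normal_form_unipotent charK clX irrX ch).
  case: hr => [/eqP|[rs|rs]]; first by rewrite (negPf r0).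
    have s1 : s = 1%N by move: rs; clear; lia.
    subst s; exact: (normal_form_corank_one charK clX irrX monX ch r0).
  have s0 : s = 0%N by move: rs; clear; lia.
  subst s; exact: (normal_form_torus charK clX irrX monX ch r0).
have [act [x0 [m [mt [p [b [pi [mubar [tor cox monb coh formulas]]]]]]]]] := nf.
split; first by split=> //; exists n, act, x0.
exists act, x0, m, mt, p, b, pi, mubar; split=> //.
exact: already_normal.
Qed.
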